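(* There exists an absolute constant $C>0$ such that the following holds. Let $d\ge 1$ be an integer, let $a_1,\dots,a_d>0$, $b_1,\dots,b_d>0$ and $\gamma>0$, and let $p\in[1,+\infty]$. Let $\Pi\subset\mathbb{R}^d$ be a parallelepiped with sides of length $a_1,\dots,a_d$ parallel to the coordinate axes, and let $E\subset\mathbb{R}^d$ be a measurable set such that $|E\cap(\Pi+x)|\ge\gamma|\Pi|$ for every $x\in\mathbb{R}^d$. Let $J\subset\mathbb{R}^d$ be a parallelepiped with sides of length $b_1,\dots,b_d$ parallel to the coordinate axes. If $f\in L^p(\mathbb{R}^d)$ and $\operatorname{supp}\hat f\subset J$, then $$\|f\|_{L^p(E)}\ \ge\ \left(\frac{\gamma}{C^d}\right)^{C\left(d+\sum_{k=1}^d a_kb_k\right)}\|f\|_p.$$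
   Context: $|\cdot|$ denotes Lebesgue measure on $\mathbb{R}^d$. Functions are complex valued. $\hat f$ is the Fourier transform of $f$, taken in the sense of tempered distributions, with kernel $e^{-ix\cdot\xi}$. $\|f\|_p$ is the norm in $L^p(\mathbb{R}^d)$ and $\|f\|_{L^p(E)}$ is the $L^p$ norm of the restriction of $f$ to $E$. The sides of length $a_k$ (of $\Pi$) and $b_k$ (of $J$) are those parallel to the $k$-th coordinate axis. The constant $C$ does not depend on $d$, $a_k$, $b_k$, $\gamma$, $p$, $E$, $J$, $f$. *)

(* Defs.v *)
From HB Require Import structures.
From mathcomp Require Import all_boot all_order all_algebra.
From mathcomp Require Import all_classical all_reals all_analysis.
From mathcomp Require Import complex.

Set Implicit Arguments.
Unset Strict Implicit.
Unset Printing Implicit Defensive.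

Import Order.TTheory GRing.Theory Num.Theory numFieldNormedType.Exports.

Local Open Scope classical_set_scope.
Local Open Scope ring_scope.
Local Open Scope complex_scope.

(* Lebesgue measure on the Borel sets of R^n, as an iterated product of the
   one-dimensional one. *)
Section TupleLebesgue.
Context {R : realType}.
Local Open Scope ereal_scope.
Local Notation Rtuple n := (n.-tuple (measurableTypeR R)).

Definition tuple_cons {n} (u : measurableTypeR R * Rtuple n) : Rtuple n.+1 :=
  [tuple of u.1 :: u.2].

Lemma measurable_tuple_cons n : measurable_fun [set: _] (@tuple_cons n).
Proof. exact: measurable_cons. Qed.

Section Step.
Context (n : nat) (mu : {sigma_finite_measure set (Rtuple n) -> \bar R}).

Definition tuple_prod : set (Rtuple n.+1) -> \bar R :=
  pushforward (@lebesgue_measure R \x mu) tuple_cons.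

Let tuple_prod0 : tuple_prod set0 = 0.
Proof. exact: (measure0 (lebesgue_measure \x mu)). Qed.

Let tuple_prod_ge0 A : 0 <= tuple_prod A.
Proof. exact: (measure_ge0 (lebesgue_measure \x mu)). Qed.

Let tuple_prod_sigma_additive : semi_sigma_additive tuple_prod.
Proof.
apply: (@measure_semi_sigma_additive _ _ _
  (pushforward (@lebesgue_measure R \x mu) tuple_cons)).
exact: measurable_tuple_cons.
Qed.

HB.instance Definition _ := isMeasure.Build _ _ _ tuple_prod
  tuple_prod0 tuple_prod_ge0 tuple_prod_sigma_additive.

Let tuple_uncons (t : Rtuple n.+1) : measurableTypeR R * Rtuple n :=
  (thead t, [tuple of behead t]).

Let tuple_prod_sigma_finite : sigma_finite setT tuple_prod.
Proof.
have /sigma_finiteP[F [FT ndF Foo]] := sigma_finiteT (@lebesgue_measure R).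
have /sigma_finiteP[G [GT ndG Goo]] := sigma_finiteT mu.
exists (fun k => tuple_uncons @^-1` (F k `*` G k)).
  apply/esym; rewrite -subTset => t _.
  have [i _ Fi] : (\bigcup_i F i) (thead t) by rewrite -FT.
  have [j _ Gj] : (\bigcup_j G j) [tuple of behead t] by rewrite -GT.
  exists (maxn i j) => //; split => /=.
    by move: Fi; exact/subsetPset/ndF/leq_maxl.
  by move: Gj; exact/subsetPset/ndG/leq_maxr.
move=> k; have [mF Fk] := Foo k; have [mG Gk] := Goo k; split.
  rewrite -[X in measurable X]setTI.
  apply: measurable_fun_pair => //; last exact: measurableX.
  + exact: measurable_tnth.
  + exact: measurable_behead.
rewrite /= /tuple_prod /pushforward (_ : _ @^-1` _ = F k `*` G k); last first.
  rewrite -comp_preimage (_ : _ \o _ = id)//; apply/funext => -[x t] /=.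
  by congr pair; exact: val_inj.
by rewrite product_measure1E// lte_mul_pinfty// ge0_fin_numE.
Qed.

HB.instance Definition _ := @Measure_isSigmaFinite.Build _ _ _ tuple_prod
  tuple_prod_sigma_finite.

End Step.

Fixpoint tuple_lebesgue n : {sigma_finite_measure set (Rtuple n) -> \bar R} :=
  match n with
  | 0%N => \d_([tuple] : Rtuple 0)
  | m.+1 => tuple_prod (tuple_lebesgue m)
  end.

End TupleLebesgue.

(* Transport to row vectors (which carry the topology and the norm), followed
   by Caratheodory completion: [lebesgue_rV R n] is 'rV[R]_n with the
   sigma-algebra of all Lebesgue measurable sets. *)
Section RowLebesgue.
Context (R : realType) (n : nat).
Local Open Scope ereal_scope.
Local Notation Rtuple := (n.-tuple (measurableTypeR R)).

Definition tuple_of_rV (x : 'rV[R]_n) : Rtuple := [tuple x ord0 k | k < n].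

Definition rV_borel := g_sigma_algebra_preimageType tuple_of_rV.
HB.instance Definition _ := Measurable.on rV_borel.

Definition rV_of_tuple (t : Rtuple) : rV_borel := \row_k tnth t k.

Lemma rV_of_tupleK : cancel rV_of_tuple tuple_of_rV.
Proof. by move=> t; apply: eq_from_tnth => k; rewrite tnth_mktuple mxE. Qed.

Lemma measurable_rV_of_tuple : measurable_fun [set: Rtuple] rV_of_tuple.
Proof.
move=> _ _ [B mB <-]; rewrite !setTI -comp_preimage.
by rewrite (_ : _ \o _ = id)//; apply/funext/rV_of_tupleK.
Qed.

Definition borel_lebesgue : set rV_borel -> \bar R :=
  pushforward (tuple_lebesgue n) rV_of_tuple.

Let borel_lebesgue0 : borel_lebesgue set0 = 0.
Proof. exact: (measure0 (tuple_lebesgue n)). Qed.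

Let borel_lebesgue_ge0 A : 0 <= borel_lebesgue A.
Proof. exact: (measure_ge0 (tuple_lebesgue n)). Qed.

Let borel_lebesgue_sigma_additive : semi_sigma_additive borel_lebesgue.
Proof.
apply: (@measure_semi_sigma_additive _ _ _
  (pushforward (tuple_lebesgue n) rV_of_tuple)).
exact: measurable_rV_of_tuple.
Qed.

HB.instance Definition _ := isMeasure.Build _ _ _ borel_lebesgue
  borel_lebesgue0 borel_lebesgue_ge0 borel_lebesgue_sigma_additive.

Definition lebesgue_rV := caratheodory_type (borel_lebesgue^*)%mu.
HB.instance Definition _ := Measurable.on lebesgue_rV.

Definition lebesgue_measure_rV : set lebesgue_rV -> \bar R :=
  @completed_measure_extension _ _ _ borel_lebesgue.
HB.instance Definition _ := Measure.on lebesgue_measure_rV.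

End RowLebesgue.
Arguments borel_lebesgue {R n}.
Arguments lebesgue_measure_rV {R n}.

Section Lp.
Context {R : realType} {n : nat}.
Local Notation Rn := 'rV[R]_n.
Implicit Types (f : Rn -> R[i]) (E : set Rn) (p : \bar R).

Definition cmeasurable f :=
  measurable_fun [set: lebesgue_rV R n] (fun x => complex.Re (f x)) /\
  measurable_fun [set: lebesgue_rV R n] (fun x => complex.Im (f x)).

Definition cintegral f : R[i] :=
  (\int[lebesgue_measure_rV]_x complex.Re (f x)) +i*
  (\int[lebesgue_measure_rV]_x complex.Im (f x)).

Definition Lpnorm p E f : \bar R :=
  'N[lebesgue_measure_rV]_p[EFin \o ((fun x => Normc.normc (f x)) \_ E)]%E.

Definition in_Lp p f := cmeasurable f /\ (Lpnorm p [set: Rn] f < +oo)%E.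

End Lp.

Section Fourier.
Context {R : realType} {n : nat}.
Local Notation Rn := 'rV[R]_n.
Implicit Types (f phi : Rn -> R[i]) (u : Rn -> R) (U : set Rn)
  (T : (Rn -> R[i]) -> R[i]).

Definition partials (s : seq 'I_n) u : Rn -> R :=
  foldr (fun k v => 'D_(delta_mx ord0 k) v) u s.

Definition real_schwartz u :=
  (forall s x, differentiable (partials s u) x) /\
  (forall (k : nat) s, exists M, forall x,
    (1 + `|x|) ^+ k * `|partials s u x| <= M).

Definition schwartz phi :=
  real_schwartz (fun x => complex.Re (phi x)) /\
  real_schwartz (fun x => complex.Im (phi x)).

Definition dotrV (x y : Rn) : R := \sum_(k < n) x ord0 k * y ord0 k.

Definition expi (t : R) : R[i] := cos t +i* sin t.

Definition fourier phi : Rn -> R[i] :=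
  fun xi => cintegral (fun x => phi x * expi (- dotrV x xi)).

(* A tempered distribution is represented by its values on functions; only
   those on Schwartz functions are meaningful. *)
Definition fourier_distribution f : (Rn -> R[i]) -> R[i] :=
  fun phi => cintegral (fun x => f x * fourier phi x).

Definition fsupp phi : set Rn := closure [set x | phi x != 0].

Definition vanishes_on T U :=
  forall phi, schwartz phi -> compact (fsupp phi) -> fsupp phi `<=` U ->
    T phi = 0.

Definition distribution_supp T : set Rn :=
  ~` \bigcup_(U in [set U | open U /\ vanishes_on T U]) U.

End Fourier.

(* The parallelepiped with lowest corner [c] and side lengths [l]. *)
Definition box {R : realType} {n : nat} (c : 'rV[R]_n) (l : 'I_n -> R) :
    set 'rV[R]_n :=
  [set x | forall k, c ord0 k <= x ord0 k <= c ord0 k + l k].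

Definition translate {R : realType} {n : nat} (A : set 'rV[R]_n)
    (x : 'rV[R]_n) : set 'rV[R]_n :=
  [set y + x | y in A].

(* Main.v *)
(* The argument uses real variables only. Testing the spectral hypothesis on
   tensors of modulated cutoffs shows that, after centring its spectrum, f is
   reproduced by convolution with a kernel prod_k b_k K(b_k x_k), where K is the
   cosine transform of a smooth cutoff. Along a line segment of direction w in
   the box this kernel is a uniform limit of polynomials whose coefficients are
   dominated by those of an exponential of rate sum_k |b_k w_k|, with a majorant
   that decays like a product of Poisson kernels. Hence at a point x where the
   Poisson average of |f|^p is at most a constant^d times |f(x)|^p, Lagrange
   interpolation of f from about kappa (d + sum_k a_k b_k) nodes on a segment
   starting at x has an error smaller than |f(x)|/2. If |f| were tiny on most of
   E in the translate of the box at x, averaging over w would produce such nodes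
   with |f| tiny at all of them, a contradiction. So |f| >= delta |f(x)| on half
   of the guaranteed part of E there. Such points x carry half of the p-th power
   of the norm, and integrating over them with Tonelli concludes; for p = oo a
   single point x suffices. *)
Require Import Defs.
From HB Require Import structures.
From mathcomp Require Import all_boot all_order all_algebra.
From mathcomp Require Import all_classical all_reals all_analysis.
From mathcomp Require Import measurable_realfun ess_sup_inf complex ring lra.

Set Implicit Arguments.
Unset Strict Implicit.
Unset Printing Implicit Defensive.
Import Order.TTheory GRing.Theory Num.Theory numFieldNormedType.Exports.

Local Open Scope classical_set_scope.
Local Open Scope ring_scope.


(** * Lagrange interpolation on [0, 1] *)

(** Kernel, majorant and test functions are products over the coordinates, so each estimate is a
    one-dimensional constant raised to the power [d]; such powers are absorbed by a number of nodes
    proportional to [d]. The base then loses only a square of [gamma] and a factor linear in [d]: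
    the nodes are crowded near the far end of the segment, where [t ^+ d] stays close to 1, so that
    shrinking the box towards [x] costs almost no measure. The reproducing formula is obtained with
    an unknown factor. The spectrum lies where all cutoffs equal 1, so convolutions with the dilated
    kernels coincide; large dilations identify them with [cosker_mass ^+ n] times the function, and
    positivity of this mass is what makes the formula usable. Real and imaginary parts are
    interpolated separately but at the same nodes, where the modulus is small. For the [p]-th power
    the loss is [gamma / 4] times the level to the power [p], whose [p]-th root is bounded below
    uniformly in [p]. The data of the statement are Lebesgue measurable, while Tonelli is applied to
    tuples with Borel sets; hence the Borel model off a null set. *)

Section BinomialWeight.
Variable R : realFieldType.
Implicit Types (P Q : {poly R}) (t : R).

(* [binweight r P] bounds [P^(r) / r!] on [0, 1]. Dividing by ['X - t] with
   [t] in [0, 1] raises [r] by one without increasing the value, so the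
   interpolation error at [n] nodes costs only [r = n], with no Rolle argument. *)
Definition binweight r P : R := \sum_(m < size P) `|P`_m| * 'C(m, r)%:R.

Lemma binweight_widen r P n : (size P <= n)%N ->
  binweight r P = \sum_(m < n) `|P`_m| * 'C(m, r)%:R.
Proof.
move=> Pn; rewrite /binweight (big_ord_widen _ (fun m => `|P`_m| * 'C(m, r)%:R) Pn).
rewrite [RHS](bigID (fun m : 'I_n => (m < size P)%N)) /= [X in _ + X]big1 ?addr0// => m.
by rewrite -leqNgt => Pm; rewrite nth_default// normr0 mul0r.
Qed.

Lemma binweight_MXaddC0 P c :
  binweight 0 (P * 'X + c%:P) = binweight 0 P + `|c|.
Proof.
rewrite (@binweight_widen 0 _ (size P).+1); last first.
  rewrite (leq_trans (size_polyD _ _))// geq_max (leq_trans (size_polyMleq _ _))//.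
    by rewrite (leq_trans (size_polyC_leq1 _)).
  by rewrite size_polyX addn2.
rewrite big_ord_recl/= coefD coefMX coefC/= add0r bin0 mulr1 addrC; congr +%R.
by apply: eq_bigr => m _; rewrite coefD coefMX coefC/= addr0 !bin0.
Qed.

(** Pascal's rule: in a Horner step the weight of order [r.+1] collects those of orders [r.+1] and
    [r]. *)
Lemma binweight_MXaddCS r P c :
  binweight r.+1 (P * 'X + c%:P) = binweight r.+1 P + binweight r P.
Proof.
rewrite (@binweight_widen r.+1 _ (size P).+1); last first.
  rewrite (leq_trans (size_polyD _ _))// geq_max (leq_trans (size_polyMleq _ _))//.
    by rewrite (leq_trans (size_polyC_leq1 _)).
  by rewrite size_polyX addn2.
rewrite big_ord_recl/= bin0n mulr0 add0r -big_split/=.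
apply: eq_bigr => m _; rewrite coefD coefMX coefC/= addr0.
by rewrite /bump/= add1n binS natrD mulrDr.
Qed.

Lemma horner_le_binweight P t : 0 <= t <= 1 -> `|P.[t]| <= binweight 0 P.
Proof.
move=> /andP[t0 t1]; rewrite horner_coef (le_trans (ler_norm_sum _ _ _))//.
apply: ler_sum => m _; rewrite normrM bin0 mulr1 ler_piMr// normrX ger0_norm//.
by rewrite exprn_ile1.
Qed.

(** Horner's scheme: if [q] is the quotient of [P], that of [P * 'X + c] is [q * 'X + P.[t]]. At
    order 0 the new constant term costs at most [binweight 0 P], which is what Pascal's rule adds on
    the other side; at higher orders both sides obey the same recursion. *)
Lemma poly_divide_root P t : 0 <= t <= 1 ->
  exists q, P = q * ('X - t%:P) + (P.[t])%:P /\
    forall r, binweight r q <= binweight r.+1 P.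
Proof.
move=> t01; elim/poly_ind: P => [|P c [q [Pq wq]]].
  exists 0; rewrite mul0r horner0 add0r; split => // r.
  by rewrite /binweight !size_poly0 !big_ord0.
exists (q * 'X + (P.[t])%:P); split.
  rewrite {1}Pq hornerMXaddC polyCD polyCM; ring.
case=> [|r]; last by rewrite !binweight_MXaddCS lerD.
by rewrite binweight_MXaddC0 binweight_MXaddCS lerD// horner_le_binweight.
Qed.

(** Division by one node after the other: the remainder has size at most the number of nodes, hence
    is reproduced by interpolation, and the order grows by one per node. *)
Lemma poly_divide_roots P (ts : seq R) :
  {in ts, forall t, 0 <= t <= 1} ->
  exists Q S, [/\ P = Q * \prod_(t <- ts) ('X - t%:P) + S,
    (size S <= size ts)%N & forall r, binweight r Q <= binweight (r + size ts) P].
Proof.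
elim: ts P => [|t ts IH] P ts01.
  exists P, 0; rewrite big_nil mulr1 addr0 size_poly0; split => // r.
  by rewrite addn0.
have [q [Pq wq]] := poly_divide_root P (ts01 t (mem_head _ _)).
have [|Q [S [qQ sS wQ]]] := IH q.
  by move=> s sts; apply: ts01; rewrite inE sts orbT.
exists Q, (S * ('X - t%:P) + (P.[t])%:P); split.
- by rewrite {1}Pq {1}qQ big_cons; ring.
- rewrite (leq_trans (size_polyD _ _))// geq_max; apply/andP; split.
    by rewrite (leq_trans (size_polyMleq _ _))// size_XsubC addn2.
  by rewrite (leq_trans (size_polyC_leq1 _)).
- move=> r; rewrite (le_trans (wQ _))// (le_trans (wq _))//=.
  by rewrite addnS.
Qed.

End BinomialWeight.

Section Lagrange.
Variable R : realFieldType.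
Variables (n : nat) (t : 'I_n -> R).

(** The value at 0 of the Lagrange basis polynomial of node [i]. *)
Definition lagrange0 (i : 'I_n) : R := \prod_(j < n | j != i) (t j / (t j - t i)).

Lemma lagrange0_horner (P : {poly R}) : injective t -> (size P <= n)%N ->
  P.[0] = \sum_(i < n) lagrange0 i * P.[t i].
Proof.
move=> tinj Pn.
pose l i := \prod_(j < n | j != i) ((t i - t j)^-1 *: ('X - (t j)%:P)).
have li i k : (l i).[t k] = (i == k)%:R.
  rewrite /l horner_prod; have [->|ik] := eqVneq i k.
    rewrite big1 // => j jk; rewrite hornerZ hornerXsubC mulVf//.
    by rewrite subr_eq0; apply: contra_neq jk => /tinj.
  by rewrite (bigD1 k) 1?eq_sym//= hornerZ hornerXsubC subrr mulr0 mul0r.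
have sl i : (size (l i) <= n)%N.
  rewrite /l scaler_prod (leq_trans (size_scale_leq _ _))//.
  rewrite -big_filter (size_prod_XsubC _ t) size_filter -sum1_count sum1_card.
  by rewrite cardC1 card_ord prednK// (leq_ltn_trans _ (ltn_ord i)).
(* The difference has size at most [n] and the [n] distinct nodes as roots. *)
have PE : P = \sum_i P.[t i] *: l i.
  apply/eqP; rewrite -subr_eq0; apply/eqP.
  apply: (@roots_geq_poly_eq0 _ _ [seq t i | i <- enum 'I_n]).
  - apply/allP => x /mapP[k _ ->]; rewrite rootE hornerD hornerN.
    rewrite horner_sum (bigD1 k)//= hornerZ li eqxx mulr1.
    rewrite big1 ?addr0 ?subrr// => i ik.
    by rewrite hornerZ li (negbTE ik) mulr0.
  - by rewrite map_inj_uniq// enum_uniq.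
  - rewrite size_map size_enum_ord (leq_trans (size_polyD _ _))// geq_max Pn/=.
    rewrite size_polyN (leq_trans (size_sum _ _ _))//; apply/bigmax_leqP => i _.
    by rewrite (leq_trans (size_scale_leq _ _)).
rewrite {1}PE horner_sum; apply: eq_bigr => i _; rewrite hornerZ mulrC; congr *%R.
rewrite /l horner_prod; apply: eq_bigr => j ji; rewrite hornerZ hornerXsubC.
by rewrite sub0r mulrN mulrC -mulrN -invrN opprB.
Qed.

End Lagrange.

Section InterpolationError.
Variable R : realType.
Implicit Types (g h : R -> R) (M B : R).

Definition interp_err n (t : 'I_n -> R) (g : R -> R) : R :=
  g 0 - \sum_(i < n) lagrange0 t i * g (t i).

(** The remainder modulo the node polynomial is interpolated exactly, and the multiple of the node
    polynomial vanishes at the nodes. What is left is [Q.[0]] times the product of the [- t i], each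
    of modulus at most 1. *)
Lemma interp_err_poly n (t : 'I_n -> R) (P : {poly R}) : injective t ->
  (forall i, 0 <= t i <= 1) -> `|interp_err t (horner P)| <= binweight n P.
Proof.
move=> tinj t01.
have [|Q [S [PE sS wQ]]] := @poly_divide_roots _ P [seq t i | i <- enum 'I_n].
  by move=> _ /mapP[i _ ->].
rewrite size_map size_enum_ord in sS wQ.
rewrite /interp_err {1}PE hornerD (lagrange0_horner tinj sS) hornerM.
under [in X in _ - X]eq_bigr => i _.
  rewrite {1}PE hornerD hornerM horner_prod big_map (bigD1_seq i)/= ?mem_enum ?enum_uniq//.
  rewrite hornerXsubC subrr mul0r mulr0 add0r.
  over.
rewrite addrK normrM (le_trans _ (wQ 0))// (le_trans _ (horner_le_binweight Q (_ : 0 <= 0 <= 1)))//; last by rewrite lexx ler01.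
rewrite ler_piMr// horner_prod big_map normr_prod prodr_ile1// => i _.
by rewrite normr_ge0 hornerXsubC sub0r normrN; have /andP[t0 t1] := t01 i; rewrite ger0_norm.
Qed.

(* Pointwise limits of polynomials whose coefficients are dominated by those
   of [t |-> M exp (B t)]. *)
Definition expmaj M B g := exists P : nat -> {poly R},
  (forall N m, `|(P N)`_m| <= M * B ^+ m / m`!%:R) /\
  forall t, (fun N => (P N).[t]) @ \oo --> g t.

Lemma expmaj_cst c : expmaj `|c| 0 (cst c).
Proof.
exists (fun=> c%:P); split; last by move=> t /=; under eq_fun do rewrite hornerC; exact: cvg_cst.
move=> _ [|m]; rewrite coefC/= ?expr0 ?fact0 ?divr1 ?mulr1//.
by rewrite normr0 expr0n/= mulr0 mul0r.
Qed.

(** By the binomial theorem the Cauchy product of two exponential majorants is again one: constants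
    multiply and rates add. *)
Lemma expmajM M B g M' B' h : 0 <= M -> 0 <= B ->
  expmaj M B g -> expmaj M' B' h -> expmaj (M * M') (B + B') (g \* h).
Proof.
move=> M0 B0 [P [PM Pg]] [Q [QM Qh]]; exists (fun N => P N * Q N); split; last first.
  by move=> t /=; under eq_fun do rewrite hornerM; apply: cvgM.
move=> N m; rewrite coefM (le_trans (ler_norm_sum _ _ _))//.
apply: (@le_trans _ _ (\sum_(i < m.+1) (M * B ^+ i / i`!%:R) *
    (M' * B' ^+ (m - i) / (m - i)`!%:R))).
  by apply: ler_sum => i _; rewrite normrM ler_pM.
rewrite addrC exprDn !mulr_sumr mulr_suml; apply: ler_sum => i _.
have im : (i <= m)%N by rewrite -ltnS.
rewrite -(bin_fact im) !natrM -[_ *+ 'C(_, _)]mulr_natr.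
rewrite le_eqVlt; apply/orP; left; apply/eqP; field.
by rewrite !pnatr_eq0 -!lt0n !fact_gt0 bin_gt0 im.
Qed.

Lemma expmaj_prod I (s : seq I) (M B : I -> R) (g : I -> R -> R) :
  (forall i, 0 <= M i) -> (forall i, 0 <= B i) ->
  (forall i, expmaj (M i) (B i) (g i)) ->
  expmaj (\prod_(i <- s) M i) (\sum_(i <- s) B i) (fun t => \prod_(i <- s) g i t).
Proof.
move=> M0 B0 Mg; elim: s => [|i s IH].
  rewrite !big_nil -[X in expmaj X]normr1.
  rewrite (_ : (fun _ => _) = cst 1); first exact: expmaj_cst.
  by apply/funext => t; rewrite big_nil.
rewrite !big_cons (_ : (fun _ => _) = g i \* (fun t => \prod_(i <- s) g i t)).
  exact: expmajM.
by apply/funext => t /=; rewrite big_cons.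
Qed.

Lemma sum_exp_le (B : R) n : 0 <= B -> \sum_(m < n) B ^+ m / m`!%:R <= expR B.
Proof.
move=> B0.
have H k : B ^+ k / k`!%:R = exp_coeff B k by [].
under eq_bigr do rewrite H.
rewrite -(big_mkord xpredT (exp_coeff B)) /expR/=.
apply: nondecreasing_cvgn_le; last exact: is_cvg_series_exp_coeff.
by apply: nondecreasing_series => k _ _; exact: exp_coeff_ge0.
Qed.

(** Since ['C(m, n) / m!] is [1 / (n! (m - n)!)], the factor [B ^+ n / n!] comes out and a partial
    sum of the exponential series of [B] remains. *)
Lemma binweight_expmaj M B (P : {poly R}) n : 0 <= M -> 0 <= B ->
  (forall m, `|P`_m| <= M * B ^+ m / m`!%:R) ->
  binweight n P <= M * B ^+ n / n`!%:R * expR B.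
Proof.
move=> M0 B0 PM; rewrite (binweight_widen n (leq_addl n (size P))) big_split_ord/=.
rewrite big1 ?add0r; last by move=> i _; rewrite bin_small// mulr0.
apply: le_trans (ler_wpM2l _ (sum_exp_le (size P) B0)); last first.
  by rewrite mulr_ge0// mulr_ge0// exprn_ge0.
rewrite mulr_sumr; apply: ler_sum => i _.
rewrite (le_trans (ler_wpM2r _ (PM _)))//.
have ni : (n <= n + i)%N by rewrite leq_addr.
have := bin_fact ni; rewrite addKn => <-.
rewrite !natrM exprD le_eqVlt; apply/orP; left; apply/eqP; field.
by rewrite !pnatr_eq0 -!lt0n !fact_gt0 bin_gt0 ni.
Qed.

(** For fixed nodes the error involves finitely many values, so it passes to the pointwise limit,
    and the bound is the same for all approximating polynomials. *)
Lemma interp_err_expmaj n (t : 'I_n -> R) M B g : injective t ->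
  (forall i, 0 <= t i <= 1) -> 0 <= M -> 0 <= B -> expmaj M B g ->
  `|interp_err t g| <= M * B ^+ n / n`!%:R * expR B.
Proof.
move=> tinj t01 M0 B0 [P [PM Pg]].
have H : (fun N => `|interp_err t (horner (P N))|) @ \oo --> `|interp_err t g|.
  apply: cvg_norm; apply: cvgB => //.
  apply: (cvg_big add_continuous) => i _.
  by apply: cvgM; [exact: cvg_cst | exact: Pg].
apply: (ler_cvg_to H (cvg_cst _)); apply: nearW => N.
by rewrite (le_trans (interp_err_poly _ tinj t01))// binweight_expmaj.
Qed.

End InterpolationError.

Section SeparatedNodes.
Variable R : realFieldType.

(** With truncated subtraction [(i - j) + (j - i)] is the distance between [i] and [j]. *)
Lemma prod_dist_fact n i : (i <= n)%N ->
  (\prod_(0 <= j < n.+1 | j != i) ((i - j) + (j - i)) = i`! * (n - i)`!)%N.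
Proof.
move=> ile; rewrite (@big_cat_nat _ _ _ i)//= 1?leqW//; congr muln.
  rewrite fact_prod big_add1 [RHS]big_nat_rev/= add0n big_nat_cond [RHS]big_nat_cond.
  apply: eq_big => j; first by case: ltngtP => //; rewrite andbF.
  by move=> /andP[/andP[_ ji] _]; rewrite (eqP (ltnW ji : j - i == 0)%N) addn0 subnSK.
rewrite big_ltn_cond ?ltnS// eqxx/= -{1}(add0n i.+1) big_addn subSS.
rewrite fact_prod big_add1/= big_nat_cond [RHS]big_nat_cond.
apply: eq_big => j; first by rewrite gtn_eqF ?andbT// leq_addl.
move=> _; rewrite (eqP (_ : i - (j + i.+1) == 0)%N) ?add0n -?addSnnS ?addnK//.
by rewrite subn_eq0 leq_addl.
Qed.

(** Numerators are at most 1 and denominators at least [s] times the distance of the indices, so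
    term [i] is at most [s^-1 ^+ n / (i! (n - i)!)]; these add up to a binomial sum. *)
Lemma sum_lagrange0_le n (t : 'I_n.+1 -> R) s : 0 < s ->
  (forall i, 0 <= t i <= 1) ->
  (forall i j : 'I_n.+1, (i <= j)%N -> s * (j - i)%N%:R <= `|t j - t i|) ->
  \sum_(i < n.+1) `|lagrange0 t i| <= (2 / s) ^+ n / n`!%:R.
Proof.
move=> s0 t01 st.
have st' (i j : 'I_n.+1) : s * ((i - j) + (j - i))%N%:R <= `|t j - t i|.
  have [ij|ji] := leqP i j; first by rewrite (eqP ij) add0n st.
  by rewrite distrC (eqP (ltnW ji : j - i == 0)%N) addn0 st// ltnW.
have lag (i : 'I_n.+1) : `|lagrange0 t i| <= s^-1 ^+ n / (i`! * (n - i)`!)%:R.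
  have ile : (i <= n)%N by rewrite -ltnS.
  rewrite -prod_dist_fact// big_mkord.
  rewrite natr_prod -prodfV -[X in s^-1 ^+ X](_ : #|predC1 i| = n); last first.
    by rewrite cardC1 card_ord.
  rewrite -prodr_const -big_split/= normr_prod; apply: ler_prod => j ji.
  rewrite normr_ge0/= normrM normfV.
  have dpos : (0 < (i - j) + (j - i))%N.
    by rewrite addn_gt0 !subn_gt0 -neq_ltn; move: ji; rewrite -val_eqE.
  have spos : 0 < s * ((i - j) + (j - i))%N%:R by rewrite mulr_gt0// ltr0n.
  have /andP[tj0 tj1] := t01 j.
  rewrite -invfM -[leRHS]mul1r ler_pM ?invr_ge0// ?(ger0_norm tj0)//.
  by rewrite lef_pV2 ?posrE// (lt_le_trans spos).
apply: (le_trans (ler_sum _ (fun i _ => lag i))).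
rewrite -mulr_sumr exprMn mulrAC mulrC ler_wpM2r//.
  by rewrite exprn_ge0// invr_ge0 ltW.
have -> : (2 : R) ^+ n = \sum_(i < n.+1) 'C(n, i)%:R.
  rewrite -natr_sum -[2%:R]/(1 + 1)%:R -natrX expnDn; congr _%:R.
  by apply: eq_bigr => i _; rewrite !exp1n !muln1.
rewrite mulr_suml ler_sum// => i _.
have ile : (i <= n)%N by rewrite -ltnS.
rewrite -(bin_fact ile) !natrM le_eqVlt; apply/orP; left; apply/eqP; field.
by rewrite !pnatr_eq0 -!lt0n !fact_gt0 bin_gt0 ile.
Qed.

End SeparatedNodes.

(** * Smooth cutoffs *)

Section SmoothReal.
Variable R : realType.
Implicit Types (f g : R -> R) (a b x : R).

(** A recursive predicate, so that closure under an operation follows by induction on [m] from the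
    formula for its first derivative. *)
Fixpoint diffn (m : nat) f : Prop :=
  if m is m'.+1 then (forall x, derivable f x 1) /\ diffn m' (derive1 f) else True.

Definition smooth f := forall m, diffn m f.

Lemma smoothP f : smooth f <-> (forall x, derivable f x 1) /\ smooth (derive1 f).
Proof.
split=> [sf|[df sf] [//|m]]; last by split; [exact: df | exact: sf].
by split=> [x|m]; [have [] := sf 1%N | have [] := sf m.+1].
Qed.

Lemma smooth_derivable f x : smooth f -> derivable f x 1.
Proof. by move=> /smoothP[]. Qed.

Lemma smooth_derive1 f : smooth f -> smooth (derive1 f).
Proof. by move=> /smoothP[]. Qed.

Lemma smooth_is_derive f x : smooth f -> is_derive x 1 f ((derive1 f) x).
Proof. by move=> sf; rewrite derive1E; apply/derivableP/smooth_derivable. Qed.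

Lemma smooth_continuous f : smooth f -> continuous f.
Proof.
by move=> sf x; apply/differentiable_continuous/derivable1_diffP/smooth_derivable.
Qed.

Lemma diffnS m f : diffn m.+1 f -> diffn m f.
Proof. by elim: m f => // m IH f [df /IH]. Qed.

Lemma eq_is_derive1 f g : (forall x, is_derive x 1 f (g x)) -> (derive1 f) = g.
Proof. by move=> fg; apply/funext => x; rewrite derive1E; case: (fg x). Qed.

Lemma diffn_is_derive m f g : (forall x, is_derive x 1 f (g x)) -> diffn m g ->
  diffn m.+1 f.
Proof. by move=> fg mg; split=> [x|]; [case: (fg x) | rewrite (eq_is_derive1 fg)]. Qed.

Lemma derivable_is_derive1 f x : derivable f x 1 -> is_derive x 1 f ((derive1 f) x).
Proof. by move=> df; rewrite derive1E; apply/derivableP. Qed.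

Lemma smooth_cst a : smooth (cst a).
Proof.
move=> m; elim: m a => // m IH a; exact: (@diffn_is_derive _ _ (cst 0)).
Qed.

Lemma diffnD m f g : diffn m f -> diffn m g -> diffn m (f \+ g).
Proof.
elim: m f g => // m IH f g [df mf] [dg mg].
apply: (diffn_is_derive (g := (derive1 f) \+ (derive1 g))); last exact: IH.
by move=> x; apply: is_deriveD; exact: derivable_is_derive1.
Qed.

Lemma diffnM m f g : diffn m f -> diffn m g -> diffn m (f \* g).
Proof.
elim: m f g => // m IH f g fm gm.
have [df mf] := fm; have [dg mg] := gm.
apply: (diffn_is_derive (g := (f \* (derive1 g)) \+ (g \* (derive1 f)))).
  by move=> x; apply: is_deriveM; exact: derivable_is_derive1.
by apply: diffnD; apply: IH => //; exact: diffnS.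
Qed.

Lemma smoothD f g : smooth f -> smooth g -> smooth (f \+ g).
Proof. by move=> sf sg m; apply: diffnD. Qed.

Lemma smoothM f g : smooth f -> smooth g -> smooth (f \* g).
Proof. by move=> sf sg m; apply: diffnM. Qed.

Lemma smoothZ a f : smooth f -> smooth (fun x => a * f x).
Proof. by move=> sf; apply: (smoothM (smooth_cst a)). Qed.

Lemma smoothN f : smooth f -> smooth (fun x => - f x).
Proof. by move=> /(smoothZ (-1)); congr smooth; apply/funext => x; rewrite mulN1r. Qed.

Lemma smoothB f g : smooth f -> smooth g -> smooth (f \- g).
Proof. by move=> sf /smoothN; exact: smoothD. Qed.

Lemma smooth_affine a b : smooth (fun x => a * x + b).
Proof.
case=> // m; apply: (@diffn_is_derive _ _ (cst a)); last exact: smooth_cst.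
move=> x; apply: is_derive_eq.
by rewrite /GRing.scale/= mulr1 addr0.
Qed.

Lemma is_derive_affine f a b x df : is_derive (a * x + b) 1 f df ->
  is_derive x 1 (fun x => f (a * x + b)) (a * df).
Proof.
move=> ff; have aff : is_derive x 1 (fun x => a * x + b) a.
  by apply: is_derive_eq; rewrite /GRing.scale/= mulr1 addr0.
by have := @is_derive1_comp _ f (fun x => a * x + b) x _ _ ff aff; rewrite mulrC.
Qed.

Lemma smooth_comp_affine f a b : smooth f -> smooth (fun x => f (a * x + b)).
Proof.
move=> sf m; elim: m f sf => // m IH f sf.
apply: (@diffn_is_derive _ _ (fun x => a * (derive1 f) (a * x + b))).
  by move=> x; apply: is_derive_affine; exact: smooth_is_derive.
by apply: (@diffnM m (cst a)); [exact: smooth_cst | apply/IH/smooth_derive1].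
Qed.

Lemma smooth_cos_sin : smooth cos /\ smooth (@sin R).
Proof.
suff H m : diffn m cos /\ diffn m (@sin R) by split => m; have [] := H m.
elim: m => // m [IHc IHs]; split; last exact: diffn_is_derive IHc.
apply: (@diffn_is_derive _ _ (cst (-1) \* (@sin R))).
  by move=> x /=; rewrite mulN1r; exact: is_derive_cos.
by apply: diffnM => //; exact: smooth_cst.
Qed.

(** The derivative of [1 / f] involves [1 / f] again, but only to the order supplied by the
    induction. *)
Lemma smoothV f : (forall x, f x != 0) -> smooth f -> smooth (fun x => (f x)^-1).
Proof.
move=> f0 sf; elim=> // m IH.
apply: (@diffn_is_derive _ _
  ((cst (-1) \* ((fun x => (f x)^-1) \* (fun x => (f x)^-1))) \* (derive1 f))).
  move=> x; apply: is_derive_eq.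
    by apply: is_deriveV => //; exact: smooth_is_derive.
  by rewrite /= /GRing.scale/= mulN1r -invfM -expr2.
apply: diffnM; last exact: smooth_derive1.
by apply: diffnM; [exact: smooth_cst | exact: diffnM].
Qed.

Lemma powM_expRN_le n (s : R) : 0 < s -> s ^+ n * expR (- s) <= n`!%:R.
Proof.
move=> s0; rewrite expRN ler_pdivrMr ?expR_gt0//.
have := sum_exp_le n.+1 (ltW s0); rewrite big_ord_recr/= => H.
rewrite mulrC -ler_pdivrMr ?ltr0n ?fact_gt0//; apply: le_trans H.
by rewrite lerDr sumr_ge0// => i _; rewrite mulr_ge0// exprn_ge0// ltW.
Qed.

(* This family is closed under derivation, which makes [expinv] smooth at 0. *)
Definition flatfun (P : {poly R}) x : R :=
  if 0 < x then P.[x^-1] * expR (- x^-1) else 0.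

(** With [s = 1 / x] each monomial satisfies [s ^+ (i + 2) * expR (- s) <= (i + 2)!], which leaves
    the factor [x ^+ 2] that makes the derivative at 0 vanish. *)
Lemma flatfun_quadratic P : exists C, forall x, x <= 1 -> `|flatfun P x| <= C * x ^+ 2.
Proof.
exists (\sum_(i < size P) `|P`_i| * (i + 2)`!%:R) => x x1; rewrite /flatfun.
have C0 : 0 <= \sum_(i < size P) `|P`_i| * (i + 2)`!%:R.
  by apply: sumr_ge0 => i _; rewrite mulr_ge0.
case: ifPn => x0; last by rewrite normr0 mulr_ge0// sqr_ge0.
rewrite normrM horner_coef (ger0_norm (expR_ge0 _)).
rewrite (le_trans (ler_wpM2r (expR_ge0 _) (ler_norm_sum _ _ _)))// !mulr_suml.
apply: ler_sum => i _; rewrite normrM -!mulrA ler_wpM2l//.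
have xV : 0 < x^-1 by rewrite invr_gt0.
rewrite normrX gtr0_norm// -ler_pdivrMr ?exprn_gt0// mulrAC -exprVn -exprD.
exact: powM_expRN_le.
Qed.

Lemma is_derive_quadratic f C : (forall x, x <= 1 -> `|f x| <= C * x ^+ 2) ->
  is_derive (0 : R) (1 : R) f 0.
Proof.
move=> fC.
have f0 : f 0 = 0 by apply/eqP; rewrite -normr_le0 (le_trans (fC _ _))// expr0n mulr0.
have C0 : 0 <= C by have := fC 1 (lexx _); rewrite expr1n mulr1; apply: le_trans.
suff H : h^-1 *: (f (h *: (1 : R) + 0) - f 0) @[h --> 0^'] --> (0 : R).
  by apply: DeriveDef; [apply/cvg_ex; exists 0 | exact: cvg_lim H].
apply/cvgrPdist_le => e e0.
have eC : 0 < e / (C + 1) by rewrite divr_gt0// ltr_wpDl.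
near=> h.
have hn0 : h != 0 by near: h; exact: nbhs_dnbhs_neq.
have h1 : `|h| <= 1 by near: h; apply: dnbhs0_le.
have he : `|h| <= e / (C + 1) by near: h; apply: dnbhs0_le.
rewrite sub0r normrN /GRing.scale/= mulr1 addr0 f0 subr0 normrM normfV.
rewrite ler_pdivrMl ?normr_gt0// (le_trans (fC _ _))//.
  by rewrite (le_trans (ler_norm _)).
rewrite -real_normK ?num_real// expr2 mulrCA ler_wpM2l//.
rewrite (le_trans (ler_wpM2l C0 he))// mulrA ler_pdivrMr ?ltr_wpDl// mulrC.
by apply: ler_wpM2l; [exact: ltW | rewrite lerDl].
Unshelve. all: by end_near.
Qed.

(** On the right half-line this is the chain rule in the variable [1 / x], whose derivative
    contributes ['X^2]. At 0 the quadratic bound applies, and the left half-line is constant. *)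
Lemma is_derive_flatfun P x :
  is_derive x 1 (flatfun P) (flatfun ('X^2 * (P - P^`())) x).
Proof.
have [x0|x0|<-] := ltgtP 0 x; last first.
- rewrite {2}/flatfun ltxx; have [C] := flatfun_quadratic P.
  exact: is_derive_quadratic.
- apply: (@near_eq_is_derive _ _ _ (cst 0)).
    near=> y; rewrite /flatfun ltNge (_ : y <= 0)//.
    by near: y; apply: (filterS _ (lt_nbhsl x0)) => y /ltW.
  by rewrite /flatfun ltNge (ltW x0); exact: is_derive_cst.
- apply: (@near_eq_is_derive _ _ _ (fun y : R => P.[y^-1] * expR (- y^-1) : R)).
    near=> y; rewrite /flatfun (_ : 0 < y)//.
    by near: y; exact: lt_nbhsr.
  rewrite /flatfun x0.
  have dV : is_derive x 1 (fun y : R => y^-1) (- x ^- 2).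
    apply: is_derive_eq; first by apply: is_deriveV; rewrite ?gt_eqF.
    by rewrite /GRing.scale/= mulr1.
  have dVN : is_derive x 1 (fun y : R => - y^-1) (x ^- 2).
    by have := is_deriveN dV; rewrite opprK.
  have d1 := is_derive1_comp (is_derive_poly P x^-1) dV.
  have d2 := @is_derive1_comp _ expR (fun y : R => - y^-1) x _ _ (is_derive_expR (- x^-1)) dVN.
  have d3 := is_deriveM d1 d2; refine (@is_derive_eq _ _ _ _ _ _ _ _ d3 _).
  rewrite /GRing.scale/= hornerM hornerXn hornerD hornerN exprVn; ring.
Unshelve. all: by end_near.
Qed.

Lemma smooth_flatfun P : smooth (flatfun P).
Proof.
move=> m; elim: m P => // m IH P; apply: diffn_is_derive (IH _).
exact: is_derive_flatfun.
Qed.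

Definition expinv := flatfun 1.

Lemma expinv_gt0 x : (0 < expinv x) = (0 < x).
Proof. by rewrite /expinv /flatfun; case: ifP; rewrite ?ltxx// hornerC mul1r expR_gt0. Qed.

Lemma expinv_ge0 x : 0 <= expinv x.
Proof. by rewrite /expinv /flatfun; case: ifP => // _; rewrite hornerC mul1r expR_ge0. Qed.

Lemma expinv_le0 x : x <= 0 -> expinv x = 0.
Proof. by rewrite /expinv /flatfun; case: ltP. Qed.

Definition smoothstep x : R := expinv x / (expinv x + expinv (1 - x)).

Lemma smoothstep_den_gt0 x : 0 < expinv x + expinv (1 - x).
Proof.
have [x0|x0] := ltP 0 x; first by rewrite ltr_pwDl ?expinv_ge0 ?expinv_gt0.
by rewrite ltr_wpDl ?expinv_ge0// expinv_gt0 subr_gt0 (le_lt_trans x0).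
Qed.

Lemma smooth_smoothstep : smooth smoothstep.
Proof.
apply: smoothM; first exact: smooth_flatfun.
apply: smoothV; first by move=> x; rewrite gt_eqF// smoothstep_den_gt0.
apply: smoothD; first exact: smooth_flatfun.
rewrite (_ : (fun x => _) = (fun x => expinv (-1 * x + 1))).
  by apply: smooth_comp_affine; exact: smooth_flatfun.
by apply/funext => x; rewrite mulN1r addrC.
Qed.

Lemma smoothstep_le0 x : x <= 0 -> smoothstep x = 0.
Proof. by move=> x0; rewrite /smoothstep expinv_le0// mul0r. Qed.

Lemma smoothstep_ge1 x : 1 <= x -> smoothstep x = 1.
Proof.
move=> x1; have := smoothstep_den_gt0 x; rewrite /smoothstep [expinv (1 - x)]expinv_le0 ?subr_le0//.
by rewrite addr0 => e0; rewrite divff ?gt_eqF.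
Qed.

Lemma smoothstep_ge0 x : 0 <= smoothstep x.
Proof. by rewrite /smoothstep divr_ge0 ?expinv_ge0// ltW// smoothstep_den_gt0. Qed.

Definition cutoff x : R := smoothstep (2 - x) * smoothstep (2 + x).

Lemma smooth_cutoff : smooth cutoff.
Proof.
apply: smoothM.
  rewrite (_ : (fun x => _) = (fun x => smoothstep (-1 * x + 2))).
    exact/smooth_comp_affine/smooth_smoothstep.
  by apply/funext => x; rewrite mulN1r addrC.
rewrite (_ : (fun x => _) = (fun x => smoothstep (1 * x + 2))).
  exact/smooth_comp_affine/smooth_smoothstep.
by apply/funext => x; rewrite mul1r addrC.
Qed.

Lemma cutoffN x : cutoff (- x) = cutoff x.
Proof. by rewrite /cutoff opprK mulrC. Qed.

Lemma cutoff_ge0 x : 0 <= cutoff x.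
Proof. by rewrite mulr_ge0 ?smoothstep_ge0. Qed.

Lemma cutoff_eq1 x : `|x| <= 1 -> cutoff x = 1.
Proof.
rewrite ler_norml => /andP[xl xr].
by rewrite /cutoff !smoothstep_ge1 ?mulr1//; lra.
Qed.

Lemma cutoff_eq0 x : 2 <= `|x| -> cutoff x = 0.
Proof.
rewrite ler_normr => /orP[x2|x2]; rewrite /cutoff.
  by rewrite smoothstep_le0 ?mul0r//; lra.
by rewrite [smoothstep (2 + x)]smoothstep_le0 ?mulr0//; lra.
Qed.

End SmoothReal.

(** * Integration on the line: domination, affine substitutions, compact support *)

Section RealIntegral.
Context d (T : measurableType d) (R : realType) (mu : {measure set T -> \bar R}).
Implicit Types f g : T -> R.

Lemma integrable_le_norm f g : measurable_fun [set: T] f ->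
  (forall x, `|f x| <= g x) -> mu.-integrable setT (EFin \o g) ->
  mu.-integrable setT (EFin \o f).
Proof.
move=> mf fg; apply: le_integrable => //; first exact/measurable_EFinP.
by move=> x _ /=; rewrite lee_fin (le_trans (fg x))// ler_norm.
Qed.

Lemma Rintegral_dominated (f_ : nat -> T -> R) f g :
  (forall n, measurable_fun [set: T] (f_ n)) ->
  (forall x, f_ ^~ x @ \oo --> f x) ->
  (forall n x, `|f_ n x| <= g x) -> mu.-integrable setT (EFin \o g) ->
  (\int[mu]_x f_ n x)%R @[n --> \oo] --> (\int[mu]_x f x)%R.
Proof.
move=> mf ff fg ig.
have mff : measurable_fun setT f.
  by apply: (measurable_fun_cvg (h := f_)) => // x _; exact: ff.
have iff : mu.-integrable setT (EFin \o f).
  apply: (integrable_le_norm mff _ ig) => x.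
  by apply: (ler_cvg_to (cvg_norm (ff x)) (cvg_cst _)); apply: nearW => n.
have H : (\int[mu]_x (f_ n x)%:E)%E @[n --> \oo] --> (\int[mu]_x (f x)%:E)%E.
  apply: (dominated_cvg _ _ _ _ ig) => //.
  - by move=> n; exact/measurable_EFinP.
  - by move=> x _ /=; apply: cvg_EFin; [exact: nearW | exact: ff].
  - by move=> n x _ /=; rewrite lee_fin.
by apply: fine_cvg; rewrite /Rintegral fineK// integrable_fin_num.
Qed.

Lemma le_normr_RintegralT f g : measurable_fun setT f ->
  (forall x, `|f x| <= g x) -> mu.-integrable setT (EFin \o g) ->
  `|\int[mu]_x f x| <= \int[mu]_x g x.
Proof.
move=> mf fg ig; have fi := integrable_le_norm mf fg ig.
apply: (le_trans (le_normr_Rintegral _ _)) => //.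
apply: le_Rintegral => //; exact: integrable_norm.
Qed.

Lemma integrableZr_EFin k f : mu.-integrable setT (EFin \o f) ->
  mu.-integrable setT (EFin \o (fun x => k * f x)).
Proof. exact: integrableZl. Qed.

Lemma integrableD_EFin f g : mu.-integrable setT (EFin \o f) ->
  mu.-integrable setT (EFin \o g) -> mu.-integrable setT (EFin \o (fun x => f x + g x)).
Proof. exact: integrableD. Qed.

Lemma integrableB_EFin f g : mu.-integrable setT (EFin \o f) ->
  mu.-integrable setT (EFin \o g) -> mu.-integrable setT (EFin \o (fun x => f x - g x)).
Proof. exact: integrableB. Qed.

Lemma Rintegral_funrposneg f : mu.-integrable setT (EFin \o f) ->
  \int[mu]_x f x = \int[mu]_x (f^\+ x) - \int[mu]_x (f^\- x).
Proof.
move=> fi; rewrite -RintegralB//; [|exact: integrable_funrpos|exact: integrable_funrneg].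
by apply: eq_Rintegral => x _; rewrite -[in LHS](funrposBneg f).
Qed.

End RealIntegral.

Section AffineLebesgue.
Variable R : realType.
Local Notation mu := (@lebesgue_measure R).

Lemma measurable_affine (a b : R) :
  measurable_fun [set: measurableTypeR R] (fun x : measurableTypeR R => a * x + b : measurableTypeR R).
Proof. by apply: measurable_funD => //; apply: measurable_funM. Qed.

(** Uniqueness of Lebesgue measure: [|a|] times the image measure agrees with it on the intervals
    []s, t]]. For negative [a] the preimage is closed on the left instead of the right, with the
    same length. *)
Lemma lebesgue_measure_affine (a b : R) (A : set (measurableTypeR R)) : a != 0 -> measurable A ->
  mu ((fun x => a * x + b) @^-1` A) = (`|a|^-1%:E * mu A)%E.
Proof.
move=> a0 mA; set phi := fun x => _.
have mphi : measurable_fun [set: measurableTypeR R] (phi : _ -> measurableTypeR R).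
  exact: measurable_affine.
have na : 0 < `|a| by rewrite normr_gt0.
have -> : mu A = (`|a|%:E * mu (phi @^-1` A))%E.
  pose m := mscale (NngNum (normr_ge0 a)) (pushforward mu (phi : _ -> measurableTypeR R)).
  apply: (@lebesgue_measure_unique _ (m mphi)) => // _ [[s t]] _ <-.
  change (mu `]s, t] = (`|a|%:E * mu (phi @^-1` `]s, t]))%E).
  have [ap|an|/eqP] := ltgtP a 0; last by rewrite (negbTE a0).
    rewrite (_ : phi @^-1` _ = `[(t - b) / a, (s - b) / a[%classic); last first.
      apply/seteqP; split=> x /=; rewrite !in_itv/= /phi.
        move=> /andP[sx xt]; rewrite ler_ndivrMr// ltr_ndivlMr// mulrC; apply/andP; split; lra.
      rewrite ler_ndivrMr// ltr_ndivlMr// mulrC => /andP[? ?]; apply/andP; split; lra.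
    rewrite !lebesgue_measure_itv/= !lte_fin ltr_ndivrMr// divfK// ltrD2r.
    case: ifP => _; last by rewrite mule0.
    rewrite -!EFinD -EFinM ltr0_norm//; congr EFin; field.
    exact: a0.
  rewrite (_ : phi @^-1` _ = `](s - b) / a, (t - b) / a]%classic); last first.
    apply/seteqP; split=> x /=; rewrite !in_itv/= /phi.
      move=> /andP[sx xt]; rewrite ltr_pdivrMr// ler_pdivlMr// mulrC; apply/andP; split; lra.
    rewrite ltr_pdivrMr// ler_pdivlMr// mulrC => /andP[? ?]; apply/andP; split; lra.
  rewrite !lebesgue_measure_itv/= !lte_fin ltr_pdivrMr// divfK// ltrD2r.
  case: ifP => _; last by rewrite mule0.
  rewrite -!EFinD -EFinM gtr0_norm//; congr EFin; field.
  exact: a0.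
by rewrite muleA -EFinM mulVf ?mul1e// gt_eqF.
Qed.

Lemma ge0_integral_affine (a b : R) (f : measurableTypeR R -> \bar R) : a != 0 ->
  measurable_fun [set: measurableTypeR R] f -> (forall x, 0 <= f x)%E ->
  (\int[mu]_x f (a * x + b)%R = `|a|^-1%:E * \int[mu]_x f x)%E.
Proof.
move=> a0 mf f0; set phi := fun x : R => a * x + b.
have mphi : measurable_fun [set: measurableTypeR R] (phi : _ -> measurableTypeR R).
  exact: measurable_affine.
have -> : (\int[mu]_x f (a * x + b)%R = \int[pushforward mu (phi : _ -> measurableTypeR R)]_x f x)%E.
  by rewrite ge0_integral_pushforward// preimage_setT.
have na : 0 <= `|a|^-1 by rewrite invr_ge0.
rewrite -(ge0_integral_mscale mu measurableT (NngNum na))//.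
apply: eq_measure_integral => A mA _.
exact: lebesgue_measure_affine.
Qed.

Lemma integrable_affine (a b : R) (f : R -> R) : a != 0 ->
  mu.-integrable setT (EFin \o f) -> mu.-integrable setT (EFin \o (fun x => f (a * x + b))).
Proof.
move=> a0 /integrableP[mf fi]; apply/integrableP; split.
  exact: (measurableT_comp mf (measurable_affine a b)).
rewrite /= (ge0_integral_affine b (f := fun x : measurableTypeR R => `|(f x)%:E|%E))//.
  by rewrite lte_mul_pinfty// ?lee_fin ?invr_ge0.
exact: measurableT_comp.
Qed.

Lemma Rintegral_affine (a b : R) (f : R -> R) : a != 0 ->
  mu.-integrable setT (EFin \o f) ->
  (\int[mu]_x f (a * x + b))%R = `|a|^-1 * (\int[mu]_x f x)%R.
Proof.
move=> a0 fi.
rewrite (Rintegral_funrposneg fi) (Rintegral_funrposneg (integrable_affine b a0 fi)).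
have H (g : R -> R) : mu.-integrable setT (EFin \o g) -> (forall x, 0 <= g x) ->
    (\int[mu]_x g (a * x + b))%R = `|a|^-1 * (\int[mu]_x g x)%R.
  move=> gi g0; rewrite /Rintegral (ge0_integral_affine b (f := EFin \o g))//.
  - by rewrite fineM//=; exact: integrable_fin_num.
  - exact: measurable_int gi.
have mp : mu.-integrable setT (EFin \o f^\+) by exact: integrable_funrpos.
have mn : mu.-integrable setT (EFin \o f^\-) by exact: integrable_funrneg.
by rewrite mulrBr -(H _ mp)// -(H _ mn).
Qed.

End AffineLebesgue.

Section CompactSupport.
Variable R : realType.
Local Notation mu := (@lebesgue_measure R).
Implicit Types (u f : R -> R) (A : R).

Lemma continuous_measurable u : continuous u -> measurable_fun [set: measurableTypeR R] u.
Proof. exact: continuous_measurable_fun. Qed.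

Lemma csupp_restrict u A : (forall x, A <= `|x| -> u x = 0) -> u = u \_ `[- A, A].
Proof.
move=> uA; apply/funext => x; rewrite patchE; case: ifPn => //.
rewrite notin_setE/= in_itv/= -ler_norml => /negP; rewrite -ltNge => /ltW.
exact: uA.
Qed.

Lemma csupp_integrable u A : continuous u -> (forall x, A <= `|x| -> u x = 0) ->
  mu.-integrable setT (EFin \o u).
Proof.
move=> cu uA; rewrite (csupp_restrict uA) -restrict_EFin.
apply/integrable_restrict => //; rewrite setTI.
apply: continuous_compact_integrable; first exact: segment_compact.
exact: continuous_subspaceT.
Qed.

Lemma csupp_Rintegral u A : (forall x, A <= `|x| -> u x = 0) ->
  (\int[mu]_x u x)%R = (\int[mu]_(x in `[- A, A]) u x)%R.
Proof. by move=> /csupp_restrict{1}->; rewrite [RHS]Rintegral_mkcond. Qed.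

Lemma csupp_FTC (F f : R -> R) A : continuous f ->
  (forall x : R, is_derive x (1 : R) F (f x)) -> (forall x, A <= `|x| -> F x = 0) ->
  (forall x, A <= `|x| -> f x = 0) -> (\int[mu]_x f x)%R = 0.
Proof.
move=> cf dF FA fA.
have [A0|A0] := ltP 0 A; last first.
  have -> : f = cst 0 by apply/funext => x; rewrite fA//= (le_trans A0).
  by rewrite Rintegral_cst// mul0r.
rewrite (csupp_Rintegral fA) /Rintegral (@continuous_FTC2 _ _ F)//.
- by rewrite !FA ?subee// ?normrN ger0_norm// ltW.
- by lra.
- exact: continuous_subspaceT.
- have cF : continuous F.
    by move=> x; apply/differentiable_continuous/derivable1_diffP; case: (dF x).
  split; [by move=> x _; case: (dF x)| |].
  + exact/cvg_at_right_filter/cF.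
  + exact/cvg_at_left_filter/cF.
- by move=> x _; rewrite derive1E; case: (dF x).
Qed.

Lemma csupp_norm_Rintegral_le u A M : 0 <= A -> continuous u ->
  (forall x, A <= `|x| -> u x = 0) -> (forall x, `|u x| <= M) ->
  `|\int[mu]_x u x| <= 2 * A * M.
Proof.
move=> A0 cu uA uM.
have M0 : 0 <= M by exact: le_trans (uM 0).
have Ii : mu.-integrable setT (EFin \o (fun x => M * \1_(`[- A, A]%classic) x)).
  by have := integrableZl measurableT M (integrable_indic_itv (- A) A true false).
apply: (le_trans (le_normr_RintegralT _ _ Ii)).
- exact: continuous_measurable_fun.
- move=> x; rewrite indicE; case: (boolP (x \in _)) => [_|].
    by rewrite mulr1.
  rewrite notin_setE/= in_itv/= -ler_norml mulr0 => /negP.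
  by rewrite -ltNge => /ltW/uA ->; rewrite normr0.
- rewrite RintegralZl//; last exact: (integrable_indic_itv (- A) A true false).
  have -> : \int[mu]_x (\1_(`[- A, A]%classic) x) = fine (mu `[- A, A]%classic).
    by rewrite /Rintegral integral_indic// setIT.
  rewrite lebesgue_measure_itv/= lte_fin.
  case: ifPn => _ /=; first by lra.
  by rewrite mulr0 !mulr_ge0.
Qed.

End CompactSupport.

(** * Cosine transforms of cutoffs *)

Section RealFubini.
Context d1 d2 (T1 : measurableType d1) (T2 : measurableType d2) (R : realType).
Variable m1 : {sigma_finite_measure set T1 -> \bar R}.
Variable m2 : {sigma_finite_measure set T2 -> \bar R}.
Variables (F : T1 * T2 -> R) (g : T1 -> R) (h : T2 -> R).
Hypothesis mF : measurable_fun [set: T1 * T2] F.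
Hypothesis Fgh : forall x y, `|F (x, y)| <= g x * h y.
Hypothesis gi : m1.-integrable setT (EFin \o g).
Hypothesis hi : m2.-integrable setT (EFin \o h).

Lemma integrable_prod_dominated : (m1 \x m2)%E.-integrable setT (EFin \o F).
Proof.
apply/integrable12ltyP; first exact/measurable_EFinP.
have mg : measurable_fun setT g by apply/measurable_EFinP; exact: measurable_int gi.
have mh : measurable_fun setT h by apply/measurable_EFinP; exact: measurable_int hi.
apply: (@le_lt_trans _ _ (\int[m1]_x ((\int[m2]_y `|(h y)%:E|) * `|(g x)%:E|))%E).
  apply: ge0_le_integral => //.
  - by move=> x _; exact: integral_ge0.
  - apply: (measurable_fun_fubini_tonelli_F (fun z => `|(F z)%:E|%E)) => //.
    by apply/measurable_EFinP; exact: measurableT_comp.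
  - by apply: emeasurable_funM => //; apply/measurable_EFinP; exact: measurableT_comp.
  - move=> x _; rewrite -ge0_integralZr//; last by apply/measurable_EFinP; exact: measurableT_comp.
    apply: ge0_le_integral => //.
    + by apply/measurable_EFinP; apply: measurableT_comp => //; exact: measurableT_comp.
    + apply: emeasurable_funM => //; apply/measurable_EFinP; exact: measurableT_comp.
    + by move=> y _ /=; rewrite lee_fin (le_trans (Fgh x y))// mulrC -normrM ler_norm.
rewrite ge0_integralZl//; last 2 first.
  by apply/measurable_EFinP; exact: measurableT_comp.
  exact: integral_ge0.
by rewrite lte_mul_pinfty ?integral_ge0//; [apply: integrable_fin_num => //; exact: integrable_norm|case/integrableP: gi].
Qed.

Lemma integrable_section1 x : m2.-integrable setT (EFin \o (fun y => F (x, y))).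
Proof.
apply: (integrable_le_norm _ (Fgh x)); first exact: measurableT_comp.
exact: (integrableZl measurableT (g x) hi).
Qed.

Lemma integrable_section2 y : m1.-integrable setT (EFin \o (fun x => F (x, y))).
Proof.
apply: (integrable_le_norm _ (Fgh ^~ y)); first exact: measurableT_comp.
exact: (integrableZr measurableT (h y) gi).
Qed.

(** Domination by a product makes every section integrable, not merely almost every one, so the
    inner real integrals agree everywhere with the extended ones to which Fubini's theorem
    applies. *)
Lemma Rintegral_Fubini :
  (\int[m1]_x \int[m2]_y F (x, y))%R = (\int[m2]_y \int[m1]_x F (x, y))%R.
Proof.
have H := Fubini integrable_prod_dominated.
transitivity (fine (\int[m1]_x \int[m2]_y (EFin \o F) (x, y))%E); last rewrite H.
- congr fine; apply: eq_integral => x _.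
  by rewrite /Rintegral fineK// integrable_fin_num//; exact: integrable_section1.
- congr fine; apply: eq_integral => y _.
  by rewrite /Rintegral fineK// integrable_fin_num//; exact: integrable_section2.
Qed.

Lemma Rintegral_Fubini12 :
  (\int[m1]_x \int[m2]_y F (x, y))%R = \int[(m1 \x m2)%E]_z F z.
Proof.
rewrite /Rintegral -integral12_prod_meas1; last exact: integrable_prod_dominated.
congr fine; apply: eq_integral => x _.
by rewrite fineK// integrable_fin_num//; exact: integrable_section1.
Qed.

End RealFubini.

Section CosineTransform.
Variable R : realType.
Local Notation mu := (@lebesgue_measure R).
Implicit Types (u : R -> R) (A B : R).

(** A whole neighbourhood of zeros is used, hence the strict inequality; the radii [A + 1] and
    [A + 2] met below leave room for it. *)
Lemma csupp_derive1 u A : smooth u -> (forall x, A <= `|x| -> u x = 0) ->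
  forall x, A < `|x| -> derive1 u x = 0.
Proof.
move=> su uA x Ax; have : is_derive x (1 : R) u 0.
  refine (near_eq_is_derive _ (is_derive_cst (0 : R) x (1 : R))).
  have : \forall y \near x, A < `|y|.
    by have /cvgr_gt/(_ _ Ax) := @norm_continuous R R^o x.
  by apply: filterS => y /ltW/uA ->.
by rewrite derive1E => -[_ ->].
Qed.

(** The function [(u'' + y ^+ 2 * u) * cos (y * x + b)] is the derivative of the compactly supported
    [u' * cos (y * x + b) + y * u * sin (y * x + b)], so its integral, the difference of the two
    sides, is 0. The phase [b] makes the lemma cover sines as well. *)
Lemma cos_ibp u A (y b : R) : smooth u -> (forall x, A <= `|x| -> u x = 0) ->
  (1 + y ^+ 2) * \int[mu]_x (u x * cos (y * x + b)) =
  \int[mu]_x ((u x - derive1 (derive1 u) x) * cos (y * x + b)).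
Proof.
move=> su uA; set u1 := derive1 u; set u2 := derive1 u1.
have su1 : smooth u1 by exact: smooth_derive1.
have su2 : smooth u2 by exact: smooth_derive1.
have u1A x : A + 1 <= `|x| -> u1 x = 0.
  by move=> Ax; apply: (csupp_derive1 su uA); lra.
have u2A x : A + 2 <= `|x| -> u2 x = 0.
  by move=> Ax; apply: (csupp_derive1 su1 u1A); lra.
have [scos ssin] := smooth_cos_sin R.
have sc : smooth (fun x => cos (y * x + b)) by exact: smooth_comp_affine.
have ss : smooth (fun x => sin (y * x + b)) by exact: smooth_comp_affine.
have ci v A' : smooth v -> (forall x, A' <= `|x| -> v x = 0) ->
    mu.-integrable setT (EFin \o (fun x => v x * cos (y * x + b))).
  move=> sv vA; apply: (@csupp_integrable _ _ A').
    by apply: smooth_continuous; exact: smoothM.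
  by move=> x /vA ->; rewrite mul0r.
pose f x := (u2 x + y ^+ 2 * u x) * cos (y * x + b).
have sf : smooth f by apply: smoothM => //; apply: smoothD => //; exact: smoothZ.
have f0 : \int[mu]_x f x = 0.
  apply: (@csupp_FTC _ (fun x => u1 x * cos (y * x + b) + y * u x * sin (y * x + b)) f (A + 2)).
  - exact: smooth_continuous.
  - move=> x.
    have dc : is_derive x (1 : R) (fun x => cos (y * x + b)) (y * - sin (y * x + b)).
      by apply: is_derive_affine; exact: is_derive_cos.
    have ds : is_derive x (1 : R) (fun x => sin (y * x + b)) (y * cos (y * x + b)).
      by apply: is_derive_affine; exact: is_derive_sin.
    have du1 : is_derive x (1 : R) u1 (u2 x) by exact: smooth_is_derive.
    have du : is_derive x (1 : R) (fun x => y * u x) (y * u1 x).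
      have := is_deriveM (is_derive_cst y x (1 : R)) (smooth_is_derive x su).
      by move=> h; refine (is_derive_eq h _); rewrite /GRing.scale/= mulr0 addr0.
    have := is_deriveD (is_deriveM du1 dc) (is_deriveM du ds).
    move=> h; refine (is_derive_eq h _).
    by rewrite /f /GRing.scale/=; ring.
  - by move=> x Ax; rewrite u1A ?uA ?mulr0 ?mul0r ?addr0//; lra.
  - by move=> x Ax; rewrite /f u2A ?uA ?mulr0 ?addr0 ?mul0r//; lra.
rewrite -RintegralZl//; last exact: (ci _ A).
rewrite -[RHS]addr0 -f0 -RintegralD//.
- by apply: eq_Rintegral => x _; rewrite /f; ring.
- apply: (ci _ (A + 2)); first exact: smoothB.
  by move=> x Ax; rewrite u2A ?uA ?subr0//; lra.
- apply: (@csupp_integrable _ _ (A + 2)); first exact: smooth_continuous.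
  by move=> x Ax; rewrite /f u2A ?uA ?mulr0 ?addr0 ?mul0r//; lra.
Qed.

Definition C2_bounded A B u := [/\ smooth u, forall x, A <= `|x| -> u x = 0,
  forall x, `|u x| <= B, forall x, `|derive1 u x| <= B &
  forall x, `|derive1 (derive1 u) x| <= B].

Lemma csupp_bounded u A : continuous u -> (forall x, A <= `|x| -> u x = 0) ->
  exists B, forall x, `|u x| <= B.
Proof.
move=> cu uA.
have [A0|A0] := ltP 0 A; last by exists 0 => x; rewrite uA ?normr0// (le_trans A0).
have cn : {within `[- A, A], continuous (fun x => `|u x|)}.
  apply: continuous_subspaceT => x; apply: continuous_comp; first exact: cu.
  exact: norm_continuous.
have [|c _ cmax] := EVT_max _ cn; first lra.
exists `|u c| => x; have [/uA ->|xA] := leP A `|x|; first by rewrite normr0.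
by apply: cmax; rewrite in_itv/= -ler_norml ltW.
Qed.

Lemma smooth_C2_bounded u A : smooth u -> (forall x, A <= `|x| -> u x = 0) ->
  exists B, C2_bounded A B u.
Proof.
move=> su uA; have su1 := smooth_derive1 su; have su2 := smooth_derive1 su1.
have u1A x : A + 1 <= `|x| -> derive1 u x = 0.
  by move=> Ax; apply: (csupp_derive1 su uA); lra.
have u2A x : A + 2 <= `|x| -> derive1 (derive1 u) x = 0.
  by move=> Ax; apply: (csupp_derive1 su1 u1A); lra.
have [B0 uB] := csupp_bounded (smooth_continuous su) uA.
have [B1 u1B] := csupp_bounded (smooth_continuous su1) u1A.
have [B2 u2B] := csupp_bounded (smooth_continuous su2) u2A.
exists (Num.max B0 (Num.max B1 B2)); split=> // x.
- by rewrite le_max uB.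
- by rewrite !le_max u1B orbT.
- by rewrite !le_max u2B !orbT.
Qed.

(** On the support [|x|] is at most 2, and the largest of the new bounds is that of
    [2 * u' + x * u'']. The factor 4 becomes the rate 4 in the exponential majorant of [cosker]. *)
Lemma C2_bounded_mulX u B : C2_bounded 2 B u ->
  C2_bounded 2 (4 * B) (fun x => x * u x).
Proof.
move=> [su uA uB u1B u2B].
have su1 := smooth_derive1 su; have su2 := smooth_derive1 su1.
have did x : is_derive x (1 : R) (fun x : R => x) 1 by exact: is_derive_id.
have sid : smooth (fun x : R => x).
  by have := smooth_affine 1 (0 : R); congr smooth; apply/funext => x; rewrite mul1r addr0.
have d1 : derive1 (fun x => x * u x) = fun x => u x + x * derive1 u x.
  apply: eq_is_derive1 => x.
  refine (is_derive_eq (is_deriveM (did x) (smooth_is_derive x su)) _).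
  by rewrite /GRing.scale/= mulr1 addrC.
have d2 : derive1 (fun x => u x + x * derive1 u x) =
    fun x => 2 * derive1 u x + x * derive1 (derive1 u) x.
  apply: eq_is_derive1 => x.
  refine (is_derive_eq (is_deriveD (smooth_is_derive x su)
    (is_deriveM (did x) (smooth_is_derive x su1))) _).
  by rewrite /GRing.scale/=; ring.
have B0 : 0 <= B by exact: le_trans (uB 0).
have xv v x : smooth v -> (forall x, 2 < `|x| -> v x = 0) -> (forall x, `|v x| <= B) ->
    `|x * v x| <= 2 * B.
  move=> sv vA vB; have [/vA ->|x2] := ltP 2 `|x|.
    by rewrite mulr0 normr0; lra.
  by rewrite normrM ler_pM.
have u1A := csupp_derive1 su uA.
have u2A x : 2 < `|x| -> derive1 (derive1 u) x = 0.
  move=> x2; have [e [e0 ex]] : exists e, 0 < e /\ 2 + e < `|x|.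
    by exists ((`|x| - 2) / 2); split; lra.
  apply: (@csupp_derive1 _ (2 + e)) => // z ez; apply: u1A; lra.
split.
- exact: smoothM.
- by move=> x /uA ->; rewrite mulr0.
- by move=> x; rewrite (le_trans (xv u x _ _ _))//; [move=> z /ltW/uA|lra].
- move=> x; rewrite d1 (le_trans (ler_normD _ _))//.
  have := xv _ x su1 u1A u1B; have := uB x; lra.
- move=> x; rewrite d1 d2 (le_trans (ler_normD _ _))// normrM (ger0_norm (_ : 0 <= 2))//.
  have := xv _ x su2 u2A u2B; have := u1B x; lra.
Qed.

(* Two integrations by parts. *)
Lemma cos_int_decay u A B (y b : R) : 0 <= A -> C2_bounded A B u ->
  `|\int[mu]_x (u x * cos (y * x + b))| <= 4 * (A + 2) * B / (1 + y ^+ 2).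
Proof.
move=> A0 [su uA uB u1B u2B].
have y0 : 0 < 1 + y ^+ 2 by rewrite ltr_pwDl// sqr_ge0.
have B0 : 0 <= B by exact: le_trans (uB 0).
rewrite ler_pdivlMr// mulrC -[X in X * _](gtr0_norm y0) -normrM (cos_ibp _ _ su uA).
have su1 := smooth_derive1 su; have su2 := smooth_derive1 su1.
have u1A x : A + 1 <= `|x| -> derive1 u x = 0.
  by move=> Ax; apply: (csupp_derive1 su uA); lra.
have u2A x : A + 2 <= `|x| -> derive1 (derive1 u) x = 0.
  by move=> Ax; apply: (csupp_derive1 su1 u1A); lra.
have [scos _] := smooth_cos_sin R.
have sg : smooth (fun x => (u x - derive1 (derive1 u) x) * cos (y * x + b)).
  apply: smoothM; [exact: smoothB | exact: smooth_comp_affine].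
have gA x : A + 2 <= `|x| -> (u x - derive1 (derive1 u) x) * cos (y * x + b) = 0.
  by move=> Ax; rewrite u2A ?uA ?subr0 ?mul0r//; lra.
(* An interval of length [2 * (A + 2)], and [2 * B] for [u] and its second derivative together. *)
have -> : 4 * (A + 2) * B = 2 * (A + 2) * (2 * B) by ring.
apply: csupp_norm_Rintegral_le => //; [lra|exact: smooth_continuous|].
move=> x; rewrite normrM -[leRHS]mulr1 ler_pM ?cos_max//.
by rewrite (le_trans (ler_normB _ _))//; have := uB x; have := u2B x; lra.
Qed.


(** The Fourier transform of [cutoff], real because the cutoff is even; no normalising constant is
    included. *)
Definition cosker (z : R) : R := \int[mu]_x (cutoff x * cos (z * x)).

Lemma cutoff_integrable (g : R -> R) : continuous g ->
  mu.-integrable setT (EFin \o (fun x => cutoff x * g x)).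
Proof.
move=> cg; apply: (@csupp_integrable _ _ 2).
  by move=> x; apply: continuousM; [exact/smooth_continuous/smooth_cutoff|exact: cg].
by move=> x x2; rewrite cutoff_eq0// mul0r.
Qed.

Lemma cutoff_moments : exists S, 0 <= S /\ forall m (z b : R),
  `|\int[mu]_x (cutoff x * x ^+ m * cos (z * x + b))| <= S * 4 ^+ m / (1 + z ^+ 2).
Proof.
have [B cB] := smooth_C2_bounded (@smooth_cutoff R) (@cutoff_eq0 R).
have cmB m : C2_bounded 2 (4 ^+ m * B) (fun x : R => cutoff x * x ^+ m).
  elim: m => [|m IH].
    rewrite mul1r (_ : (fun x : R => _) = @cutoff R)//.
    by apply/funext => x; rewrite mulr1.
  have := C2_bounded_mulX IH; rewrite mulrA -exprS; congr C2_bounded.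
  by apply/funext => x; rewrite exprS; ring.
(* 16 is the value at [A = 2] of the factor [4 * (A + 2)] of [cos_int_decay]. *)
exists (16 * B); split => [|m z b].
  by rewrite mulr_ge0//; case: cB => _ _ /(_ 0) cB0 _ _; exact: le_trans cB0.
apply: (le_trans (cos_int_decay z b _ (cmB m))) => //.
rewrite ler_wpM2r ?invr_ge0 ?addr_ge0 ?sqr_ge0//.
by rewrite le_eqVlt; apply/orP; left; apply/eqP; ring.
Qed.

Lemma cos_phase (x : R) : sin x = cos (x - pi / 2).
Proof. by rewrite cosB cos_pihalf sin_pihalf mulr0 mulr1 add0r. Qed.

Lemma cutoff_moments_sin S :
  (forall m (z b : R), `|\int[mu]_x (cutoff x * x ^+ m * cos (z * x + b))|
    <= S * 4 ^+ m / (1 + z ^+ 2)) ->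
  forall m (z : R), `|\int[mu]_x (cutoff x * x ^+ m * sin (z * x))|
    <= S * 4 ^+ m / (1 + z ^+ 2).
Proof.
move=> H m z; have := H m z (- (pi / 2)).
by under eq_Rintegral do rewrite -cos_phase.
Qed.

Lemma trig_coeff_le m : `|cos_coeff (1 : R) m| <= m`!%:R^-1 /\ `|sin_coeff (1 : R) m| <= m`!%:R^-1.
Proof.
rewrite /cos_coeff /sin_coeff/= !expr1n !mulr1 !normrM !normfV !normr_nat.
have n1 k : `|(-1 : R) ^+ k| = 1 by rewrite normrX normrN1 expr1n.
by rewrite -exprnP !n1 !mulr1; case: (odd m) => /=; rewrite ?mul0r ?mul1r ?invr_ge0; split.
Qed.

Lemma trig_coeff_scale (x : R) m : cos_coeff x m = cos_coeff 1 m * x ^+ m /\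
  sin_coeff x m = sin_coeff 1 m * x ^+ m.
Proof. by rewrite /cos_coeff /sin_coeff/= !expr1n !mulr1; split; ring. Qed.

#[local] Arguments cos_coeff : simpl never.
#[local] Arguments sin_coeff : simpl never.

(** The Taylor coefficients in [s] of [(1 + z ^+ 2) * cosker (z + s)]. The weight cancels the decay
    of the moments, so that they have bounds uniform in [z]. *)
Definition cosker_coef (z : R) m : R := (1 + z ^+ 2) *
  (cos_coeff 1 m * \int[mu]_x (cutoff x * x ^+ m * cos (z * x)) -
   sin_coeff 1 m * \int[mu]_x (cutoff x * x ^+ m * sin (z * x))).

Lemma cosker_coef_le : exists S, 0 <= S /\ forall z m, `|cosker_coef z m| <= S * 4 ^+ m / m`!%:R.
Proof.
have [S [S0 SM]] := cutoff_moments; exists (S + S); split => [|z m]; first by rewrite addr_ge0.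
have SMs := cutoff_moments_sin SM.
have z0 : 0 < 1 + z ^+ 2 by rewrite ltr_pwDl// sqr_ge0.
have [cm sm] := trig_coeff_le m.
have m0 : 0 <= (m`!%:R : R)^-1 by rewrite invr_ge0.
rewrite /cosker_coef normrM gtr0_norm// mulrC -ler_pdivlMr//.
rewrite (le_trans (ler_normB _ _))// (normrM (cos_coeff 1 m)) (normrM (sin_coeff 1 m)).
have SM0 := SM m z 0; have SMs0 := SMs m z.
rewrite (_ : _ / _ = m`!%:R^-1 * (S * 4 ^+ m / (1 + z ^+ 2)) +
  m`!%:R^-1 * (S * 4 ^+ m / (1 + z ^+ 2))); last by ring.
apply: lerD; apply: ler_pM => //.
by under eq_Rintegral do rewrite -[z * _]addr0.
Qed.

(** Expand [cos ((z + s) * x)] by the addition formula and integrate the series of [cos (s * x)] and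
    [sin (s * x)] termwise: on the support [|x|] is at most 2, so the partial sums are dominated by
    [2 * expR (2 * |s|)]. *)
Lemma cosker_series (z s : R) :
  (\poly_(m < N) cosker_coef z m).[s] @[N --> \oo] --> (1 + z ^+ 2) * cosker (z + s).
Proof.
pose trig (x : R) N := \sum_(m < N) (cos_coeff (s * x) m * cos (z * x) - sin_coeff (s * x) m * sin (z * x)).
have trigE x : trig x @ \oo --> cos ((z + s) * x).
  have -> : trig x = (fun N => series (cos_coeff (s * x)) N * cos (z * x) -
      series (sin_coeff (s * x)) N * sin (z * x)).
    by apply/funext => N; rewrite /trig sumrB -!mulr_suml /series/= !big_mkord.
  rewrite mulrDl cosD [cos (z * x) * _]mulrC [sin (z * x) * _]mulrC.
  apply: cvgB; apply: cvgM; try exact: cvg_cst.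
    by rewrite cos.unlock; exact: is_cvg_series_cos_coeff.
  by rewrite sin.unlock; exact: is_cvg_series_sin_coeff.
have trigM x N : `|x| <= 2 -> `|trig x N| <= 2 * expR (2 * `|s|).
  move=> x2; have s0 : 0 <= 2 * `|s| by rewrite mulr_ge0.
  apply: (le_trans (ler_norm_sum _ _ _)).
  apply: (@le_trans _ _ (\sum_(m < N) 2 * ((2 * `|s|) ^+ m / m`!%:R))); last first.
    by rewrite -mulr_sumr ler_pM2l// sum_exp_le.
  apply: ler_sum => m _; have [cm sm] := trig_coeff_le m.
  have [-> ->] := trig_coeff_scale (s * x) m.
  have sx : `|(s * x) ^+ m| <= (2 * `|s|) ^+ m.
    by rewrite normrX lerXn2r ?nnegrE// normrM mulrC ler_wpM2r.
  rewrite (le_trans (ler_normB _ _))// mulr_natl mulr2n lerD// [leRHS]mulrC.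
    rewrite (normrM (_ * _)) (normrM (cos_coeff 1 m)).
    by rewrite -[leRHS]mulr1 ler_pM ?cos_max// ?mulr_ge0// ?ler_pM//.
  rewrite (normrM (_ * _)) (normrM (sin_coeff 1 m)).
  by rewrite -[leRHS]mulr1 ler_pM ?sin_max// ?mulr_ge0// ?ler_pM.
have ctrig N : continuous (trig ^~ N).
  rewrite /trig => x; apply: (cvg_big add_continuous) => i _.
  have [scos ssin] := smooth_cos_sin R.
  have cc : {for x, continuous (fun x => cos (z * x))}.
    apply: continuous_comp; last exact: continuous_cos.
    by apply: continuousM; [exact: cst_continuous|].
  have cs : {for x, continuous (fun x => sin (z * x))}.
    apply: continuous_comp; last exact: continuous_sin.
    by apply: continuousM; [exact: cst_continuous|].
  have cx : {for x, continuous (fun x => (s * x) ^+ i)}.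
    apply: (@continuous_comp _ _ _ (fun y : R => s * y) (fun y : R => y ^+ i)); last exact: exprn_continuous.
    by apply: continuousM; [exact: cst_continuous|].
  apply: cvgB; apply: cvgM => //.
    under eq_fun do rewrite (proj1 (trig_coeff_scale _ _)).
    rewrite (proj1 (trig_coeff_scale _ _)).
    by apply: cvgM; [exact: cvg_cst|exact: cx].
  under eq_fun do rewrite (proj2 (trig_coeff_scale _ _)).
  rewrite (proj2 (trig_coeff_scale _ _)).
  by apply: cvgM; [exact: cvg_cst|exact: cx].
have polyE N : (\poly_(m < N) cosker_coef z m).[s] =
    (1 + z ^+ 2) * \int[mu]_x (cutoff x * trig x N).
  rewrite horner_poly.
  have -> : \int[mu]_x (cutoff x * trig x N) = \sum_(m < N) s ^+ m *
      (cos_coeff 1 m * \int[mu]_x (cutoff x * x ^+ m * cos (z * x)) -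
       sin_coeff 1 m * \int[mu]_x (cutoff x * x ^+ m * sin (z * x))).
    elim: N => [|N IH].
      by rewrite big_ord0; under eq_Rintegral do rewrite /trig big_ord0 mulr0; rewrite Rintegral_cst// mul0r.
    rewrite big_ord_recr/= -IH.
    have cX (g : R -> R) : continuous g -> mu.-integrable setT (EFin \o (fun x => cutoff x * x ^+ N * g x)).
      move=> cg; have := cutoff_integrable (g := fun x => x ^+ N * g x).
      rewrite (_ : (fun x => cutoff x * (x ^+ N * g x)) = (fun x => cutoff x * x ^+ N * g x)); last first.
        by apply/funext => x; rewrite mulrA.
      by apply; move=> x; apply: cvgM; [exact: exprn_continuous|exact: cg].
    have [scos ssin] := smooth_cos_sin R.
    have ic := cX _ (smooth_continuous (smooth_comp_affine z 0 scos)).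
    have is_ := cX _ (smooth_continuous (smooth_comp_affine z 0 ssin)).
    have ic1 := integrableZr_EFin (s ^+ N * cos_coeff 1 N) ic.
    have is1 := integrableZr_EFin (s ^+ N * sin_coeff 1 N) is_.
    have itN := cutoff_integrable (ctrig N).
    have icE : \int[mu]_x (cutoff x * x ^+ N * cos (z * x)) = \int[mu]_x (cutoff x * x ^+ N * cos (z * x + 0)).
      by apply: eq_Rintegral => x _; rewrite addr0.
    have isE : \int[mu]_x (cutoff x * x ^+ N * sin (z * x)) = \int[mu]_x (cutoff x * x ^+ N * sin (z * x + 0)).
      by apply: eq_Rintegral => x _; rewrite addr0.
    rewrite mulrBr (mulrA _ (cos_coeff 1 N)) (mulrA _ (sin_coeff 1 N)) icE isE -!RintegralZl// -RintegralB//.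
    rewrite -RintegralD//; last exact: (integrableB_EFin ic1 is1).
    apply: eq_Rintegral => x _; rewrite /trig big_ord_recr/= !addr0.
    have [-> ->] := trig_coeff_scale (s * x) N.
    by rewrite exprMn; ring.
  rewrite mulr_sumr; apply: eq_bigr => m _; rewrite /cosker_coef; ring.
under eq_fun do rewrite polyE.
apply: cvgM; first exact: cvg_cst.
apply: (@Rintegral_dominated _ _ _ mu (fun N x => cutoff x * trig x N)
  (fun x => cutoff x * cos ((z + s) * x)) (fun x => cutoff x * cst (2 * expR (2 * `|s|)) x)).
- move=> n; apply: continuous_measurable_fun => x.
  by apply: continuousM; [exact/smooth_continuous/smooth_cutoff|exact: ctrig].
- by move=> x; apply: cvgM; [exact: cvg_cst|exact: trigE].
- move=> n x; rewrite normrM (ger0_norm (cutoff_ge0 _)).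
  have [x2|/ltW x2] := leP `|x| 2; first by rewrite ler_wpM2l ?cutoff_ge0// trigM.
  by rewrite cutoff_eq0// !mul0r.
- by apply: cutoff_integrable; exact: cst_continuous.
Qed.

(** One majorant serves all base points [z]; dividing by the weight afterwards turns it into the
    Poisson-type decay of the kernel. *)
Lemma cosker_expmaj : exists S, 0 <= S /\ forall z,
  expmaj S 4 (fun s => (1 + z ^+ 2) * cosker (z + s)).
Proof.
have [S [S0 SC]] := cosker_coef_le; exists S; split => // z.
exists (fun N => \poly_(m < N) cosker_coef z m); split; last exact: cosker_series.
move=> N m; rewrite coef_poly; case: ifP => _ //.
by rewrite normr0 mulr_ge0// mulr_ge0// exprn_ge0.
Qed.

Lemma measurable_cosker : measurable_fun [set: measurableTypeR R] cosker.
Proof.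
apply: (measurable_fun_cvg (h := fun N s => (\poly_(m < N) cosker_coef 0 m).[s])).
- by move=> N; apply: continuous_measurable_fun; exact: continuous_horner.
- by move=> s _; have := @cosker_series 0 s; rewrite expr0n addr0 mul1r add0r.
Qed.

Lemma cosker_decay : exists S, 0 <= S /\ forall z, `|cosker z| <= S / (1 + z ^+ 2).
Proof.
have [S [S0 SM]] := cutoff_moments; exists S; split => // z.
have := SM 0%N z 0; rewrite expr0 mulr1 /cosker.
by under eq_Rintegral do rewrite mulr1 addr0.
Qed.

Lemma coskerN z : cosker (- z) = cosker z.
Proof. by apply: eq_Rintegral => x _; rewrite mulNr cosN. Qed.

End CosineTransform.

(** * Positivity of the total mass of the cosine transform *)

Section CoskerMass.
Variable R : realType.
Local Notation mu := (@lebesgue_measure R).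
Implicit Types (x y z : R).

Lemma normr_onem_le1 x : 0 <= x -> x <= 1 -> `|1 - x| <= 1.
Proof. by move=> x0 x1; rewrite ler_norml; lra. Qed.

Lemma integrable_oneDsqrV : mu.-integrable setT (EFin \o (fun x => (1 + x ^+ 2)^-1)).
Proof.
have c : continuous (fun x : R => (1 + x ^+ 2)^-1) by exact: continuous_oneDsqrV.
apply/integrableP; split; first by apply/measurable_EFinP; exact: continuous_measurable_fun.
have p x : 0 <= (1 + x ^+ 2)^-1 by rewrite invr_ge0 addr_ge0// sqr_ge0.
under eq_integral do rewrite /= ger0_norm//.
rewrite ge0_symfun_integralT//; last by move=> x; rewrite /= sqrrN.
rewrite (_ : [set x : R | _] = `[0, +oo[%classic); last first.
  by apply/seteqP; split => x /=; rewrite in_itv/= andbT.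
by have := @integral0y_oneDsqr R; rewrite /oneDsqr => ->; rewrite -EFinM ltry.
Qed.

Lemma integrable_cosker : mu.-integrable setT (EFin \o @cosker R).
Proof.
have [S [S0 HS]] := cosker_decay R.
exact: (integrable_le_norm (@measurable_cosker R) HS (integrableZr_EFin S integrable_oneDsqrV)).
Qed.

Definition cosker_mass : R := \int[mu]_z cosker z.

(** A Fejer kernel, equal to [(1 - cos (N * x)) / (N * x ^+ 2)] for nonzero [x]. The interval enters
    as an indicator factor so that Fubini applies on the whole line. *)
Definition fejer N x : R :=
  \int[mu]_z (\1_(`]0, N]%classic) z * ((1 - z / N) * cos (z * x))).

Lemma fejerE N x : 0 < N -> fejer N x = \int[mu]_(z in `[0, N]) ((1 - z / N) * cos (z * x)).
Proof.
move=> N0; rewrite -Rintegral_itv_obnd_cbnd; last first.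
  apply: (@integrableS _ _ _ mu `[0, N]) => //.
    by move=> z /=; rewrite !in_itv/= => /andP[/ltW-> ->].
  apply: continuous_compact_integrable; first exact: segment_compact.
  apply: continuous_subspaceT => z; apply: cvgM.
    by apply: cvgB; [exact: cvg_cst | apply: cvgM => //; exact: cvg_cst].
  apply: (@continuous_comp _ _ _ (fun z => z * x) cos); last exact: continuous_cos.
  by apply: cvgM => //; exact: cvg_cst.
rewrite [RHS]Rintegral_mkcond; apply: eq_Rintegral => z _.
by rewrite patchE indicE; case: (z \in _); rewrite ?mul1r ?mul0r.
Qed.

Lemma fejer_ge0 N x : 0 < N -> x != 0 -> 0 <= fejer N x.
Proof.
move=> N0 x0; rewrite fejerE// /Rintegral.
(* The antiderivative given by one integration by parts. *)
pose F z := (1 - z / N) * (sin (z * x) / x) - cos (z * x) / (N * x ^+ 2).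
have dF (z : R) : is_derive z (1 : R) F ((1 - z / N) * cos (z * x)).
  have dz : is_derive z (1 : R) (fun z => 1 - z / N) (- N^-1).
    have := is_derive_affine (f := @idfun R) (a := - N^-1) (b := 1) (x := z) (is_derive_id _ _).
    rewrite mulr1; congr (is_derive _ _ _ _); apply/funext => t /=; ring.
  have ds : is_derive z (1 : R) (fun z => sin (z * x) / x) (cos (z * x)).
    have h := is_derive_affine (f := @sin R) (a := x) (b := 0) (x := z) (is_derive_sin _).
    have h2 := is_deriveM h (is_derive_cst x^-1 z (1 : R)).
    move: h2; rewrite (_ : (fun _ => _) * cst _ = (fun z => sin (z * x) / x)); last first.
      by apply/funext => t; rewrite -[LHS]/(sin (x * t + 0) / x) addr0 [x * t]mulrC.
    move=> h2; refine (is_derive_eq h2 _); rewrite /GRing.scale/= addr0 mulr0 add0r.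
    by rewrite mulrA mulVf// mul1r mulrC.
  have dc : is_derive z (1 : R) (fun z => cos (z * x) / (N * x ^+ 2)) (- sin (z * x) / (N * x)).
    have h := is_derive_affine (f := @cos R) (a := x) (b := 0) (x := z) (is_derive_cos _).
    have h2 := is_deriveM h (is_derive_cst (N * x ^+ 2)^-1 z (1 : R)).
    move: h2; rewrite (_ : (fun _ => _) * cst _ = (fun z => cos (z * x) / (N * x ^+ 2))); last first.
      by apply/funext => t; rewrite -[LHS]/(cos (x * t + 0) / (N * x ^+ 2)) addr0 [x * t]mulrC.
    move=> h2; refine (is_derive_eq h2 _); rewrite /GRing.scale/= addr0 mulr0 add0r.
    by rewrite [z * x]mulrC; field; rewrite x0 gt_eqF.
  have := is_deriveB (is_deriveM dz ds) dc.
  move=> h; refine (is_derive_eq h _); rewrite /GRing.scale/=.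
  by field; rewrite x0 gt_eqF.
have cF : continuous F.
  by move=> z; apply/differentiable_continuous/derivable1_diffP; case: (dF z).
rewrite (@continuous_FTC2 _ _ F)//.
- have -> : F N = - (cos (N * x) / (N * x ^+ 2)).
    by rewrite /F divff ?gt_eqF// subrr mul0r sub0r.
  have -> : F 0 = - (1 / (N * x ^+ 2)) by rewrite /F !mul0r sin0 cos0 mul0r mulr0 sub0r.
  rewrite -EFinB/= opprK addrC -mulrBl.
  by rewrite mulr_ge0 ?subr_ge0 ?cos_le1// invr_ge0 mulr_ge0 ?sqr_ge0// ltW.
- apply: continuous_subspaceT => z; apply: cvgM.
    by apply: cvgB; [exact: cvg_cst | apply: cvgM => //; exact: cvg_cst].
  apply: (@continuous_comp _ _ _ (fun z => z * x) cos); last exact: continuous_cos.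
  by apply: cvgM => //; exact: cvg_cst.
- split; [by move=> z _; case: (dF z)| |].
  + exact/cvg_at_right_filter/cF.
  + exact/cvg_at_left_filter/cF.
- by move=> z _; rewrite derive1E; case: (dF z).
Qed.

Lemma cos_ge_cos1 x : `|x| <= 1 -> cos 1 <= cos x.
Proof.
have H y : 0 <= y <= 1 -> cos 1 <= cos y.
  move=> /andP[y0 y1]; rewrite leNgt; have := pi_ge2 R => pi2.
  rewrite ltr_cos; first by rewrite -leNgt.
    by rewrite in_itv/=; apply/andP; split; lra.
  by rewrite in_itv/=; apply/andP; split; lra.
by move=> x1; have [x0|/ltW x0] := leP 0 x; [|rewrite -(cosN x)]; apply: H; move: x1; rewrite ler_norml; lra.
Qed.

Lemma continuous_fejer_term N x : continuous (fun z => (1 - z / N) * cos (z * x)).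
Proof.
move=> z; apply: cvgM.
  by apply: cvgB; [exact: cvg_cst | apply: cvgM => //; exact: cvg_cst].
apply: (@continuous_comp _ _ _ (fun z => z * x) cos); last exact: continuous_cos.
by apply: cvgM => //; exact: cvg_cst.
Qed.

Lemma integrable_fejer_term N x :
  mu.-integrable setT (EFin \o (fun z => \1_(`]0, N]%classic) z * ((1 - z / N) * cos (z * x)))).
Proof.
rewrite (_ : (fun z => _) = (fun z => (1 - z / N) * cos (z * x)) \_ `]0, N]); last first.
  by apply/funext => z; rewrite patchE indicE; case: (z \in _); rewrite ?mul1r ?mul0r.
rewrite -restrict_EFin; apply/integrable_restrict => //; rewrite setTI.
apply: (@integrableS _ _ _ mu `[0, N]) => //.
  by move=> z /=; rewrite !in_itv/= => /andP[/ltW-> ->].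
apply: continuous_compact_integrable; first exact: segment_compact.
exact/continuous_subspaceT/continuous_fejer_term.
Qed.

Lemma Rintegral_indic_itv (a b : R) b0 b1 : a <= b ->
  \int[mu]_z (\1_[set` Interval (BSide b0 a) (BSide b1 b)] z) = b - a.
Proof.
move=> ab; set i := Interval _ _.
have -> : \int[mu]_z (\1_[set` i] z) = fine (mu [set` i]).
  by rewrite /Rintegral integral_indic// setIT.
rewrite lebesgue_measure_itv/= lte_fin; case: ltP => [//|ba].
by have -> : a = b by [apply/eqP; rewrite eq_le ab ba]; rewrite subrr.
Qed.

(** For [z <= N] the argument [z * x] stays within [[-1, 1]]. On []0, N / 2]] the weight is at least
    1/2; on the rest of the interval the integrand is nonnegative. *)
Lemma fejer_ge N x : 0 < N -> `|x| <= N^-1 -> cos 1 * (N / 4) <= fejer N x.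
Proof.
move=> N0 xN.
have -> : cos 1 * (N / 4) = \int[mu]_z (cos 1 / 2 * \1_(`]0, N / 2]%classic) z).
  rewrite RintegralZl//; last exact: (integrable_indic_itv 0 (N / 2) false false).
  by rewrite Rintegral_indic_itv ?divr_ge0 ?ltW//; field.
apply: le_Rintegral => //.
- exact: (integrableZl measurableT (cos 1 / 2) (integrable_indic_itv 0 (N / 2) false false)).
- exact: integrable_fejer_term.
- move=> z _; have [zN|/negP zN] := boolP (z \in `]0, N]%R); last first.
    rewrite !indicE !memNset/= ?mulr0 ?mul0r//.
    by apply: contra_not zN; rewrite !in_itv/= => /andP[-> zN2]; lra.
  move: zN; rewrite in_itv/= => /andP[z0 zN].
  have zx : cos 1 <= cos (z * x).
    apply: cos_ge_cos1; rewrite normrM gtr0_norm//.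
    by rewrite (le_trans (ler_pM _ _ zN xN))// ?mulfV ?gt_eqF// ltW.
  have c1 := cos1_gt0 R.
  rewrite [in leRHS]indicE mem_set/= ?in_itv/= ?z0// mul1r.
  rewrite indicE; have [zN2|zN2] := boolP (_ \in _); last first.
    rewrite mulr0 mulr_ge0//; last by rewrite (le_trans _ zx)// ltW.
    by rewrite subr_ge0 ler_pdivrMr// mul1r.
  move: zN2; rewrite inE/= in_itv/= => /andP[_ zN2].
  have zN3 : z / N <= 2^-1 by rewrite ler_pdivrMr//; lra.
  by rewrite mulr1 mulrC; apply: ler_pM => //; [exact: ltW | lra].
Qed.

(* The Fejer means of the cosine transform of a nonnegative function that is 1
   near 0 are bounded below; letting N tend to infinity they converge to half
   of [cosker_mass], which is thus positive without Fourier inversion. *)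
Lemma fejer_cosker_ge N : 1 <= N ->
  cos 1 / 2 <= \int[mu]_z (\1_(`]0, N]%classic) z * (1 - z / N) * cosker z).
Proof.
move=> N1; have N0 : 0 < N by lra.
pose F (w : measurableTypeR R * measurableTypeR R) : R :=
  (\1_(`]0, N]%classic) w.1 * (1 - w.1 / N)) * (cutoff w.2 * cos (w.1 * w.2)).
have mF : measurable_fun setT F.
  apply: measurable_funM.
    apply: measurable_funM.
      by apply: (measurableT_comp _ (@measurable_fst _ _ _ _)); exact: measurable_indic.
    apply: (@measurableT_comp _ _ _ _ _ _ (fun z : measurableTypeR R => 1 - z / N) _ fst) => //.
    by apply: measurable_funB => //; apply: measurable_funM.
  apply: measurable_funM.
    apply: (@measurableT_comp _ _ _ _ _ _ (@cutoff R : measurableTypeR R -> _) _ snd) => //.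
    exact: (continuous_measurable_fun (smooth_continuous (@smooth_cutoff R))).
  apply: (measurableT_comp (continuous_measurable_fun (@continuous_cos R))).
  by apply: measurable_funM.
have Fle z x : `|F (z, x)| <= \1_(`]0, N]%classic) z * cutoff x.
  rewrite /F/= normrM; apply: ler_pM => //.
    rewrite indicE; case: (boolP (_ \in _)) => [|_]; last by rewrite !mul0r normr0.
    rewrite inE/= in_itv/= !mul1r => /andP[z0 zN].
    by apply: normr_onem_le1; [rewrite divr_ge0 ?(ltW z0) ?(ltW N0)|rewrite ler_pdivrMr// mul1r].
  by rewrite normrM ger0_norm ?cutoff_ge0// ler_piMr ?cutoff_ge0// cos_max.
have i1 : mu.-integrable setT (EFin \o (\1_(`]0, N]%classic) : R -> R)).
  exact: (integrable_indic_itv 0 N false false).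
have i2 : mu.-integrable setT (EFin \o @cutoff R).
  have := cutoff_integrable (@cst_continuous _ _ (1 : R)).
  by rewrite (_ : (fun x => _) = @cutoff R)//; apply/funext => x; rewrite mulr1.
have -> : \int[mu]_z (\1_(`]0, N]%classic) z * (1 - z / N) * cosker z) =
    \int[mu]_z \int[mu]_x F (z, x).
  apply: eq_Rintegral => z _; rewrite /F/= RintegralZl//.
  apply: cutoff_integrable => x.
  apply: (@continuous_comp _ _ _ (fun x => z * x) cos); last exact: continuous_cos.
  by apply: cvgM => //; exact: cvg_cst.
rewrite (Rintegral_Fubini mF Fle i1 i2).
have -> : \int[mu]_x \int[mu]_z F (z, x) = \int[mu]_x (cutoff x * fejer N x).
  apply: eq_Rintegral => x _; rewrite /F/= /fejer -RintegralZl//; last exact: integrable_fejer_term.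
  by apply: eq_Rintegral => z _; ring.
have -> : cos 1 / 2 = \int[mu]_x (cos 1 * (N / 4) * \1_(`[- N^-1, N^-1]%classic) x).
  rewrite RintegralZl//; last exact: (integrable_indic_itv (- N^-1) N^-1 true false).
  rewrite Rintegral_indic_itv; first by field; rewrite gt_eqF.
  by rewrite ge0_cp// invr_ge0 ltW.
have mG := measurable_fubini_G (integrable_prod_dominated mF Fle i1 i2).
have GE x : (\int[mu]_z (EFin \o F) (z, x))%E = (cutoff x * fejer N x)%:E.
  have fn := integrable_fin_num measurableT (integrable_section2 mF Fle i1 x).
  rewrite -[LHS]fineK//; congr EFin; rewrite /fejer -RintegralZl//; last exact: integrable_fejer_term.
  by apply: eq_Rintegral => z _; rewrite /F/=; ring.
have mcf : measurable_fun [set: measurableTypeR R] (fun x => cutoff x * fejer N x).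
  by apply/measurable_EFinP; apply: eq_measurable_fun mG => x _; rewrite /fubini_G GE.
have fN x : `|fejer N x| <= N.
  have NE : N = \int[mu]_z (\1_(`]0, N]%classic) z) by rewrite Rintegral_indic_itv ?subr0// ltW.
  rewrite [leRHS]NE; apply: le_normr_RintegralT i1.
    by apply/measurable_EFinP; exact: measurable_int (integrable_fejer_term N x).
  move=> z; rewrite indicE; case: (boolP (_ \in _)) => [|_]; last by rewrite mul0r normr0.
  rewrite inE/= in_itv/= mul1r => /andP[z0 zN].
  rewrite normrM -[leRHS]mulr1 ler_pM ?cos_max//.
  by apply: normr_onem_le1; [rewrite divr_ge0 ?(ltW z0) ?(ltW N0)|rewrite ler_pdivrMr// mul1r].
apply: le_Rintegral => //.
- exact: (integrableZl measurableT (cos 1 * (N / 4)) (integrable_indic_itv (- N^-1) N^-1 true false)).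
- apply: (integrable_le_norm mcf _ (integrableZr_EFin N i2)) => x.
  by rewrite normrM ger0_norm ?cutoff_ge0// mulrC ler_wpM2r ?cutoff_ge0.
- move=> x _; rewrite indicE; have [xN|xN] := boolP (_ \in _).
    move: xN; rewrite inE/= in_itv/= -ler_norml => xN; rewrite mulr1 cutoff_eq1 ?mul1r ?fejer_ge//.
    by rewrite (le_trans xN)// invf_le1.
  (* Outside the short interval [x] is nonzero, as [fejer_ge0] requires. *)
  rewrite mulr0 mulr_ge0 ?cutoff_ge0// fejer_ge0//.
  apply: contraNneq xN => ->; rewrite inE/= in_itv/= oppr_le0 invr_ge0 (ltW N0)//.
Qed.

Lemma Rintegral_even_half (f : R -> R) : mu.-integrable setT (EFin \o f) ->
  (forall x, f (- x) = f x) ->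
  \int[mu]_x f x = 2 * \int[mu]_x (\1_(`]0, +oo[%classic) x * f x).
Proof.
move=> fi fN.
have mI (D : set R) : measurable (D : set (measurableTypeR R)) -> mu.-integrable setT (EFin \o (fun x => \1_D x * f x)).
  move=> mD; rewrite (_ : (fun x => _) = f \_ D); last first.
    by apply/funext => z; rewrite patchE indicE; case: (z \in _); rewrite ?mul1r ?mul0r.
  rewrite -restrict_EFin; apply/integrable_restrict => //; rewrite setTI.
  exact: integrableS fi.
have neg : \int[mu]_x (\1_(`]-oo, 0[%classic) x * f x) = \int[mu]_x (\1_(`]0, +oo[%classic) x * f x).
  have n0 : (-1 : R) != 0 by rewrite oppr_eq0 oner_eq0.
  have := Rintegral_affine 0 n0 (mI `]0, +oo[%classic (measurable_itv _)).
  rewrite normrN1 invr1 mul1r => <-.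
  apply: eq_Rintegral => x _; rewrite mulN1r addr0 fN; congr (_ * _).
  rewrite !indicE (_ : (x \in _) = (- x \in `]0, +oo[%classic))//.
  by apply/idP/idP; rewrite !inE/= !in_itv/= ?andbT oppr_gt0.
have zer : \int[mu]_x (\1_[set 0] x * f x) = 0.
  rewrite (_ : (fun x => _) = f \_ [set 0]); last first.
    by apply/funext => z; rewrite patchE indicE; case: (z \in _); rewrite ?mul1r ?mul0r.
  by rewrite -Rintegral_mkcond Rintegral_set1.
have mn := mI `]-oo, 0[%classic (measurable_itv _).
have mp := mI `]0, +oo[%classic (measurable_itv _).
have mz := mI [set 0] (measurable_set1 _).
rewrite mulr_natl mulr2n -{1}neg; transitivity (\int[mu]_x (\1_(`]-oo, 0[%classic) x * f x) +
  \int[mu]_x (\1_(`]0, +oo[%classic) x * f x) + \int[mu]_x (\1_[set 0] x * f x)); last first.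
  by rewrite zer addr0.
rewrite -(RintegralD _ mn mp)// -(RintegralD _ (integrableD_EFin mn mp) mz)//.
apply: eq_Rintegral => x _; rewrite -!mulrDl -[LHS]mul1r; congr (_ * _).
have b1 : (x \in `]-oo, 0[%classic) = (x < 0) by apply/idP/idP; rewrite inE/= in_itv.
have b2 : (x \in `]0, +oo[%classic) = (0 < x) by apply/idP/idP; rewrite inE/= in_itv/= andbT.
have b3 : (x \in [set 0]) = (x == 0) by apply/idP/idP; rewrite inE/= => /eqP.
by rewrite !indicE b1 b2 b3; case: ltgtP => _; rewrite ?addr0 ?add0r.
Qed.

Lemma cosker_mass_gt0 : 0 < cosker_mass.
Proof.
rewrite /cosker_mass (Rintegral_even_half integrable_cosker); last exact: coskerN.
rewrite mulr_gt0// (@lt_le_trans _ _ (cos 1 / 2)) ?divr_gt0 ?cos1_gt0//.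
have [S [S0 HS]] := cosker_decay R.
pose h (n : nat) (z : R) := \1_(`]0, n.+1%:R]%classic) z * (1 - z / n.+1%:R) * cosker z.
have H : (\int[mu]_z h n z) @[n --> \oo] --> \int[mu]_z (\1_(`]0, +oo[%classic) z * cosker z).
  apply: (@Rintegral_dominated _ _ _ mu h (fun z => \1_(`]0, +oo[%classic) z * cosker z) (fun z => S * (1 + z ^+ 2)^-1)).
  - move=> n; apply: measurable_funM; last exact: measurable_cosker.
    apply: measurable_funM; first exact: measurable_indic.
    by apply: measurable_funB => //; apply: measurable_funM.
  - move=> z; apply: cvgM; last exact: cvg_cst.
    have [z0|z0] := ltP 0 z; last first.
      rewrite indicE memNset/=; last by rewrite in_itv/= andbT; apply/negP; rewrite -leNgt.
      rewrite (_ : (fun n => _) = cst 0); first exact: cvg_cst.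
      apply/funext => n; rewrite indicE memNset/= ?mul0r// in_itv/=.
      by apply/negP; rewrite negb_and -leNgt z0.
    rewrite indicE mem_set/=; last by rewrite in_itv/= z0.
    rewrite -[1%:R]mulr1; apply: cvgM.
      apply: cvg_near_cst; near=> n.
      rewrite indicE mem_set//= in_itv/= z0/=.
      near: n; exists (Num.truncn z).+1 => // n /= zn.
      by rewrite (le_trans (ltW (truncnS_gt _)))// ler_nat (leq_trans zn).
    rewrite -[1 in X in _ --> X]subr0; apply: cvgB; first exact: cvg_cst.
    rewrite -[X in _ --> X](mulr0 z); apply: cvgM; first exact: cvg_cst.
    exact: cvg_harmonic.
  - move=> n z; rewrite normrM; apply: (@le_trans _ _ (1 * `|cosker z|)); last first.
      by rewrite mul1r HS.
    rewrite ler_wpM2r// indicE; case: (boolP (_ \in _)) => [|_]; last by rewrite mul0r normr0.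
    rewrite inE/= in_itv/= mul1r => /andP[z0 zn].
    have zn1 : z / n.+1%:R <= 1 by rewrite ler_pdivrMr// mul1r.
    have zn0 : 0 <= z / n.+1%:R by rewrite divr_ge0// ltW.
    exact: normr_onem_le1.
  - exact: (integrableZl measurableT S integrable_oneDsqrV).
apply: (ler_cvg_to (cvg_cst _) H); apply: nearW => n.
by apply: fejer_cosker_ge; rewrite ler1n.
Unshelve. all: by end_near.
Qed.

End CoskerMass.

(** * Lebesgue measure on tuples *)

Section TupleIntegration.
Variable R : realType.
Local Notation mu := (@lebesgue_measure R).
Local Notation tup n := (n.-tuple (measurableTypeR R)).
Local Notation lam n := (@tuple_lebesgue R n).

Lemma measurable_tuple_map n (g : 'I_n -> measurableTypeR R -> measurableTypeR R) :
  (forall i, measurable_fun setT (g i)) ->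
  measurable_fun [set: tup n] (fun x : tup n => [tuple g i (tnth x i) | i < n] : tup n).
Proof.
move=> mg; apply/measurable_fun_tnthP => i.
rewrite (_ : _ \o _ = g i \o (fun x => tnth x i)); last first.
  by apply/funext => x /=; rewrite tnth_mktuple.
by apply: measurableT_comp => //; exact: measurable_tnth.
Qed.

Definition tpred n (x : tup n.+1) : tup n := [tuple of behead x].

Lemma tuple_consE n (x : tup n.+1) : tuple_cons (thead x, tpred x) = x.
Proof. by case/tupleP: x => x t; apply: val_inj; rewrite /= theadE. Qed.

Lemma thead_tuple_cons n (w : measurableTypeR R * tup n) : thead (tuple_cons w) = w.1.
Proof. by []. Qed.

Lemma tpred_tuple_cons n (w : measurableTypeR R * tup n) : tpred (tuple_cons w) = w.2.
Proof. exact: val_inj. Qed.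

Lemma tnth_tuple_cons0 n (w : measurableTypeR R * tup n) : tnth (tuple_cons w) ord0 = w.1.
Proof. by []. Qed.

Lemma tnth_tuple_consS n (w : measurableTypeR R * tup n) i :
  tnth (tuple_cons w) (lift ord0 i) = tnth w.2 i.
Proof. by case: w => x t; rewrite /tuple_cons tnthS. Qed.

Lemma lam_pushforward n (f : tup n.+1 -> \bar R) : measurable_fun setT f ->
  (forall x, 0 <= f x)%E ->
  (\int[lam n.+1]_x f x = \int[(mu \x lam n)%E]_w f (tuple_cons w))%E.
Proof.
move=> mf f0; have mc := @measurable_tuple_cons R n.
exact: (ge0_integral_pushforward mc).
Qed.

Lemma ge0_integral_tupleS n (f : tup n.+1 -> \bar R) : measurable_fun setT f ->
  (forall x, 0 <= f x)%E ->
  (\int[lam n.+1]_x f x = \int[mu]_x \int[lam n]_t f (tuple_cons (x, t)))%E.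
Proof.
move=> mf f0; have mc := @measurable_tuple_cons R n.
rewrite lam_pushforward// (fubini_tonelli1 (f \o tuple_cons))//.
  exact: (measurableT_comp mf mc).
by move=> w; exact: f0.
Qed.

Lemma tuple_tensor_integral n (u : R -> R) (v : tup n -> R) :
  mu.-integrable setT (EFin \o u) -> (lam n).-integrable setT (EFin \o v) ->
  (lam n.+1).-integrable setT (EFin \o (fun x => u (thead x) * v (tpred x))) /\
  \int[lam n.+1]_x (u (thead x) * v (tpred x)) = (\int[mu]_x u x) * \int[lam n]_x v x.
Proof.
move=> ui vi; have mc := @measurable_tuple_cons R n.
have mu_ : measurable_fun setT u by apply/measurable_EFinP; exact: measurable_int ui.
have mv : measurable_fun setT v by apply/measurable_EFinP; exact: measurable_int vi.
pose F (w : measurableTypeR R * tup n) := u w.1 * v w.2.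
have mF : measurable_fun setT F.
  by apply: measurable_funM; [exact: (measurableT_comp mu_)|exact: (measurableT_comp mv)].
have FF x t : `|F (x, t)| <= `|u x| * `|v t| by rewrite normrM.
have ui' := integrable_norm ui; have vi' := integrable_norm vi.
have iF := integrable_prod_dominated mF FF ui' vi'.
pose f (x : tup n.+1) := u (thead x) * v (tpred x).
have fF : f \o tuple_cons = F.
  by apply/funext => w; rewrite /f /= thead_tuple_cons tpred_tuple_cons.
have mf : measurable_fun setT f.
  apply: measurable_funM; first exact: (measurableT_comp mu_ (measurable_tnth ord0)).
  exact: (measurableT_comp mv (@measurable_behead _ _ n)).
have if_ : (lam n.+1).-integrable setT (EFin \o f).
  apply: (integrable_pushforward mc) => //; first exact/measurable_EFinP.
  by rewrite preimage_setT -compA fF.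
split => //.
have -> : \int[lam n.+1]_x f x = \int[(mu \x lam n)%E]_w F w.
  rewrite /Rintegral -fF; congr fine; apply: (integral_pushforward mc) => //.
    exact/measurable_EFinP.
  by rewrite preimage_setT -compA fF.
rewrite -(Rintegral_Fubini12 mF FF ui' vi').
under eq_Rintegral do rewrite /F/= RintegralZl//.
by rewrite RintegralZr.
Qed.

Lemma tensor_integral n (F : 'I_n -> R -> R) :
  (forall i, mu.-integrable setT (EFin \o F i)) ->
  (lam n).-integrable setT (EFin \o (fun x => \prod_(i < n) F i (tnth x i))) /\
  \int[lam n]_x (\prod_(i < n) F i (tnth x i)) = \prod_(i < n) \int[mu]_x F i x.
Proof.
elim: n F => [|n IH] F iF.
  rewrite big_ord0 (_ : (fun _ => _) = cst 1); last by apply/funext => x; rewrite big_ord0.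
  have l0 : lam 0 setT = 1%E by exact: diracT.
  split; last by rewrite (Rintegral_cst _ measurableT) (_ : fine _ = 1) ?mulr1//; exact: (congr1 fine l0).
  apply/integrableP; split; first by apply/measurable_EFinP; exact: measurable_cst.
  by under eq_integral do rewrite /= normr1; rewrite integral_cst// [X in (_ * X)%E](_ : _ = 1%E) ?mule1 ?ltry.
have [i1 i2] := IH (fun i => F (lift ord0 i)) (fun i => iF _).
have [i3 i4] := tuple_tensor_integral (iF ord0) i1.
have E : (fun x : tup n.+1 => \prod_(i < n.+1) F i (tnth x i)) =
    (fun x => F ord0 (thead x) * \prod_(i < n) F (lift ord0 i) (tnth (tpred x) i)).
  apply/funext => x; rewrite big_ord_recl; congr (_ * _).
  by apply: eq_bigr => i _; rewrite -{1}(tuple_consE x) tnth_tuple_consS.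
by rewrite E; split => //; rewrite i4 i2 big_ord_recl.
Qed.

Definition taffine n (a : R) (b : 'I_n -> R) (x : tup n) : tup n :=
  [tuple a * tnth x i + b i | i < n].

Lemma measurable_taffine n a (b : 'I_n -> R) : measurable_fun setT (taffine a b).
Proof. apply: (measurable_tuple_map (g := fun i (z : measurableTypeR R) => a * z + b i : measurableTypeR R)) => i.
exact: measurable_affine. Qed.

Lemma taffine_cons n a (b : 'I_n.+1 -> R) w : taffine a b (tuple_cons w) =
  tuple_cons (a * w.1 + b ord0, taffine a (fun i => b (lift ord0 i)) w.2).
Proof.
apply: eq_from_tnth => i; rewrite tnth_mktuple.
have [j ->|->] := unliftP ord0 i; last by rewrite !tnth_tuple_cons0.
by rewrite !tnth_tuple_consS tnth_mktuple.
Qed.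

(** Induction by slices: each slice is an affine preimage in one dimension less, and the remaining
    coordinate is an affine substitution on the line. Each step contributes one factor [|a|^-1]. *)
Lemma tuple_lebesgue_taffine n a (b : 'I_n -> R) (A : set (tup n)) : a != 0 -> measurable A ->
  lam n (taffine a b @^-1` A) = ((`|a|^-1 ^+ n)%:E * lam n A)%E.
Proof.
move=> a0; elim: n b A => [|n IH] b A mA.
  rewrite expr0 mul1e; congr (lam 0 _); apply/seteqP; split => x;
  by rewrite /preimage/= [taffine a b x]tuple0 [x]tuple0.
have mt := measurable_taffine a b.
have mS m (B : set (tup m)) : measurable B -> lam m B = (\int[lam m]_x (\1_B x)%:E)%E.
  by move=> mB; rewrite integral_indic// setIT.
have mB : measurable (taffine a b @^-1` A) by rewrite -[_ @^-1` _]setTI; exact: mt.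
have mI (B : set (tup n.+1)) : measurable B -> measurable_fun setT (EFin \o (\1_B : tup n.+1 -> R)).
  by move=> ?; apply/measurable_EFinP; exact: measurable_indic.
have mc := @measurable_tuple_cons R n.
have msec s : measurable [set t | A (tuple_cons (s, t))].
  rewrite -[X in measurable X]setTI.
  have := measurableT_comp mc (measurable_pair1 s (T2 := tup n)).
  by move/(_ measurableT _ mA).
rewrite (mS _ _ mB) (mS _ _ mA).
rewrite (ge0_integral_tupleS (mI _ mB)); last by move=> x; rewrite lee_fin.
rewrite (ge0_integral_tupleS (mI _ mA)); last by move=> x; rewrite lee_fin.
have inner x : (\int[lam n]_t (\1_(taffine a b @^-1` A) (tuple_cons (x, t)))%:E =
    (`|a|^-1 ^+ n)%:E * \int[lam n]_t (\1_A (tuple_cons ((a * x + b ord0)%R, t)))%:E)%E.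
  have E (B : set (tup n.+1)) s : measurable [set t | B (tuple_cons (s, t))] ->
      (\int[lam n]_t (\1_B (tuple_cons (s, t)))%:E = lam n [set t | B (tuple_cons (s, t))])%E.
    by move=> mBs; rewrite [RHS]mS.
  rewrite !E//.
    rewrite -(IH (fun i => b (lift ord0 i)))//; congr (lam n _); apply/seteqP; split => t /=;
    by rewrite /preimage/= taffine_cons.
  rewrite (_ : [set _ | _] = taffine a (fun i => b (lift ord0 i)) @^-1` [set t | A (tuple_cons ((a * x + b ord0), t))]).
    by rewrite -[X in measurable X]setTI; apply: measurable_taffine.
  by apply/seteqP; split => t /=; rewrite /preimage/= taffine_cons.
under eq_integral do rewrite inner.
pose g (s : measurableTypeR R) := (\int[lam n]_t (\1_A (tuple_cons (s, t)))%:E)%E.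
have mg : measurable_fun setT g.
  apply: (measurable_fun_fubini_tonelli_F (fun w => (\1_A (tuple_cons w))%:E)).
    exact: (measurableT_comp (mI _ mA) mc).
  by move=> w; rewrite lee_fin.
have g0 s : (0 <= g s)%E by apply: integral_ge0 => t _; rewrite lee_fin.
have a1 : 0 <= `|a|^-1 by rewrite invr_ge0.
have mga : measurable_fun setT (fun x : measurableTypeR R => g (a * x + b ord0)).
  exact: (measurableT_comp mg (measurable_affine a (b ord0))).
transitivity ((`|a|^-1 ^+ n)%:E * \int[mu]_x g (a * x + b ord0)%R)%E.
  by apply: ge0_integralZl => //; first [by move=> x _; exact: g0 | by rewrite lee_fin exprn_ge0].
by rewrite (ge0_integral_affine (b ord0) a0 mg g0) muleA -EFinM exprSr.
Qed.

End TupleIntegration.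

(** * Null functions detected by integrals over boxes *)

Section BoxUniqueness.
Variables (R : realType) (n : nat).
Local Notation mu := (@lebesgue_measure R).
Local Notation tup := (n.-tuple (measurableTypeR R)).
Local Notation lam := (@tuple_lebesgue R n).
Implicit Types (s t : 'I_n -> R) (h : tup -> R).

Definition tbox s t : set tup := [set x | forall i, s i < tnth x i <= t i].

Definition tboxes : set (set tup) := [set B | exists s t, B = tbox s t].

Lemma tboxI s t s' t' : tbox s t `&` tbox s' t' =
  tbox (fun i => Num.max (s i) (s' i)) (fun i => Num.min (t i) (t' i)).
Proof.
apply/seteqP; split => [x [xst xst'] i|x xst].
  by rewrite gt_max le_min; have /andP[-> ->] := xst i; have /andP[-> ->] := xst' i.
by split=> i; have := xst i; rewrite gt_max le_min => /andP[/andP[a b] /andP[c e]]; rewrite ?a ?b ?c ?e.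
Qed.

Lemma setI_closed_tboxes : setI_closed tboxes.
Proof.
move=> _ _ [s [t ->]] [s' [t' ->]]; rewrite tboxI.
by exists (fun i => Num.max (s i) (s' i)), (fun i => Num.min (t i) (t' i)).
Qed.

Lemma measurable_tbox s t : measurable (tbox s t).
Proof.
rewrite (_ : tbox s t = \bigcap_(i in [set: 'I_n]) (fun x : tup => tnth x i) @^-1` `]s i, t i]); last first.
  apply/seteqP; split => [x xst i _|x xst i]; first by rewrite /= in_itv/=.
  by have := xst i I; rewrite /= in_itv.
apply: fin_bigcap_measurable => // i _.
by rewrite -[X in measurable X]setTI; exact: measurable_tnth.
Qed.

Lemma tbox_indic s t x : \1_(tbox s t) x = \prod_(i < n) \1_(`]s i, t i]%classic) (tnth x i) :> R.
Proof.
rewrite indicE; case: (boolP (x \in _)) => [|].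
  rewrite inE => xst; rewrite big1// => i _; rewrite indicE mem_set//=.
  by rewrite in_itv/=.
rewrite notin_setE => /existsNP[i xi]; rewrite (bigD1 i)//= indicE memNset/=; last by rewrite in_itv.
by rewrite mul0r.
Qed.

Definition tcube k : set tup := tbox (fun=> - k%:R) (fun=> k%:R).

Lemma norm_bound_nat (x : tup) : exists k : nat, forall i, `|tnth x i| < k%:R.
Proof.
exists (\max_(i < n) (Num.truncn `|tnth x i|).+1) => i.
rewrite (lt_le_trans (truncnS_gt _))// ler_nat.
exact: (@leq_bigmax _ (fun i : 'I_n => (Num.truncn `|tnth x i|).+1) i).
Qed.

Lemma tcube_cover : \bigcup_k tcube k = setT.
Proof.
rewrite -subTset => x _; have [k xk] := norm_bound_nat x; exists k => // i.
by have := xk i; rewrite ltr_norml => /andP[-> /ltW].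
Qed.

(** The half-space where coordinate [i] exceeds [a] is the union over [k] of boxes with lower bound
    [a] in that coordinate and all other bounds [-k] or [k]. *)
Lemma measurable_tuple_boxes : @measurable _ tup = <<s tboxes >>.
Proof.
apply/seteqP; split; last first.
  apply: smallest_sub; first exact: sigma_algebra_measurable.
  by move=> _ [s [t ->]]; exact: measurable_tbox.
pose T0 := g_sigma_algebraType tboxes.
suff mid : measurable_fun [set: T0] (fun x : T0 => x : tup).
  by move=> A mA; have := mid measurableT A mA; rewrite setTI.
apply/measurable_fun_tnthP => i.
apply: (measurability _ (@RGenOInfty.measurableE R)).
move=> _ [_ [a ->] <-]; rewrite setTI.
rewrite (_ : _ @^-1` _ = \bigcup_k tbox (fun j => if j == i then a else - k%:R) (fun=> k%:R)); last first.
  apply/seteqP; split => [x|x [k _ xk]]; last first.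
    by have := xk i; rewrite eqxx /= in_itv/= andbT => /andP[].
  rewrite /= in_itv/= andbT => ax; have [k xk] := norm_bound_nat x.
  exists k => // j; have := xk j; rewrite ltr_norml => /andP[xl /ltW ->].
  by rewrite andbT; case: eqP => [->|_].
by apply: (@bigcupT_measurable _ T0) => k; apply: sub_sigma_algebra; eexists; eexists.
Qed.

(** Inside a fixed cube the sets over which [h] integrates to 0 form a Dynkin class that contains
    the boxes, hence all measurable sets. The argument is localised to cubes because [h] is only
    locally integrable; countably many cubes cover the space. *)
Lemma ae_eq0_boxes h : measurable_fun setT h ->
  (forall s t, lam.-integrable (tbox s t) (EFin \o h)) ->
  (forall s t, (\int[lam]_(x in tbox s t) (h x)%:E = 0)%E) ->
  {ae lam, forall x, h x = 0}.
Proof.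
move=> mh hi h0.
have on_cube k A : measurable A -> (\int[lam]_(x in tcube k `&` A) (h x)%:E = 0)%E.
  have mQ : measurable (tcube k) by exact: measurable_tbox.
  rewrite measurable_tuple_boxes; move: A.
  apply: (dynkin_induction (G := tboxes)).
  - exact: measurable_tuple_boxes.
  - exact: setI_closed_tboxes.
  - by rewrite setIT h0.
  - by move=> _ [s [t ->]]; rewrite /tcube tboxI h0.
  - move=> A mA A0.
    have iU : lam.-integrable ((tcube k `&` ~` A) `|` (tcube k `&` A)) (EFin \o h).
      by rewrite -setIUr setvU setIT; exact: hi.
    have := h0 (fun=> - k%:R) (fun=> k%:R); rewrite -/(tcube k).
    rewrite -{1}(setIT (tcube k)) -(setvU A) setIUr integral_setU.
    + by rewrite A0 adde0.
    + by apply: measurableI => //; exact: measurableC.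
    + exact: measurableI.
    + by apply: measurable_funTS; exact/measurable_EFinP.
    + by apply/disj_set2P; rewrite -setIIr setICl setI0.
  - move=> F mF tF F0; rewrite setI_bigcupr.
    rewrite integral_bigcup//.
    + by under eq_eseriesr do rewrite F0; rewrite eseries0.
    + by apply: trivIset_setIl.
    + by move=> j; apply: measurableI.
    + apply: integrableS (hi (fun=> - k%:R) (fun=> k%:R)) => //.
      * by apply: bigcupT_measurable => j; apply: measurableI.
      * by move=> x [j _ []].
have N0 k : lam.-negligible (tcube k `&` [set x | h x != 0]).
  have mQ : measurable (tcube k) by exact: measurable_tbox.
  have := integral_ae_eq mQ (hi _ _) (measurable_cst (0%E : \bar R)).
  have H E : E `<=` tcube k -> measurable E ->
    (\int[lam]_(x in E) (EFin \o h) x = \int[lam]_(x in E) cst 0 x)%E.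
    by move=> EQ mE; rewrite integral0 -(on_cube k E mE) setIidr.
  move/(_ H); apply: negligibleS => x [Qx hx] /= /(_ Qx) [] /eqP.
  by rewrite (negbTE hx).
have : lam.-negligible (\bigcup_k (tcube k `&` [set x | h x != 0])).
  exact: negligible_bigcup.
apply: negligibleS => x /= /eqP hx.
have : (\bigcup_k tcube k) x by rewrite tcube_cover.
by case=> k _ Qx; exists k.
Qed.

(** In each cube the slice lies in a box with one side of length 0. It serves to discard the
    hyperplanes through the faces of a box, which [slab_kernel_cvg] excludes. *)
Lemma negligible_hyperplane i (a : R) : lam.-negligible [set x | tnth x i = a].
Proof.
have mH : measurable [set x : tup | tnth x i = a].
  rewrite (_ : [set _ | _] = (fun x : tup => tnth x i) @^-1` [set a])//.
  by rewrite -[X in measurable X]setTI; apply: measurable_tnth => //; exact: measurable_set1.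
suff : lam.-negligible (\bigcup_k (tcube k `&` [set x | tnth x i = a])).
  by apply: negligibleS => x xi; have [k _ Qx] : (\bigcup_k tcube k) x by [rewrite tcube_cover]; exists k.
apply: negligible_bigcup => k.
have mB : measurable (tcube k `&` [set x | tnth x i = a]).
  by apply: measurableI => //; exact: measurable_tbox.
apply/negligibleP => //.
pose F j : R -> R := if j == i then \1_(`[a, a]%classic) else \1_(`]- k%:R, k%:R]%classic).
have iF j : mu.-integrable setT (EFin \o F j).
  by rewrite /F; case: ifP => _; exact: integrable_indic_itv.
have [iP PE] := tensor_integral iF.
have P0 : \int[lam]_x (\prod_(i < n) F i (tnth x i)) = 0.
  rewrite PE (bigD1 i)//= {1}/F eqxx Rintegral_indic_itv// subrr mul0r//.
have pos x : 0 <= \prod_(i < n) F i (tnth x i).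
  by apply: prodr_ge0 => j _; rewrite /F; case: ifP.
apply/eqP; rewrite -measure_le0.
apply: (@le_trans _ _ (\int[lam]_x (\prod_(i < n) F i (tnth x i))%:E)%E); last first.
  by rewrite -[leLHS]fineK ?integrable_fin_num// -[fine _]/(Rintegral _ _ _) P0.
apply: (@le_trans _ _ (\int[lam]_x (\1_(tcube k `&` [set x | tnth x i = a]) x)%:E)%E).
  by rewrite integral_indic// setIT.
apply: ge0_le_integral => //.
- by apply/measurable_EFinP; exact: measurable_indic.
- exact: measurable_int iP.
- move=> x _; rewrite lee_fin indicE; case: (boolP (_ \in _)) => // /[!inE]/= -[Qx xi].
  rewrite big1// => j _; rewrite /F; case: ifP => [/eqP ->|_]; rewrite indicE mem_set//= in_itv/=.
    by rewrite xi lexx.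
  exact: Qx.
Qed.

End BoxUniqueness.

(** * The reproducing formula *)

Section ApproximateIdentity.
Variable R : realType.
Local Notation mu := (@lebesgue_measure R).

(** For positive [b], the dilation that preserves the integral. *)
Definition dcosker (b z : R) : R := b * cosker (b * z).

Lemma measurable_dcosker b : measurable_fun [set: measurableTypeR R] (dcosker b).
Proof.
apply: measurable_funM => //; apply: (measurableT_comp (@measurable_cosker R)).
by apply: measurable_funM.
Qed.

Lemma measurable_dcosker_sub b y :
  measurable_fun [set: measurableTypeR R] (fun x => dcosker b (x - y)).
Proof. by apply: (measurableT_comp (measurable_dcosker b)); exact: measurable_funB. Qed.

Definition slab_kernel (b s t y : R) : R :=
  \int[mu]_x (\1_(`]s, t]%classic) x * dcosker b (x - y)).

Lemma slab_kernelE b s t y : 0 < b -> slab_kernel b s t y =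
  \int[mu]_z (\1_(`]s, t]%classic) (z / b + y) * cosker z).
Proof.
move=> b0; have bn0 : b != 0 by rewrite gt_eqF.
have i0 : mu.-integrable setT (EFin \o (fun z => \1_(`]s, t]%classic) (z / b + y) * cosker z)).
  apply: (integrable_le_norm _ _ (integrable_norm (@integrable_cosker R))).
    apply: measurable_funM; last exact: measurable_cosker.
    apply: (measurableT_comp (f := \1_(`]s, t]%classic) : measurableTypeR R -> R)).
      exact: measurable_indic.
    by apply: measurable_funD => //; apply: measurable_funM.
  move=> z; rewrite normrM/= indicE; case: (_ \in _); rewrite ?normr1 ?mul1r//.
  by rewrite normr0 mul0r.
have := Rintegral_affine (- b * y) bn0 i0; rewrite gtr0_norm// => H.
rewrite -[RHS](mulVKf bn0) -H /slab_kernel /dcosker.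
have Hi := integrable_affine (- b * y) bn0 i0.
rewrite -(@RintegralZl _ _ R mu setT (fun x => \1_(`]s, t]%classic) ((b * x + - b * y) / b + y) *
  cosker (b * x + - b * y)) b measurableT Hi).
apply: eq_Rintegral => x _.
have -> : b * x + - b * y = b * (x - y) by rewrite mulNr -mulrBr.
by rewrite mulrCA (mulrAC b) mulfV// mul1r subrK.
Qed.

Lemma slab_kernel_le b s t y : 0 < b ->
  `|slab_kernel b s t y| <= \int[mu]_z `|cosker z|.
Proof.
move=> b0; rewrite slab_kernelE//.
apply: le_normr_RintegralT (integrable_norm (@integrable_cosker R)).
  apply: measurable_funM; last exact: measurable_cosker.
  apply: (measurableT_comp (f := \1_(`]s, t]%classic) : measurableTypeR R -> R)).
    exact: measurable_indic.
  by apply: measurable_funD => //; apply: measurable_funM.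
move=> z; rewrite normrM/= indicE; case: (_ \in _); rewrite ?normr1 ?mul1r//.
by rewrite normr0 mul0r.
Qed.

(** Uniformity in [b >= b0] makes this a dominating function for growing bandwidth. For
    [|y| <= 2 * M] the integral of [|cosker|] suffices; beyond, [|x - y| >= |y| / 2], and
    [b * cosker (b * w)] is at most [S / (b * w ^+ 2)] in modulus. *)
Lemma slab_kernel_decay b0 s t : 0 < b0 -> exists C, 0 <= C /\
  forall b y, b0 <= b -> `|slab_kernel b s t y| <= C * (1 + y ^+ 2)^-1.
Proof.
move=> b00; have [S [S0 HS]] := @cosker_decay R.
pose I1 := \int[mu]_z `|cosker z|.
have I10 : 0 <= I1 by apply: Rintegral_ge0.
pose M := `|s| + `|t| + 1.
have M1 : 1 <= M by rewrite lerDr addr_ge0.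
pose L := `|t - s|.
exists (I1 * (1 + (2 * M) ^+ 2) + 8 * S / b0 * L).
have L0 : 0 <= L by exact: normr_ge0.
have C1 : 0 <= 8 * S / b0 * L by rewrite mulr_ge0// divr_ge0 ?mulr_ge0// ltW.
have C0 : 0 <= I1 * (1 + (2 * M) ^+ 2) by rewrite mulr_ge0// addr_ge0 ?sqr_ge0.
split => [|b y bb]; first exact: addr_ge0.
have bp : 0 < b by exact: lt_le_trans bb.
have y1 : 0 < 1 + y ^+ 2 by rewrite ltr_pwDl// sqr_ge0.
rewrite ler_pdivlMr//.
have [yM|yM] := leP `|y| (2 * M).
  apply: (@le_trans _ _ (I1 * (1 + (2 * M) ^+ 2))); last by rewrite lerDl.
  apply: ler_pM; [by []|exact: ltW|exact: slab_kernel_le|].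
  by rewrite lerD2l -real_normK ?num_real// lerXn2r ?nnegrE// mulr_ge0//; lra.
apply: (@le_trans _ _ (8 * S / b0 * L)); last by rewrite lerDr.
rewrite -ler_pdivlMr//.
have y2 : 1 <= y ^+ 2.
  by rewrite -real_normK ?num_real// expr_ge1//; lra.
have ker x : x \in `]s, t] -> `|dcosker b (x - y)| <= 8 * S / b0 / (1 + y ^+ 2).
  rewrite in_itv/= => /andP[sx xt].
  have xM : `|x| <= M - 1.
    by rewrite /M addrK ler_norml; have := ler_norm s; have := ler_norm t;
       have := ler_norm (- s); have := ler_norm (- t); rewrite !normrN;
       have := normr_ge0 s; have := normr_ge0 t; lra.
  have xy : `|y| / 2 <= `|x - y|.
    by rewrite distrC (le_trans _ (lerB_dist _ _))//; lra.
  have xy2 : y ^+ 2 / 4 <= (x - y) ^+ 2.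
    rewrite -(real_normK (num_real (x - y))) -(real_normK (num_real y)).
    have -> : `|y| ^+ 2 / 4 = (`|y| / 2) ^+ 2 by field.
    by rewrite lerXn2r ?nnegrE// divr_ge0.
  rewrite /dcosker normrM gtr0_norm// (le_trans (ler_wpM2l (ltW bp) (HS _)))//.
  have q1 : 0 < y ^+ 2 by lra.
  have q2 : 0 < (x - y) ^+ 2 by rewrite (lt_le_trans _ xy2)// divr_gt0.
  have q3 : 0 < b * (x - y) ^+ 2 by rewrite mulr_gt0.
  apply: (@le_trans _ _ (S / (b * (x - y) ^+ 2))).
    rewrite mulrA ler_pdivrMr ?ltr_pwDl ?sqr_ge0// [S / _]mulrC -mulrA ler_pdivlMl//.
    rewrite mulrA mulrC; apply: ler_wpM2l => //.
    by rewrite -subr_ge0 (_ : _ - _ = 1) ?ler01//; ring.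
  rewrite ler_pdivrMr// -!mulrA; apply: (@le_trans _ _ (S * 1)); first by rewrite mulr1.
  rewrite (mulrCA 8) ler_wpM2l// mulrA.
  rewrite [leRHS](_ : _ = (b / b0) * (8 * (x - y) ^+ 2 / (1 + y ^+ 2))); last first.
    by field; rewrite !gt_eqF.
  rewrite -[leLHS]mulr1 ler_pM//; first by rewrite ler_pdivlMr// mul1r.
  by rewrite ler_pdivlMr// mul1r; lra.
have iI : mu.-integrable setT (EFin \o (fun x => 8 * S / b0 / (1 + y ^+ 2) * \1_(`]s, t]%classic) x)).
  exact: (integrableZr_EFin _ (integrable_indic_itv s t false false)).
apply: (@le_trans _ _ (\int[mu]_x (8 * S / b0 / (1 + y ^+ 2) * \1_(`]s, t]%classic) x))).
  apply: le_normr_RintegralT iI.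
    by apply: measurable_funM; [exact: measurable_indic|exact: measurable_dcosker_sub].
  move=> x; rewrite normrM indicE; case: (boolP (x \in `]s, t]%classic)) => xst.
    by rewrite normr1 mul1r mulr1 ker//; move: xst; rewrite inE.
  by rewrite normr0 mul0r mulr0.
rewrite RintegralZl//; last exact: (integrable_indic_itv s t false false).
rewrite mulrAC ler_wpM2r ?invr_ge0 ?(ltW y1)//.
rewrite ler_wpM2l ?divr_ge0 ?mulr_ge0 ?(ltW b00)//.
have [st|ts] := leP s t; first by rewrite Rintegral_indic_itv// /L ler_norm.
by rewrite set_itv_ge ?bnd_simp -?leNgt ?(ltW ts)// indic0 /Rintegral integral0.
Qed.

(** After the substitution the indicator is evaluated at a point that tends to [y], so it is
    eventually constant in [m] when [y] is no endpoint. At an endpoint the side of approach would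
    depend on the sign of [z]. *)
Lemma slab_kernel_cvg (b s t y : R) : 0 < b -> y != s -> y != t ->
  slab_kernel (m.+2%:R * b) s t y @[m --> \oo] -->
  cosker_mass R * \1_(`]s, t]%classic) y.
Proof.
move=> b0 ys yt.
have -> : cosker_mass R * \1_(`]s, t]%classic) y =
    \int[mu]_z (\1_(`]s, t]%classic) y * cosker z).
  by rewrite mulrC; apply/esym/RintegralZl => //; exact: integrable_cosker.
have bm m : 0 < m.+2%:R * b by rewrite mulr_gt0.
under eq_fun do rewrite (slab_kernelE _ _ _ (bm _)).
apply: (@Rintegral_dominated _ _ _ mu
  (fun m z => \1_(`]s, t]%classic) (z / (m.+2%:R * b) + y) * cosker z)
  (fun z => \1_(`]s, t]%classic) y * cosker z) (fun z => `|cosker z|)).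
- move=> m; apply: measurable_funM; last exact: measurable_cosker.
  apply: (measurableT_comp (f := \1_(`]s, t]%classic) : measurableTypeR R -> R)).
    exact: measurable_indic.
  by apply: measurable_funD => //; apply: measurable_funM.
- move=> z; apply: cvgM; last exact: cvg_cst.
  apply: cvg_near_cst.
  have zy : z / (m.+2%:R * b) + y @[m --> \oo] --> y.
    rewrite -[X in _ --> X]add0r; apply: cvgD; last exact: cvg_cst.
    rewrite -[X in _ --> X](mulr0 (z / b)).
    under eq_fun do rewrite invfM [_^-1 / b]mulrC mulrA.
    apply: cvgM; first exact: cvg_cst.
    have := @cvg_harmonic R; rewrite -(cvg_shiftn 1).
    by under eq_fun do rewrite addn1.
  have ind x : (x \in `]s, t]%classic) = (s < x <= t) by apply/idP/idP; rewrite inE/= in_itv.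
  have E : \forall m \near \oo, (s < z / (m.+2%:R * b) + y <= t) = (s < y <= t).
    have [sy|sy|sy] := ltgtP y s; last by rewrite sy eqxx in ys.
      move: (zy) => /cvgr_lt/(_ _ sy); apply: filterS => m H.
      by rewrite ltNge (ltW H).
    have [ty|ty|ty] := ltgtP y t; last by rewrite ty eqxx in yt.
      move: (zy) (zy) => /cvgr_lt/(_ _ ty) H1 /cvgr_gt/(_ _ sy) H2.
      by apply: filterS2 H1 H2 => m H1 H2; rewrite H2 (ltW H1).
    move: (zy) => /cvgr_gt/(_ _ ty); apply: filterS => m H.
    by rewrite [X in _ && X = _]leNgt H/= andbF.
  by apply: filterS E => m; rewrite !indicE !ind => ->.
- move=> m z; rewrite normrM/= indicE; case: (_ \in _); rewrite ?normr1 ?mul1r//.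
  by rewrite normr0 mul0r.
- exact: integrable_norm (@integrable_cosker R).
Qed.

(** By [y ^+ 2 <= 2 * x ^+ 2 + 2 * (x - y) ^+ 2], decay in [x - y] is decay in [y] when [x] is
    confined to an interval. *)
Lemma dcosker_slab_bound b s t : 0 < b -> exists C, 0 <= C /\
  forall x y, x \in `]s, t] -> `|dcosker b (x - y)| <= C * (1 + y ^+ 2)^-1.
Proof.
move=> b0; have [S [S0 HS]] := @cosker_decay R.
pose M := `|s| + `|t|.
have M0 : 0 <= M by rewrite addr_ge0.
exists (b * S * (2 * (1 + M ^+ 2) * (1 + b ^- 2))); split.
  by rewrite !mulr_ge0 ?addr_ge0 ?sqr_ge0 ?invr_ge0 ?exprn_ge0// ltW.
move=> x y; rewrite in_itv/= => /andP[sx xt].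
have xM : `|x| <= M.
  by rewrite /M ler_norml; have := ler_norm s; have := ler_norm t;
     have := ler_norm (- s); have := ler_norm (- t); rewrite !normrN;
     have := normr_ge0 s; have := normr_ge0 t; lra.
have x2 : x ^+ 2 <= M ^+ 2 by rewrite -real_normK ?num_real// lerXn2r ?nnegrE.
have y1 : 0 < 1 + y ^+ 2 by rewrite ltr_pwDl// sqr_ge0.
have z1 : 0 < 1 + (b * (x - y)) ^+ 2 by rewrite ltr_pwDl// sqr_ge0.
rewrite /dcosker normrM gtr0_norm// (le_trans (ler_wpM2l (ltW b0) (HS _)))//.
rewrite mulrA -[leRHS]mulrA ler_wpM2l ?mulr_ge0 ?(ltW b0)//.
rewrite ler_pdivlMr// -ler_pdivlMl// ?invr_gt0// invrK mulrC.
have bV : 0 < b ^- 2 by rewrite invr_gt0 exprn_gt0.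
have e : b ^- 2 * (b * (x - y)) ^+ 2 = (x - y) ^+ 2 by field; rewrite gt_eqF.
have H1 : y ^+ 2 <= 2 * x ^+ 2 + 2 * (x - y) ^+ 2.
  by rewrite -subr_ge0 (_ : _ - _ = (2 * x - y) ^+ 2) ?sqr_ge0//; ring.
have := sqr_ge0 M; set M2 := M ^+ 2 in x2 *; set X2 := x ^+ 2 in x2 H1; move: e.
set Q := (b * (x - y)) ^+ 2; set P := (x - y) ^+ 2 in H1 *; set B := b ^- 2 in bV *.
move=> e M20.
have Q0 : 0 <= Q by rewrite sqr_ge0.
have X20 : 0 <= X2 by rewrite sqr_ge0.
have P0 : 0 <= P by rewrite sqr_ge0.
have MP : 0 <= M2 * P by rewrite mulr_ge0.
have MB : 0 <= M2 * B by rewrite mulr_ge0// ltW.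
have MQ : 0 <= M2 * Q by rewrite mulr_ge0.
have -> : 2 * (1 + M2) * (1 + B) * (1 + Q) =
  2 + 2 * M2 + 2 * B + 2 * Q + 2 * (B * Q) + 2 * (M2 * B) + 2 * (M2 * Q) + 2 * (M2 * (B * Q)).
  by ring.
by rewrite e; lra.
Qed.

End ApproximateIdentity.

Section ReproducingFormula.
Variables (R : realType) (n : nat).
Local Notation mu := (@lebesgue_measure R).
Local Notation tup := (n.-tuple (measurableTypeR R)).
Local Notation lam := (@tuple_lebesgue R n).
Implicit Types (x y : tup) (b : 'I_n -> R).

Definition tker b x y : R := \prod_(i < n) dcosker (b i) (tnth x i - tnth y i).

(** An integrable weight with values in [[0, 1]], so that functions of every [L^p] are integrable
    against it. Kernels at a fixed point and Fourier transforms of tensor tests are bounded by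
    multiples of it. *)
Definition tweight y : R := \prod_(i < n) (1 + tnth y i ^+ 2)^-1.

Lemma tweight_ge0 y : 0 <= tweight y.
Proof. by apply: prodr_ge0 => i _; rewrite invr_ge0 addr_ge0// sqr_ge0. Qed.

Lemma integrable_tweight : lam.-integrable setT (EFin \o tweight).
Proof. exact: (tensor_integral (fun=> integrable_oneDsqrV R)).1. Qed.

Lemma measurable_prod_fun d (T : measurableType d) (F : 'I_n -> T -> R) :
  (forall i, measurable_fun setT (F i)) -> measurable_fun setT (fun z => \prod_(i < n) F i z).
Proof.
move=> mF; rewrite (_ : (fun z => _) = \prod_(i < n) F i).
  by apply: (big_ind (fun f => measurable_fun setT f)) => //; move=> f g mf mg; exact: measurable_funM.
by apply/funext => z; rewrite fct_prodE.
Qed.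

Lemma measurable_tker_pair b : measurable_fun [set: tup * tup] (fun w => tker b w.1 w.2).
Proof.
apply: measurable_prod_fun => i.
apply: (measurableT_comp (measurable_dcosker (b i))); apply: measurable_funB.
  exact: (measurableT_comp (measurable_tnth i) measurable_fst).
exact: (measurableT_comp (measurable_tnth i) measurable_snd).
Qed.

Lemma tker_bound b s t : (forall i, 0 < b i) -> exists C, 0 <= C /\
  forall x y, tbox s t x -> `|tker b x y| <= C * tweight y.
Proof.
move=> b0; have /choice[C HC] := fun i => dcosker_slab_bound (s i) (t i) (b0 i).
exists (\prod_(i < n) C i); split; first by apply: prodr_ge0 => i _; case: (HC i).
move=> x y xst; rewrite /tker /tweight -big_split/= normr_prod; apply: ler_prod => i _.
rewrite normr_ge0/=; have [_ H] := HC i; apply: H.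
by rewrite in_itv/=; exact: xst.
Qed.

Lemma tker_integrable b (u : tup -> R) x : (forall i, 0 < b i) -> measurable_fun setT u ->
  lam.-integrable setT (EFin \o (fun y => `|u y| * tweight y)) ->
  lam.-integrable setT (EFin \o (fun y => u y * tker b x y)).
Proof.
move=> b0 mu_ iu.
have [C [C0 HC]] := tker_bound (fun i => tnth x i - 1) (fun i => tnth x i) b0.
apply: (integrable_le_norm _ _ (integrableZr_EFin C iu)).
  apply: measurable_funM => //.
  exact: (measurableT_comp (measurable_tker_pair b) (measurable_pair1 x)).
move=> y; rewrite normrM mulrCA ler_wpM2l// HC// => i.
by rewrite lexx andbT ltrBlDr ltrDl.
Qed.

(** By Fubini the average over [x] falls on the tensor kernel alone and factors into one-dimensional
    slab kernels, whose limit for large bandwidth is explicit. *)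
Lemma box_average_tker b (u : tup -> R) s t : (forall i, 0 < b i) -> measurable_fun setT u ->
  lam.-integrable setT (EFin \o (fun y => `|u y| * tweight y)) ->
  lam.-integrable (tbox s t) (EFin \o (fun x => \int[lam]_y (u y * tker b x y))) /\
  \int[lam]_(x in tbox s t) (\int[lam]_y (u y * tker b x y)) =
  \int[lam]_y (u y * \prod_(i < n) slab_kernel (b i) (s i) (t i) (tnth y i)).
Proof.
move=> b0 mu_ iu.
have [C [C0 HC]] := tker_bound s t b0.
pose F (w : tup * tup) := \1_(tbox s t) w.1 * (u w.2 * tker b w.1 w.2).
have mB : measurable (tbox s t) by exact: measurable_tbox.
have mF : measurable_fun setT F.
  apply: measurable_funM.
    by apply: (measurableT_comp (f := \1_(tbox s t) : tup -> R)); [exact: measurable_indic|exact: measurable_fst].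
  apply: measurable_funM; last exact: measurable_tker_pair.
  exact: (measurableT_comp mu_ measurable_snd).
have FF x y : `|F (x, y)| <= \1_(tbox s t) x * (C * (`|u y| * tweight y)).
  rewrite /F/= normrM indicE; case: (boolP (x \in _)) => [|_]; last by rewrite normr0 !mul0r.
  by rewrite inE => xst; rewrite normr1 !mul1r normrM mulrCA ler_wpM2l// HC.
have iB : lam.-integrable setT (EFin \o (\1_(tbox s t) : tup -> R)).
  rewrite (_ : \1_(tbox s t) = fun x => \prod_(i < n) \1_(`]s i, t i]%classic) (tnth x i)).
    exact: (tensor_integral (fun i => integrable_indic_itv (s i) (t i) false false)).1.
  by apply/funext => x; exact: tbox_indic.
have iCu := integrableZr_EFin C iu.
have E1 : (fun x => \int[lam]_y F (x, y)) = (fun x => \int[lam]_y (u y * tker b x y)) \_ (tbox s t).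
  apply/funext => x; rewrite patchE /F/= indicE; case: ifP => _.
    by under eq_Rintegral do rewrite mul1r.
  by under eq_Rintegral do rewrite mul0r; rewrite /Rintegral integral0.
split.
  have iF : lam.-integrable setT (fun x => (\int[lam]_y (F (x, y))%:E)%E).
    exact: (integrable_fubini_F (integrable_prod_dominated mF FF iB iCu)).
  rewrite -(setTI (tbox s t)); apply/integrable_restrict => //.
  apply: eq_integrable iF => // x _; rewrite restrict_EFin /= -E1 /Rintegral fineK//.
  exact: (integrable_fin_num measurableT (integrable_section1 mF FF iCu x)).
rewrite Rintegral_mkcond -E1 (Rintegral_Fubini mF FF iB iCu).
apply: eq_Rintegral => y _; rewrite /F/=.
have it i : mu.-integrable setT (EFin \o (fun z => \1_(`]s i, t i]%classic) z * dcosker (b i) (z - tnth y i))).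
  have [c [c0 Hc]] := dcosker_slab_bound (s i) (t i) (b0 i).
  apply: (integrable_le_norm _ _ (integrableZr_EFin (c * (1 + tnth y i ^+ 2)^-1)
     (integrable_indic_itv (s i) (t i) false false))).
    by apply: measurable_funM; [exact: measurable_indic|exact: measurable_dcosker_sub].
  move=> z; rewrite normrM indicE; case: (boolP (z \in _)) => zst.
    by rewrite normr1 mul1r mulr1 Hc//; move: zst; rewrite inE.
  by rewrite normr0 mul0r mulr0.
have [iP PE] := tensor_integral it.
rewrite -[X in _ = _ * X]PE -RintegralZl//.
apply: eq_Rintegral => x _; rewrite tbox_indic mulrCA; congr (_ * _).
by rewrite /tker -big_split.
Qed.

Lemma measurable_slab_kernel (b s t : R) : 0 < b ->
  measurable_fun [set: measurableTypeR R] (slab_kernel b s t).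
Proof.
move=> b0; have [C [C0 HC]] := dcosker_slab_bound s t b0.
pose F (w : measurableTypeR R * measurableTypeR R) := \1_(`]s, t]%classic) w.2 * dcosker b (w.2 - w.1).
have mF : measurable_fun setT F.
  apply: measurable_funM.
    apply: (measurableT_comp (f := \1_(`]s, t]%classic) : measurableTypeR R -> R)).
      exact: measurable_indic.
    exact: measurable_snd.
  by apply: (measurableT_comp (measurable_dcosker b)); exact: measurable_funB.
have FF z w : `|F (z, w)| <= C * (1 + z ^+ 2)^-1 * \1_(`]s, t]%classic) w.
  rewrite /F/= normrM indicE; case: (boolP (w \in _)) => wst.
    by rewrite normr1 mul1r mulr1 HC//; move: wst; rewrite inE.
  by rewrite normr0 mul0r mulr0.
have i1 := integrableZr_EFin C (integrable_oneDsqrV R).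
have i2 := integrable_indic_itv s t false false.
have mG := measurable_fubini_F (integrable_prod_dominated mF FF i1 i2).
apply/measurable_EFinP; apply: eq_measurable_fun mG => z _.
rewrite /= /slab_kernel /Rintegral fineK//.
exact: (integrable_fin_num measurableT (integrable_section1 mF FF i2 z)).
Qed.

Lemma Rintegral_dominated_ae d (T : measurableType d) (m : {measure set T -> \bar R})
    (f_ : nat -> T -> R) (f g : T -> R) :
  (forall k, measurable_fun [set: T] (f_ k)) -> measurable_fun [set: T] f ->
  {ae m, forall z, f_ ^~ z @ \oo --> f z} ->
  (forall k z, `|f_ k z| <= g z) -> m.-integrable setT (EFin \o g) ->
  (\int[m]_z f_ k z)%R @[k --> \oo] --> (\int[m]_z f z)%R.
Proof.
move=> mf_ mf ff fg ig.
have [] := @dominated_convergence _ _ _ m setT measurableT (fun k => EFin \o f_ k)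
  (EFin \o f) (EFin \o g).
- by move=> k; exact/measurable_EFinP.
- exact/measurable_EFinP.
- by apply: filterS ff => x fx _; apply: cvg_EFin; [exact: nearW|exact: fx].
- exact: ig.
- by apply/aeW => x k _; rewrite lee_fin.
by move=> fi _ H; apply: fine_cvg; rewrite /Rintegral fineK; [exact: H|exact: integrable_fin_num].
Qed.

(* Integrated over a box, the convolutions with the kernels of bandwidth
   [m.+2 * b] do not depend on [m]; as [m] grows they converge to
   [cosker_mass ^+ n] times the integral of [u] over the box. *)
Lemma reproducing_ae b (u : tup -> R) : (forall i, 0 < b i) -> measurable_fun setT u ->
  lam.-integrable setT (EFin \o (fun y => `|u y| * tweight y)) ->
  (forall (m : nat) x, \int[lam]_y (u y * tker (fun i => m.+2%:R * b i) x y) =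
    \int[lam]_y (u y * tker b x y)) ->
  {ae lam, forall x, cosker_mass R ^+ n * u x = \int[lam]_y (u y * tker b x y)}.
Proof.
move=> b0 mu_ iu Hm.
have bm m i : 0 < m.+2%:R * b i by rewrite mulr_gt0.
pose c := cosker_mass R.
pose v x := \int[lam]_y (u y * tker b x y).
have iuB s t : lam.-integrable setT (EFin \o (fun y => u y * \1_(tbox s t) y)).
  (* A bound of [1 / tweight] on the box, which gives integrability of [u] there. *)
  pose M := \prod_(i < n) (1 + (`|s i| + `|t i|) ^+ 2).
  have M0 : 0 <= M by apply: prodr_ge0 => i _; rewrite addr_ge0// sqr_ge0.
  apply: (integrable_le_norm _ _ (integrableZr_EFin M iu)).
    by apply: measurable_funM => //; apply: measurable_indic; exact: measurable_tbox.
  move=> y; rewrite normrM mulrCA ler_wpM2l// indicE.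
  case: (boolP (y \in _)) => [|_]; last by rewrite normr0 mulr_ge0// tweight_ge0.
  rewrite inE => yst; rewrite normr1 /M /tweight -big_split/=.
  apply: (@le_trans _ _ (\prod_(i < n) 1)); first by rewrite big1.
  apply: ler_prod => i _; rewrite ler01/= ler_pdivlMr ?ltr_pwDl ?sqr_ge0// mul1r lerD2l.
  rewrite -real_normK ?num_real// lerXn2r ?nnegrE ?addr_ge0//.
  have /andP[sy yt] := yst i; rewrite ler_norml.
  by have := ler_norm (s i); have := ler_norm (t i); have := ler_norm (- s i);
     have := ler_norm (- t i); rewrite !normrN;
     have := normr_ge0 (s i); have := normr_ge0 (t i); lra.
have lim_box s t : \int[lam]_(x in tbox s t) v x = c ^+ n * \int[lam]_y (u y * \1_(tbox s t) y).
  have /choice[C HC] := fun i => slab_kernel_decay (s i) (t i) (b0 i).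
  pose f_ m y := u y * \prod_(i < n) slab_kernel (m.+2%:R * b i) (s i) (t i) (tnth y i).
  pose f y := u y * \prod_(i < n) (c * \1_(`]s i, t i]%classic) (tnth y i)).
  have E m : \int[lam]_(x in tbox s t) v x = \int[lam]_y f_ m y.
    rewrite -(box_average_tker s t (bm m) mu_ iu).2.
    by apply: eq_Rintegral => x _; rewrite Hm.
  have -> : c ^+ n * \int[lam]_y (u y * \1_(tbox s t) y) = \int[lam]_y f y.
    rewrite -RintegralZl//; apply: eq_Rintegral => y _.
    by rewrite /f big_split/= prodr_const card_ord tbox_indic mulrCA.
  have msk m i : measurable_fun [set: tup] (fun y => slab_kernel (m.+2%:R * b i) (s i) (t i) (tnth y i)).
    apply: (measurableT_comp _ (measurable_tnth i)).
    by apply: measurable_slab_kernel.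
  have cvE : \int[lam]_y f_ m y @[m --> \oo] --> \int[lam]_y f y.
    apply: (@Rintegral_dominated_ae _ _ lam f_ f
      (fun y => (\prod_(i < n) C i) * (`|u y| * tweight y))).
    - by move=> m; apply: measurable_funM => //; apply: measurable_prod_fun => i.
    - apply: measurable_funM => //; apply: measurable_prod_fun => i.
      apply: measurable_funM => //; apply: (measurableT_comp _ (measurable_tnth i)).
      exact: measurable_indic.
    (* Almost every [y] avoids the finitely many hyperplanes through the faces of the box. *)
    - have : lam.-negligible (\big[setU/set0]_(i < n) ([set y | tnth y i = s i] `|` [set y | tnth y i = t i])).
        apply: (big_ind (fun A : set tup => lam.-negligible A)).
        - exact: negligible_set0.
        - exact: negligibleU.
        - by move=> i _; apply: negligibleU; exact: negligible_hyperplane.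
      apply: negligibleS => y /=; apply: contra_notP => ny.
      apply: cvgM; first exact: cvg_cst.
      apply: (cvg_big (@mul_continuous R)) => i _; apply: slab_kernel_cvg => //.
        by apply/eqP => yi; apply: ny; rewrite -bigcup_seq; exists i; [rewrite /= mem_index_enum|left].
      by apply/eqP => yi; apply: ny; rewrite -bigcup_seq; exists i; [rewrite /= mem_index_enum|right].
    - move=> m y; rewrite normrM mulrCA ler_wpM2l// normr_prod /tweight -big_split/=.
      apply: ler_prod => i _; rewrite normr_ge0/=; have [_ H] := HC i; apply: H.
      by rewrite -[leLHS]mul1r ler_pM2r// ler1n.
    - exact: (integrableZr_EFin (\prod_(i < n) C i) iu).
  have cst_ : (fun m => \int[lam]_y f_ m y) = cst (\int[lam]_(x in tbox s t) v x).
    by apply/funext => m; rewrite -(E m).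
  rewrite cst_ in cvE.
  by apply: (cvg_unique _ (cvg_cst _) cvE).
pose h x := c ^+ n * u x - v x.
have ivB s t : lam.-integrable (tbox s t) (EFin \o v).
  exact: (box_average_tker s t b0 mu_ iu).1.
(* Integrability over boxes makes [v] measurable on each cube, and every point is eventually inside
   the growing cubes. *)
have mv : measurable_fun setT v.
  apply: (measurable_fun_cvg (h := fun k => v \_ (@tcube R n k))).
    move=> k; apply: (proj1 (measurable_restrictT v (measurable_tbox _ _))).
    by apply/measurable_EFinP; exact: measurable_int (ivB _ _).
  move=> x _; have [k0 xk] := norm_bound_nat x.
  apply: cvg_near_cst; exists k0 => // k /= kk.
  rewrite patchE mem_set// => i; have := xk i; rewrite ltr_norml => /andP[xl xr].
  have kk' : (k0%:R : R) <= k%:R by rewrite ler_nat.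
  by apply/andP; split; [rewrite (le_lt_trans _ xl)// lerN2|rewrite (le_trans (ltW xr))].
have iuB' s t : lam.-integrable (tbox s t) (EFin \o u).
  rewrite -(setTI (tbox s t)); apply/integrable_restrict => //; first exact: measurable_tbox.
  apply: eq_integrable (iuB s t) => // y _; rewrite restrict_EFin /= patchE indicE.
  by case: (y \in _); rewrite ?mulr1 ?mulr0.
have iZ s t : lam.-integrable (tbox s t) (EFin \o (fun x => c ^+ n * u x)).
  exact: (integrableZl (measurable_tbox s t) (c ^+ n) (iuB' s t)).
have ih s t : lam.-integrable (tbox s t) (EFin \o h).
  exact: (integrableB (measurable_tbox s t) (iZ s t) (ivB s t)).
have h0 : {ae lam, forall x, h x = 0}.
  apply: ae_eq0_boxes => //.
    by apply: measurable_funB => //; exact: measurable_funM.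
  move=> s t; have mB : measurable (tbox s t) by exact: measurable_tbox.
  rewrite -[LHS]fineK ?integrable_fin_num//; congr EFin; rewrite -[LHS]/(Rintegral _ _ _).
  rewrite RintegralB// lim_box RintegralZl// Rintegral_mkcond.
  apply/eqP; rewrite subr_eq0; apply/eqP; congr (_ * _); apply: eq_Rintegral => y _.
  by rewrite patchE indicE; case: (y \in _); rewrite ?mulr1 ?mulr0.
by apply: filterS h0 => x /eqP; rewrite subr_eq0 => /eqP.
Qed.

End ReproducingFormula.

(** * Interpolation of band-limited functions *)

Section KernelInterpolation.
Variables (R : realType) (n : nat).
Local Notation mu := (@lebesgue_measure R).
Local Notation tup := (n.-tuple (measurableTypeR R)).
Local Notation lam := (@tuple_lebesgue R n).
Implicit Types (x y w : tup) (b : 'I_n -> R).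

Lemma expmaj_scale (M B th : R) g : expmaj M B g -> 0 <= M -> 0 <= B ->
  expmaj M (B * `|th|) (fun t => g (th * t)).
Proof.
move=> [P [PM Pg]] M0 B0; exists (fun N => \poly_(m < size (P N)) ((P N)`_m * th ^+ m)).
split=> [N m|t]; last first.
  rewrite (_ : (fun N => _) = (fun N => (P N).[th * t])); first exact: Pg.
  apply/funext => N; rewrite horner_poly horner_coef; apply: eq_bigr => i _.
  by rewrite exprMn mulrA.
rewrite coef_poly; case: ifP => _.
  rewrite normrM normrX exprMn mulrA [leRHS]mulrAC; apply: ler_wpM2r; last exact: PM.
  exact: exprn_ge0.
by rewrite normr0 divr_ge0// mulr_ge0// exprn_ge0// mulr_ge0.
Qed.

(** A product of Poisson kernels of widths [1 / b i], up to constants; [S] is the constant of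
    [cosker_expmaj]. *)
Definition poisson_prod (S : R) b x y : R :=
  \prod_(i < n) (b i * S / (1 + (b i * (tnth x i - tnth y i)) ^+ 2)).

Lemma poisson_prod_ge0 S b x y : 0 <= S -> (forall i, 0 < b i) -> 0 <= poisson_prod S b x y.
Proof.
by move=> S0 b0; apply: prodr_ge0 => i _; rewrite divr_ge0 ?mulr_ge0 ?addr_ge0 ?sqr_ge0// ltW.
Qed.

(* Along a line through [x] the kernel extends to an entire function of
   exponential type, with a majorant that still decays in [x - y]. *)
Lemma tker_line_expmaj S b x w y : 0 <= S ->
  (forall z, expmaj S 4 (fun s => (1 + z ^+ 2) * cosker (z + s))) ->
  (forall i, 0 < b i) ->
  expmaj (poisson_prod S b x y) (\sum_(i < n) 4 * `|b i * tnth w i|)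
    (fun t => tker b (taffine t (tnth x) w) y).
Proof.
move=> S0 HS b0.
pose z i := b i * (tnth x i - tnth y i).
have z1 i : 0 < 1 + z i ^+ 2 by rewrite ltr_pwDl// sqr_ge0.
apply: (@eq_rect _ (fun t => \prod_(i < n) (b i / (1 + z i ^+ 2) *
    ((1 + z i ^+ 2) * cosker (z i + (b i * tnth w i) * t)))) (expmaj _ _)); last first.
  apply/funext => t; rewrite /tker; apply: eq_bigr => i _.
  rewrite /dcosker tnth_mktuple -mulrA mulKf ?gt_eqF//; congr (_ * cosker _).
  by rewrite /z; ring.
apply: expmaj_prod => [i|i|i].
- by apply: divr_ge0; [exact: mulr_ge0 (ltW (b0 i)) S0|exact: ltW (z1 i)].
- by rewrite mulr_ge0.
- have p0 : 0 <= b i / (1 + z i ^+ 2) by rewrite divr_ge0// ltW.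
  have := expmajM (normr_ge0 _) (lexx 0) (expmaj_cst (b i / (1 + z i ^+ 2)))
     (expmaj_scale (b i * tnth w i) (HS (z i)) S0 (ler0n _ 4)).
  by rewrite add0r ger0_norm// mulrAC.
Qed.

Definition line_speed b w : R := \sum_(i < n) 4 * `|b i * tnth w i|.

Lemma line_speed_ge0 b w : 0 <= line_speed b w.
Proof. by apply: sumr_ge0 => i _; rewrite mulr_ge0. Qed.

Definition reproduced b (u : tup -> R) z : Prop :=
  cosker_mass R ^+ n * u z = \int[lam]_y (u y * tker b z y).

Lemma interp_tker S b x w y N (t : 'I_N -> R) : 0 <= S ->
  (forall z, expmaj S 4 (fun s => (1 + z ^+ 2) * cosker (z + s))) ->
  (forall i, 0 < b i) -> injective t -> (forall i, 0 <= t i <= 1) ->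
  `|interp_err t (fun t => tker b (taffine t (tnth x) w) y)| <=
    poisson_prod S b x y * (line_speed b w ^+ N / N`!%:R * expR (line_speed b w)).
Proof.
move=> S0 HS b0 tinj t01; have B0 := line_speed_ge0 b w.
rewrite !mulrA; apply: interp_err_expmaj => //; first exact: poisson_prod_ge0.
exact: tker_line_expmaj.
Qed.

(** The interpolation error is linear, so it passes under the integral of the reproducing formula
    and falls on the kernel, where it is at most [e] times the Poisson majorant. Integrating against
    [G] leaves [A * e]. *)
Lemma interp_reproducing S b (u G : tup -> R) x w N (t : 'I_N -> R) A e :
  0 <= S -> (forall z, expmaj S 4 (fun s => (1 + z ^+ 2) * cosker (z + s))) ->
  (forall i, 0 < b i) -> injective t -> (forall i, 0 <= t i <= 1) ->
  measurable_fun setT u -> (forall y, `|u y| <= G y) ->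
  lam.-integrable setT (EFin \o (fun y => `|u y| * tweight y)) ->
  lam.-integrable setT (EFin \o (fun y => G y * poisson_prod S b x y)) ->
  \int[lam]_y (G y * poisson_prod S b x y) <= A ->
  line_speed b w ^+ N / N`!%:R * expR (line_speed b w) <= e ->
  reproduced b u x -> (forall i, reproduced b u (taffine (t i) (tnth x) w)) ->
  cosker_mass R ^+ n * `|u x| <=
    cosker_mass R ^+ n * (\sum_(i < N) `|lagrange0 t i| * `|u (taffine (t i) (tnth x) w)|) + A * e.
Proof.
move=> S0 HS b0 tinj t01 mu_ uG iu iG GA Be rx rt.
set c := cosker_mass R ^+ n.
have c0 : 0 < c by rewrite exprn_gt0// cosker_mass_gt0.
have iK z : lam.-integrable setT (EFin \o (fun y => u y * tker b z y)) by exact: tker_integrable.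
have x0 : taffine 0 (tnth x) w = x.
  by apply: eq_from_tnth => i; rewrite tnth_mktuple mul0r add0r.
pose D y := interp_err t (fun t => tker b (taffine t (tnth x) w) y).
have E : c * (u x - \sum_(i < N) lagrange0 t i * u (taffine (t i) (tnth x) w)) =
    \int[lam]_y (u y * D y).
  have isum : lam.-integrable setT (EFin \o (fun y => \sum_(i < N) lagrange0 t i * (u y * tker b (taffine (t i) (tnth x) w) y))) /\
     \int[lam]_y (\sum_(i < N) lagrange0 t i * (u y * tker b (taffine (t i) (tnth x) w) y)) =
     \sum_(i < N) lagrange0 t i * (c * u (taffine (t i) (tnth x) w)).
    elim: (index_enum _) => [|i s [IH1 IH2]].
      have -> : (fun y => \sum_(i <- [::]) lagrange0 t i * (u y * tker b (taffine (t i) (tnth x) w) y)) = cst 0.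
        by apply/funext => y; rewrite big_nil.
      by rewrite big_nil; split; [exact: integrable0|rewrite /Rintegral integral0].
    have -> : (fun y => \sum_(i <- i :: s) lagrange0 t i * (u y * tker b (taffine (t i) (tnth x) w) y)) =
      (fun y => lagrange0 t i * (u y * tker b (taffine (t i) (tnth x) w) y) +
         \sum_(i <- s) lagrange0 t i * (u y * tker b (taffine (t i) (tnth x) w) y)).
      by apply/funext => y; rewrite big_cons.
    have ii := integrableZr_EFin (lagrange0 t i) (iK (taffine (t i) (tnth x) w)).
    split; first exact: integrableD_EFin.
    rewrite RintegralD// IH2 big_cons; congr (_ + _).
    by rewrite (rt i); apply: RintegralZl.
  have rx' : c * u x = \int[lam]_y (u y * tker b x y) by exact: rx.
  rewrite mulrBr rx' mulr_sumr.
  under [X in _ - X]eq_bigr do rewrite mulrCA.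
  rewrite -isum.2 -RintegralB//; last exact: isum.1.
  apply: eq_Rintegral => y _; rewrite /D /interp_err mulrBr mulr_sumr x0; congr (_ - _).
  by apply: eq_bigr => i _; rewrite mulrCA.
have Dle y : `|u y * D y| <= e * (G y * poisson_prod S b x y).
  have G0 : 0 <= G y by exact: le_trans (uG y).
  rewrite normrM mulrCA; apply: ler_pM => //.
  apply: (le_trans (interp_tker x w y S0 HS b0 tinj t01)).
  by rewrite mulrC ler_wpM2r// poisson_prod_ge0.
have mD : measurable_fun setT (fun y => u y * D y).
  apply: measurable_funM => //; rewrite /D /interp_err.
  have mk z : measurable_fun setT (fun y => tker b z y).
    exact: (measurableT_comp (measurable_tker_pair b) (measurable_pair1 z)).
  apply: measurable_funB => //.
  apply: measurable_sum => i; exact: measurable_funM.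
have H := le_normr_RintegralT mD Dle (integrableZr_EFin e iG).
have e0 : 0 <= e.
  apply: le_trans Be; rewrite mulr_ge0 ?expR_ge0// divr_ge0// exprn_ge0//.
  exact: line_speed_ge0.
have {H} : c * `|u x - \sum_(i < N) lagrange0 t i * u (taffine (t i) (tnth x) w)| <= A * e.
  rewrite -[c in leLHS](gtr0_norm c0) -normrM E (le_trans H)// RintegralZl// mulrC.
  by rewrite ler_wpM2r.
move=> H; set sg := \sum_(i < N) _ in H *; set sg' := \sum_(i < N) _.
have ss' : `|sg| <= sg'.
  by apply: (le_trans (ler_norm_sum _ _ _)); apply: ler_sum => i _; rewrite normrM.
have : `|u x| <= `|u x - sg| + sg'.
  by rewrite -{1}(subrK sg (u x)) (le_trans (ler_normD _ _))// lerD2l.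
by move=> /(ler_wpM2l (ltW c0)) K; rewrite (le_trans K)// mulrDr addrC lerD2l.
Qed.

End KernelInterpolation.

(** * Interpolation nodes on a segment that hit a given set *)

Section GridHits.
Variables (R : realType) (n : nat).
Local Notation mu := (@lebesgue_measure R).
Local Notation tup := (n.-tuple (measurableTypeR R)).
Local Notation lam := (@tuple_lebesgue R n).
Implicit Types (x w : tup) (a : 'I_n -> R).

Definition tcbox (c : 'I_n -> R) a : set tup := [set y | forall i, c i <= tnth y i <= c i + a i].

Lemma measurable_tcbox c a : measurable (tcbox c a).
Proof.
rewrite (_ : tcbox c a = \bigcap_(i in [set: 'I_n]) (fun x : tup => tnth x i) @^-1` `[c i, c i + a i]); last first.
  apply/seteqP; split => [x xst i _|x xst i]; first by rewrite /= in_itv/=.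
  by have := xst i I; rewrite /= in_itv.
apply: fin_bigcap_measurable => // i _.
by rewrite -[X in measurable X]setTI; exact: measurable_tnth.
Qed.

Lemma tcbox_indic c a x : \1_(tcbox c a) x =
  \prod_(i < n) \1_(`[c i, c i + a i]%classic) (tnth x i) :> R.
Proof.
rewrite indicE; case: (boolP (x \in _)) => [|].
  rewrite inE => xst; rewrite big1// => i _; rewrite indicE mem_set//=.
  by rewrite in_itv/=.
rewrite notin_setE => /existsNP[i xi]; rewrite (bigD1 i)//= indicE memNset/=; last by rewrite in_itv.
by rewrite mul0r.
Qed.

Lemma lam_tcbox c a : (forall i, 0 < a i) -> lam (tcbox c a) = (\prod_(i < n) a i)%:E.
Proof.
move=> a0.
have iI i : mu.-integrable setT (EFin \o (\1_(`[c i, c i + a i]%classic) : R -> R)).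
  exact: (integrable_indic_itv _ _ true false).
have [iP PE] := tensor_integral iI.
have E : (fun x => \prod_(i < n) \1_(`[c i, c i + a i]%classic) (tnth x i)) = (\1_(tcbox c a) : tup -> R).
  by apply/funext => x; rewrite tcbox_indic.
rewrite E in iP PE; have mB := measurable_tcbox c a.
have <- : \int[lam]_x \1_(tcbox c a) x = \prod_(i < n) a i.
  rewrite PE; apply: eq_bigr => i _; rewrite Rintegral_indic_itv ?lerDl ?ltW//.
  by rewrite addrC addKr.
rewrite /Rintegral fineK ?(integrable_fin_num measurableT iP)//.
by rewrite integral_indic// setIT.
Qed.

Lemma bernoulli_onem (x : R) m : 0 <= x -> x <= 1 -> 1 - m%:R * x <= (1 - x) ^+ m.
Proof.
move=> x0 x1; elim: m => [|m IH]; first by rewrite mul0r subr0 expr0.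
rewrite exprS (le_trans _ (ler_wpM2l _ IH)) ?subr_ge0// -natr1.
rewrite mulrBl mulrBr !mulr1 mulrDl !mul1r.
have : 0 <= m%:R * x * x by rewrite !mulr_ge0.
lra.
Qed.

(** In the increasing enumeration of [A] consecutive elements differ by at least 1, so differences
    of ranks bound differences of values. *)
Lemma ordinal_nodes M (A : {set 'I_M}) K : (K < #|A|)%N -> exists sg : 'I_K.+1 -> 'I_M,
  (forall i, sg i \in A) /\ (forall i j : 'I_K.+1, (i <= j)%N -> (j - i <= sg j - sg i)%N).
Proof.
move=> KA.
have /card_gt0P[j0 _] : (0 < #|A|)%N by exact: leq_trans KA.
pose sg (i : 'I_K.+1) := nth j0 (enum A) i.
have szA : size (enum A) = #|A| by rewrite -cardE.
have lt_nth p q : (p < q < #|A|)%N -> (nth j0 (enum A) p < nth j0 (enum A) q)%N.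
  move=> /andP[pq qA].
  have srt : sorted ltn [seq val j | j <- enum A].
    have -> : enum A = [seq j <- enum 'I_M | j \in A] by rewrite enumT.
    apply: (subseq_sorted ltn_trans (s2 := [seq val j | j <- enum 'I_M])).
      by apply: map_subseq; exact: filter_subseq.
    by rewrite val_enum_ord iota_ltn_sorted.
  have := @sorted_ltn_nth _ _ ltn_trans 0%N _ srt p q.
  by rewrite !inE !size_map szA (ltn_trans pq qA) qA !(nth_map j0) ?szA ?(ltn_trans pq qA)//; exact.
have gap p q : (p <= q < #|A|)%N -> (q - p <= nth j0 (enum A) q - nth j0 (enum A) p)%N.
  elim: q => [|q IH] /andP[pq qA]; first by rewrite sub0n.
  move: pq; rewrite leq_eqVlt => /orP[/eqP ->|]; first by rewrite subnn.
  rewrite ltnS => pq; have /IH H : (p <= q < #|A|)%N by rewrite pq ltnW.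
  have lt1 := lt_nth q q.+1; rewrite ltnSn qA in lt1; have {}lt1 := lt1 isT.
  have le1 : (nth j0 (enum A) p <= nth j0 (enum A) q)%N.
    move: pq; rewrite leq_eqVlt => /orP[/eqP ->//|pq].
    by apply/ltnW/lt_nth; rewrite pq ltnW.
  by rewrite subSn// (leq_ltn_trans H)// ltn_sub2r// (leq_ltn_trans le1).
exists sg; split => [i|i j ij].
  by rewrite -mem_enum mem_nth// szA (leq_trans (ltn_ord i)).
by apply: gap; rewrite ij (leq_trans (ltn_ord j)).
Qed.

(* Averaging over [w] in the box: when [t ^+ n >= 1 - g/2] the [w] with
   [x + t w] in [Q] have proportion at least [g/2], so some [w] hits [Q] at [N.+1]
   of the [M >= 2 N.+1 / g] equally spaced values of [t]. *)
Lemma grid_hits x a g N (Q : set tup) : (forall i, 0 < a i) -> (0 < n)%N -> 0 < g -> g <= 1 ->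
  measurable Q -> (lam (tcbox (tnth x) a `\` Q) <= (1 - g)%:E * (\prod_(i < n) a i)%:E)%E ->
  exists (w : tup) (t : 'I_N.+1 -> R),
    [/\ forall i, 0 <= tnth w i <= a i, forall i, 0 <= t i <= 1,
        forall i j : 'I_N.+1, (i <= j)%N ->
          g ^+ 2 / (6 * n%:R * N.+1%:R) * (j - i)%N%:R <= `|t j - t i| &
        forall i, Q (taffine (t i) (tnth x) w)].
Proof.
move=> a0 n0 g0 g1 mQ; set V := \prod_(i < n) a i => DV.
have V0 : 0 < V by apply: prodr_gt0.
(* At least [2 * N.+1 / g], which leaves enough hits, and at most [3 * N.+1 / g], which controls the
   separation of the nodes. *)
pose M := (Num.truncn (2 * N.+1%:R / g)).+1.
have M1 : 2 * N.+1%:R <= g * M%:R.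
  by rewrite [leRHS]mulrC -ler_pdivrMr// ltW// truncnS_gt.
have M2 : g * M%:R <= 3 * N.+1%:R.
  have : M%:R <= 2 * N.+1%:R / g + 1.
    by rewrite /M -natr1 lerD2r truncn_le// divr_ge0 ?mulr_ge0 ?ltW.
  move=> /(ler_wpM2l (ltW g0)); rewrite mulrDr mulrCA mulfV ?gt_eqF// !mulr1.
  have : (1 : R) <= N.+1%:R by rewrite ler1n.
  lra.
have nR : (0 : R) < n%:R by rewrite ltr0n.
have MR : (0 : R) < M%:R by rewrite ltr0n.
(* Chosen so that [n * s * M = g / 2]: by Bernoulli's inequality every [t = 1 - s * j] then
   satisfies [t ^+ n >= 1 - g / 2]. *)
pose s := g / (2 * n%:R * M%:R).
have s0 : 0 < s by rewrite divr_gt0 ?mulr_gt0.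
have sle : g ^+ 2 / (6 * n%:R * N.+1%:R) <= s.
  rewrite /s expr2 -mulrA ler_pM2l// ler_pdivrMr ?mulr_gt0// -mulrA ler_pdivlMl ?mulr_gt0//.
  rewrite [leRHS](_ : _ = 2 * n%:R * (3 * N.+1%:R)); last by ring.
  by rewrite [leLHS](_ : _ = 2 * n%:R * (g * M%:R)) ?ler_pM2l ?mulr_gt0//; ring.
have nsM : n%:R * (s * M%:R) = g / 2 by rewrite /s; field; rewrite ?gt_eqF.
have sM : s * M%:R <= g / 2.
  by rewrite -nsM ler_peMl ?ler1n// mulr_ge0 ?ltW.
pose t (j : 'I_M) : R := 1 - s * j%:R.
have sj (j : 'I_M) : 0 <= s * j%:R <= s * M%:R.
  apply/andP; split; first exact: mulr_ge0 (ltW s0) (ler0n _ _).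
  by apply: ler_wpM2l; [exact: ltW|rewrite ler_nat ltnW].
have t01 j : 0 < t j <= 1 by have := sj j; rewrite /t; lra.
have tn j : 1 - g / 2 <= t j ^+ n.
  have /andP[s1 s2] := sj j.
  apply: le_trans (bernoulli_onem n s1 _); last by lra.
  by rewrite lerD2l lerN2 -nsM ler_pM2l.
pose D := tcbox (tnth x) a `\` Q.
have mD : measurable D by apply: measurableD => //; exact: measurable_tcbox.
pose B0 := tcbox (fun=> 0) a.
have mB0 : measurable B0 by exact: measurable_tcbox.
pose miss w : {set 'I_M} := finset (fun j : 'I_M => `[< D (taffine (t j) (tnth x) w) >]).
have NM : (N.+1 <= M)%N.
  rewrite -(ler_nat R); have : g * M%:R <= M%:R by apply: ler_piMl => //; exact: ltW.
  have : (0 : R) <= N.+1%:R by [].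
  lra.
have [w [wB mw]] : exists w, B0 w /\ (#|miss w| <= M - N.+1)%N.
  (* Otherwise every [w] of the box misses [Q] at [M - N] values of [t] or more. Integrated over
     [w], the number of misses is then at least [(M - N) * V] and at most [M * (1 - g / 2) * V],
     against [g * M >= 2 * N.+1]. *)
  apply: contrapT => /forallNP H.
  have pre j : lam (taffine (t j) (tnth x) @^-1` D) = (((t j)^-1 ^+ n)%:E * lam D)%E.
    have /andP[tj0 _] := t01 j.
    by rewrite tuple_lebesgue_taffine ?gt_eqF// gtr0_norm.
  have mpre j : measurable (taffine (t j) (tnth x) @^-1` D).
    by rewrite -[X in measurable X]setTI; exact: measurable_taffine.
  have cnt w : (\sum_(j < M) \1_(taffine (t j) (tnth x) @^-1` D) w : R) = #|miss w|%:R.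
    rewrite -sum1_card natr_sum [RHS]big_mkcond/=; apply: eq_bigr => j _.
    rewrite indicE [in RHS]inE/=; case: asboolP => [h|h]; first by rewrite mem_set.
    by rewrite memNset.
  have I1 : (((M - N.+1).+1%:R)%:E * V%:E <= \int[lam]_w (\sum_(j < M) \1_(taffine (t j) (tnth x) @^-1` D) w)%:E)%E.
    rewrite -(lam_tcbox (fun=> 0) a0) -/B0.
    have -> : (((M - N.+1).+1%:R)%:E * lam B0 = \int[lam]_w (((M - N.+1).+1%:R)%:E * (\1_B0 w)%:E))%E.
      rewrite ge0_integralZl//; first by rewrite integral_indic// setIT.
      by apply/measurable_EFinP; exact: measurable_indic.
    apply: ge0_le_integral => //.
    - by apply/measurable_EFinP; apply: measurable_funM => //; exact: measurable_indic.
    - apply/measurable_EFinP; apply: measurable_sum => j; exact: measurable_indic.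
    move=> w _; rewrite -EFinM lee_fin cnt indicE; case: (boolP (w \in B0)) => wB.
      rewrite mulr1 ler_nat ltnNge; apply/negP => mw.
      by apply: (H w); split => //; move: wB; rewrite inE.
    by rewrite mulr0.
  have I2 : (\int[lam]_w (\sum_(j < M) \1_(taffine (t j) (tnth x) @^-1` D) w)%:E <=
      (M%:R * ((1 - g / 2) * V))%:E)%E.
    under eq_integral do rewrite -sumEFin.
    rewrite ge0_integral_sum//; last by move=> j; apply/measurable_EFinP; exact: measurable_indic.
    apply: (@le_trans _ _ (\sum_(j < M) ((1 - g / 2) * V)%:E)%E); last first.
      by rewrite sumEFin sumr_const card_ord mulr_natl.
    apply: lee_sum => j _; rewrite integral_indic// setIT.
    apply: (@le_trans _ _ (((t j)^-1 ^+ n)%:E * lam D)%E).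
      by have /eqP := pre j; rewrite eq_le => /andP[].
    have /andP[tj0 tj1] := t01 j.
    have p0 : 0 < t j ^+ n by rewrite exprn_gt0.
    apply: (le_trans (lee_wpmul2l _ DV)); first by rewrite lee_fin exprn_ge0// invr_ge0 ltW.
    rewrite -!EFinM lee_fin exprVn mulrA ler_pM2r// mulrC ler_pdivrMr//.
    have q0 : 0 <= 1 - g / 2 by lra.
    apply: le_trans (ler_wpM2l q0 (tn j)).
    (* This is [1 - g <= (1 - g / 2) ^+ 2]; one of the two factors stands for the lower bound of
       [t j ^+ n]. *)
    have := sqr_ge0 g; rewrite expr2; lra.
  have := le_trans I1 I2; rewrite -EFinM lee_fin mulrA ler_pM2r// -natr1 natrB//.
  lra.
have hitQ j : j \notin miss w -> Q (taffine (t j) (tnth x) w).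
  rewrite inE => /asboolPn nD; apply: contrapT => nQ; apply: nD; split => // i.
  rewrite tnth_mktuple; have := wB i; rewrite add0r => /andP[w0 w1].
  have /andP[tj0 tj1] := t01 j.
  have q0 : 0 <= t j * tnth w i by exact: mulr_ge0 (ltW tj0) w0.
  have q1 : t j * tnth w i <= a i by apply: (le_trans _ w1); exact: ler_piMl.
  by apply/andP; split; [rewrite lerDr|rewrite addrC lerD2l].
have cA : (N.+1 <= #|(~: miss w)%SET|)%N.
  have := cardsC (miss w); rewrite card_ord.
  by move=> E; move: mw; rewrite -(leq_add2r #|(~: miss w)%SET|) E -leq_subLR subKn.
have [sg [sgA sggap]] := ordinal_nodes cA.
exists w, (fun i => t (sg i)); split.
- by move=> i; have := wB i; rewrite add0r.
- by move=> i; have /andP[/ltW -> ->] := t01 (sg i).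
- move=> i j ij; rewrite /t opprD addrACA subrr add0r opprK addrC -mulrBr normrM (gtr0_norm s0).
  apply: ler_pM => //; first by rewrite divr_ge0 ?mulr_ge0 ?sqr_ge0 ?ltW.
  have := sggap i j ij; rewrite -(ler_nat R) => /le_trans; apply.
  have [le|/ltnW le] := leqP (sg i) (sg j); first by rewrite natrB// distrC ler_norm.
  by rewrite (eqP (_ : sg j - sg i == 0)%N) ?subn_eq0// normr_ge0.
- by move=> i; apply: hitQ; have := sgA i; rewrite inE.
Qed.

End GridHits.

Section InterpolationConstants.
Variables (R : realType).
Local Notation mu := (@lebesgue_measure R).

Lemma expn_fact_le (x : R) m : 0 <= x -> x ^+ m / m`!%:R <= expR x.
Proof.
move=> x0; apply: (le_trans _ (sum_exp_le m.+1 x0)).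
by rewrite big_ord_recr/= lerDr sumr_ge0// => i _; rewrite divr_ge0// exprn_ge0.
Qed.

(** With a spacing of order [1 / N.+1] the bound of [sum_lagrange0_le] contains [N.+1 ^+ N / N!],
    which is at most [expR N.+1]: the factorial compensates the crowding of the nodes. *)
Lemma sum_lagrange0_grid n g N (t : 'I_N.+1 -> R) : (0 < n)%N -> 0 < g -> g <= 1 ->
  (forall i, 0 <= t i <= 1) ->
  (forall i j : 'I_N.+1, (i <= j)%N ->
    g ^+ 2 / (6 * n%:R * N.+1%:R) * (j - i)%N%:R <= `|t j - t i|) ->
  \sum_i `|lagrange0 t i| <= (12 * expR 1 * n%:R / g ^+ 2) ^+ N.+1.
Proof.
move=> n0 g0 g1 t01 tt; have nR : (0 : R) < n%:R by rewrite ltr0n.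
have n1 : (1 : R) <= n%:R by rewrite ler1n.
have s0 : 0 < g ^+ 2 / (6 * n%:R * N.+1%:R) by rewrite divr_gt0 ?exprn_gt0 ?mulr_gt0.
apply: (le_trans (sum_lagrange0_le s0 t01 tt)).
have -> : 2 / (g ^+ 2 / (6 * n%:R * N.+1%:R)) = 12 * n%:R / g ^+ 2 * N.+1%:R :> R.
  by field; rewrite !gt_eqF ?exprn_gt0.
rewrite exprMn -[leLHS]mulrA.
have -> : 12 * expR 1 * n%:R / g ^+ 2 = 12 * n%:R / g ^+ 2 * expR 1 :> R by ring.
rewrite [leRHS]exprMn -[expR 1 ^+ _]expRM_natl mulr1.
have d0 : 1 <= 12 * n%:R / g ^+ 2.
  have g2 : 0 < g ^+ 2 by rewrite exprn_gt0.
  rewrite ler_pdivlMr// mul1r; have : g ^+ 2 <= 1 by rewrite exprn_ile1// ltW.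
  lra.
apply: ler_pM.
- by rewrite exprn_ge0// (le_trans ler01).
- by rewrite divr_ge0// exprn_ge0.
- by rewrite ler_weXn2l.
- exact: expn_fact_le.
Qed.

(* [B ^+ K / K`! <= (B e / K) ^+ K]; the constant 96 is 24 * 4, where 24 pays
   for the factors 3 and 8 and 4 for [B <= 4 * sg]. *)
Lemma interp_error_small (B sg q r : R) n N : (0 < n)%N -> 0 <= B -> B <= 4 * sg -> 1 <= q ->
  0 <= r -> r <= q ->
  96 * expR 5 * q * (n%:R + sg) <= N.+1%:R ->
  3 * r ^+ n * (B ^+ N.+1 / N.+1`!%:R * expR B) <= 8^-1.
Proof.
move=> n0 B0 Bsg q1 r0 rq HK; set K := N.+1 in HK *.
have sg0 : 0 <= sg by lra.
have n1 : (1 : R) <= n%:R by rewrite ler1n.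
have KR : (0 : R) < K%:R by rewrite ltr0n.
have e1 : 1 <= expR (5 : R) by rewrite -[X in X <= _]expR0 ler_expR.
have e0 : 0 < expR (5 : R) by exact: expR_gt0.
have q0 : 0 < q by lra.
have eq1 : 1 <= expR 5 * q by rewrite -[X in X <= _]mulr1; apply: ler_pM => //; lra.
have nsK : 96 * (n%:R + sg) <= K%:R.
  apply: le_trans HK; rewrite -mulrA -mulrA ler_pM2l// mulrA ler_peMl//; lra.
have nK : (n <= K)%N by rewrite -(ler_nat R); lra.
have BK : B <= 4 * K%:R by lra.
have eB : expR B <= expR 4 ^+ K by rewrite -expRM_natl ler_expR mulrC.
have rK : r ^+ n <= q ^+ K.
  apply: (@le_trans _ _ (q ^+ n)); first by rewrite lerXn2r// nnegrE ltW.
  by rewrite ler_weXn2l.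
have T24 : 24 <= (24 : R) ^+ K by rewrite -[X in X <= _]expr1 ler_weXn2l// ler1n.
have BKe : B ^+ K / K`!%:R <= (B / K%:R * expR 1) ^+ K.
  rewrite exprMn -expRM_natl mulr1 expr_div_n.
  have -> : B ^+ K / K`!%:R = B ^+ K / K%:R ^+ K * (K%:R ^+ K / K`!%:R).
    by field; rewrite ?gt_eqF ?exprn_gt0 ?ltr0n ?fact_gt0.
  apply: ler_wpM2l; first by rewrite divr_ge0 ?exprn_ge0.
  exact: expn_fact_le.
rewrite -(@ler_pM2l _ 8)// mulfV//; set X := B ^+ K / _ * _.
have -> : 8 * (3 * r ^+ n * X) = 24 * r ^+ n * X by ring.
apply: (@le_trans _ _ (24 ^+ K * q ^+ K * ((B / K%:R * expR 1) ^+ K * expR 4 ^+ K))).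
  apply: ler_pM.
  - by rewrite mulr_ge0 ?exprn_ge0.
  - by rewrite mulr_ge0 ?expR_ge0// divr_ge0// exprn_ge0.
  - by apply: ler_pM => //; rewrite exprn_ge0.
  - by apply: ler_pM => //; rewrite ?expR_ge0// divr_ge0// exprn_ge0.
rewrite -!exprMn; apply: exprn_ile1.
  by rewrite !mulr_ge0 ?expR_ge0 ?invr_ge0 ?(ltW q0) ?(ltW KR).
have -> : 24 * q * (B / K%:R * expR 1 * expR 4) = 24 * expR 5 * q * B / K%:R.
  have -> : expR 5 = expR 1 * expR 4 :> R by rewrite -expRD; congr expR; ring.
  by ring.
rewrite ler_pdivrMr// mul1r; apply: le_trans HK.
rewrite [leRHS](_ : _ = 24 * expR 5 * q * (4 * (n%:R + sg))); last by ring.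
apply: ler_wpM2l; first by rewrite !mulr_ge0 ?expR_ge0 ?(ltW q0).
lra.
Qed.

End InterpolationConstants.

Section GoodPoint.
Variables (R : realType) (n : nat).
Local Notation mu := (@lebesgue_measure R).
Local Notation tup := (n.-tuple (measurableTypeR R)).
Local Notation lam := (@tuple_lebesgue R n).
Implicit Types (x w : tup) (a b : 'I_n -> R).

(* Otherwise [G] is small on most of the box at [x]; interpolating [u] and [v]
   from [N.+1] such points on a common line through [x] makes [G x] small. *)
Lemma dense_near_good_point (S W q : R) b a (gam : R) N (E : set tup) (u v G : tup -> R) x :
  0 <= S -> (forall z, expmaj S 4 (fun s => (1 + z ^+ 2) * cosker (z + s))) ->
  0 <= W -> 1 <= q -> W <= q * cosker_mass R ->
  (forall i, 0 < b i) -> (forall i, 0 < a i) -> (0 < n)%N -> 0 < gam -> gam <= 1 ->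
  96 * expR 5 * q * (n%:R + \sum_(i < n) a i * b i) <= N.+1%:R ->
  measurable_fun setT u -> measurable_fun setT v -> measurable_fun setT G ->
  (forall y, `|u y| <= G y) -> (forall y, `|v y| <= G y) -> (forall y, G y <= `|u y| + `|v y|) ->
  lam.-integrable setT (EFin \o (fun y => `|u y| * tweight y)) ->
  lam.-integrable setT (EFin \o (fun y => `|v y| * tweight y)) ->
  lam.-integrable setT (EFin \o (fun y => G y * poisson_prod S b x y)) ->
  \int[lam]_y (G y * poisson_prod S b x y) <= 3 * W ^+ n * G x ->
  {ae lam, forall z, reproduced b u z} -> {ae lam, forall z, reproduced b v z} ->
  reproduced b u x -> reproduced b v x -> 0 < G x ->
  measurable E ->
  (gam%:E * (\prod_(i < n) a i)%:E <= lam (E `&` tcbox (tnth x) a))%E ->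
  ((gam / 2)%:E * (\prod_(i < n) a i)%:E <=
    lam (E `&` tcbox (tnth x) a `&`
         [set y | ((gam ^+ 2 / (48 * expR 1 * n%:R)) ^+ N.+1 / 8 * G x <= G y)%R]))%E.
Proof.
move=> S0 HS W0 q1 Wq b0 a0 n0 g0 g1 HN mu_ mv mG uG vG Guv iu iv iG GA aeu aev rux rvx Gx mE HE.
set V := \prod_(i < n) a i in HE *; set c := cosker_mass R in Wq.
have c0 : 0 < c by exact: cosker_mass_gt0.
set del := (_ ^+ N.+1 / 8); set H := [set y | del * G x <= G y].
have nR : (0 : R) < n%:R by rewrite ltr0n.
have V0 : 0 < V by exact: prodr_gt0.
have mB : measurable (tcbox (tnth x) a) by exact: measurable_tcbox.
set B := tcbox (tnth x) a in HE mB *.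
have mH : measurable H.
  rewrite /H -[X in measurable X]setTI; apply: measurable_fun_le => //; exact: measurable_cst.
rewrite leNgt; apply/negP => small.
have [N0 [mN0 N00 N0rep]] : exists N0, [/\ measurable N0, lam N0 = 0%E &
    forall z, ~ N0 z -> reproduced b u z /\ reproduced b v z].
  have [N0 [mN0 N00 sub]] : {ae lam, forall z, reproduced b u z /\ reproduced b v z}.
    by apply: filterS2 aeu aev => z.
  exists N0; split; [exact: mN0|exact: N00|].
  by move=> z nz; apply: contrapT => nr; apply: nz; apply: sub.
(* The nodes are sought where [G] is small and both reproducing formulas hold. *)
pose Q := (E `\` H) `\` N0.
have mQ : measurable Q by do 2 apply: measurableD => //.
have g20 : 0 < gam / 2 by rewrite divr_gt0.
have g21 : gam / 2 <= 1 by lra.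
have lB : lam B = V%:E by exact: lam_tcbox.
(* The box minus [Q] is covered by its part outside [E], the large-value part of [E], which is small
   by the assumption to be refuted, and a null set. *)
have HQ : (lam (B `\` Q) <= (1 - gam / 2)%:E * V%:E)%E.
  have sub : B `\` Q `<=` (B `\` E) `|` (E `&` B `&` H) `|` N0.
    move=> y [By nQ]; have [Ny|nNy] := pselect (N0 y); first by right.
    left; have [Ey|nEy] := pselect (E y); last by left.
    right; split => //; apply: contrapT => nHy; exact: nQ.
  have m1 : measurable (B `\` E) by exact: measurableD.
  have m2 : measurable (E `&` B `&` H) by do 2 apply: measurableI => //.
  apply: (@le_trans _ _ (lam ((B `\` E) `|` (E `&` B `&` H) `|` N0))).
    apply: le_measure => //; rewrite inE; first exact: measurableD.
    by do 2 apply: measurableU => //.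
  have U1 : (lam ((B `\` E) `|` (E `&` B `&` H) `|` N0) <=
      lam ((B `\` E) `|` (E `&` B `&` H)) + lam N0)%E.
    by apply: measureU2 => //; exact: measurableU.
  have U2 : (lam ((B `\` E) `|` (E `&` B `&` H)) <= lam (B `\` E) + lam (E `&` B `&` H))%E.
    exact: measureU2.
  apply: (le_trans U1); rewrite [X in (_ + X)%E]N00 adde0; apply: (le_trans U2).
  have -> : ((1 - gam / 2)%:E * V%:E = (1 - gam)%:E * V%:E + (gam / 2)%:E * V%:E)%E.
    by rewrite -!EFinM -EFinD; congr EFin; rewrite -mulrDl; congr (_ * _); lra.
  apply: leeD; last exact: ltW.
  have fB : (lam B < +oo)%E by apply: (@le_lt_trans _ _ V%:E); rewrite ?ltry// -lB.
  have lBE : (lam (B `\` E) = lam B - lam (E `&` B))%E by rewrite (setIC E); exact: measureD.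
  rewrite lBE.
  have -> : ((1 - gam)%:E * V%:E = V%:E - gam%:E * V%:E)%E.
    by rewrite -!EFinM -EFinB; congr EFin; rewrite mulrBl mul1r.
  apply: leeB; last exact: HE.
  by have /eqP := lB; rewrite eq_le => /andP[].
have [w [t [wa t01 tt tQ]]] := grid_hits N a0 n0 g20 g21 mQ HQ.
have tinj : injective t.
  have sp : 0 < (gam / 2) ^+ 2 / (6 * n%:R * N.+1%:R) by rewrite divr_gt0 ?exprn_gt0 ?mulr_gt0.
  suff lem (i j : 'I_N.+1) : (i <= j)%N -> t i = t j -> i = j.
    move=> i j ij; have [le|/ltnW le] := leqP i j; first exact: lem.
    by apply/esym/lem.
  move=> ij tij; have := tt i j ij; rewrite tij subrr normr0 pmulr_rle0// lern0 subn_eq0 => ji.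
  by apply/val_inj/eqP; rewrite eqn_leq ij.
have Lam := sum_lagrange0_grid n0 g20 g21 t01 tt.
set La := \sum_i _ in Lam.
set K := N.+1 in Lam HN del H mH small Q mQ HQ tQ *.
(* The base in [sum_lagrange0_grid] for the density [gam / 2], which turns 12 into 48; thus [del] is
   [D ^- K / 8]. *)
pose D := 48 * expR 1 * n%:R / gam ^+ 2.
have gg : 0 < gam ^+ 2 by rewrite exprn_gt0.
have e10 := expR_gt0 (1 : R).
have LD : La <= D ^+ K.
  rewrite (_ : D = 12 * expR 1 * n%:R / (gam / 2) ^+ 2)// /D; field.
  by rewrite gt_eqF.
have D0 : 0 < D by rewrite divr_gt0 ?mulr_gt0.
have delD : del = D ^- K / 8.
  by rewrite /del -exprVn; congr (_ ^+ _ / _); rewrite /D invf_div.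
have del0 : 0 < del by rewrite delD divr_gt0// invr_gt0 exprn_gt0.
have B4 : line_speed b w <= 4 * \sum_(i < n) a i * b i.
  rewrite /line_speed mulr_sumr; apply: ler_sum => i _.
  have /andP[w0 w1] := wa i.
  rewrite ger0_norm ?mulr_ge0// ?(ltW (b0 i))// ler_wpM2l// mulrC.
  by apply: ler_wpM2r => //; exact: ltW (b0 i).
have r0 : 0 <= W / c by exact: divr_ge0 W0 (ltW c0).
have rq : W / c <= q by rewrite ler_pdivrMr.
have err := interp_error_small n0 (line_speed_ge0 b w) B4 q1 r0 rq HN.
set e := line_speed b w ^+ K / K`!%:R * expR (line_speed b w) in err.
have rep i : reproduced b u (taffine (t i) (tnth x) w) /\ reproduced b v (taffine (t i) (tnth x) w).
  by have [_] := tQ i; exact: N0rep.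
have Glow i : G (taffine (t i) (tnth x) w) <= del * G x.
  have [[_ nH] _] := tQ i; rewrite leNgt; apply/negP => lt; apply: nH; exact: ltW.
have cn0 : 0 < c ^+ n by rewrite exprn_gt0.
(* Two contributions of at most [G x / 8]: the values at the nodes, by the choice of [del], and the
   error, by [interp_error_small] with [r = W / c]. Applied to [u] and [v], this gives
   [G x <= G x / 2], a contradiction. *)
have one (f : tup -> R) : measurable_fun setT f -> (forall y, `|f y| <= G y) ->
    lam.-integrable setT (EFin \o (fun y => `|f y| * tweight y)) -> reproduced b f x ->
    (forall i, reproduced b f (taffine (t i) (tnth x) w)) ->
    c ^+ n * `|f x| <= c ^+ n * (G x / 4).
  move=> mf fG ifw rfx rfi.
  have := interp_reproducing S0 HS b0 tinj t01 mf fG ifw iG GA (lexx e) rfx rfi.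
  move/le_trans; apply; rewrite -/c.
  have -> : c ^+ n * (G x / 4) = c ^+ n * (G x / 8) + c ^+ n * (G x / 8).
    by rewrite -mulrDr; congr (_ * _); field.
  apply: lerD.
    apply: ler_wpM2l; first exact: ltW.
    apply: (@le_trans _ _ (\sum_(i < K) `|lagrange0 t i| * (del * G x))).
      by apply: ler_sum => i _; apply: ler_wpM2l => //; exact: le_trans (fG _) (Glow i).
    rewrite -mulr_suml (le_trans (ler_wpM2r _ LD))//; first exact: mulr_ge0 (ltW del0) (ltW Gx).
    by rewrite delD !mulrA mulfV ?gt_eqF ?exprn_gt0// mul1r mulrC.
  have -> : 3 * W ^+ n * G x * e = c ^+ n * (3 * (W / c) ^+ n * e * G x).
    rewrite expr_div_n; field; exact: lt0r_neq0.
  apply: ler_wpM2l; first exact: ltW.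
  by rewrite mulrC; apply: ler_wpM2l; first exact: ltW.
have Ou := one u mu_ uG iu rux (fun i => (rep i).1).
have Ov := one v mv vG iv rvx (fun i => (rep i).2).
move: Ou Ov; rewrite !ler_pM2l// => Ou Ov.
have := Guv x; lra.
Qed.

End GoodPoint.

(** * From good points to norms *)

Section PoissonKernel.
Variables (R : realType) (n : nat).
Local Notation mu := (@lebesgue_measure R).
Local Notation tup := (n.-tuple (measurableTypeR R)).
Local Notation lam := (@tuple_lebesgue R n).
Implicit Types (x y : tup) (b : 'I_n -> R).

Definition oneDsqrV_mass : R := \int[mu]_x (1 + x ^+ 2)^-1.

Lemma oneDsqrV_mass_ge0 : 0 <= oneDsqrV_mass.
Proof. by apply: Rintegral_ge0 => x _; rewrite invr_ge0 addr_ge0// sqr_ge0. Qed.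

Lemma poisson_line (b S y : R) : 0 < b ->
  mu.-integrable setT (EFin \o (fun z => b * S / (1 + (b * (z - y)) ^+ 2))) /\
  \int[mu]_z (b * S / (1 + (b * (z - y)) ^+ 2)) = S * oneDsqrV_mass.
Proof.
move=> b0; have bn0 : b != 0 by rewrite gt_eqF.
have E : (fun z => b * S / (1 + (b * (z - y)) ^+ 2)) =
    (fun z => (b * S) * (fun z => (1 + z ^+ 2)^-1) (b * z + - b * y)).
  by apply/funext => z; congr (_ / (1 + _ ^+ 2)); rewrite mulrBr mulNr.
have i1 := integrable_affine (- b * y) bn0 (integrable_oneDsqrV R).
rewrite E; split; first exact: (integrableZr_EFin (b * S) i1).
rewrite (@RintegralZl _ _ R mu setT _ (b * S) measurableT i1).
rewrite (Rintegral_affine (- b * y) bn0 (integrable_oneDsqrV R)) gtr0_norm//.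
by rewrite -/oneDsqrV_mass mulrACA mulfV// mul1r.
Qed.

Lemma poisson_prodC S b x y : poisson_prod S b x y = poisson_prod S b y x.
Proof.
apply: eq_bigr => i _; congr (_ / (1 + _)).
by rewrite -sqrrN -mulrN opprB.
Qed.

Lemma poisson_prod_integral S b x : (forall i, 0 < b i) ->
  lam.-integrable setT (EFin \o poisson_prod S b x) /\
  \int[lam]_y poisson_prod S b x y = (S * oneDsqrV_mass) ^+ n.
Proof.
move=> b0.
have -> : poisson_prod S b x = (fun y => \prod_(i < n) (b i * S / (1 + (b i * (tnth y i - tnth x i)) ^+ 2))).
  by apply/funext => y; rewrite poisson_prodC.
have [iP ->] := tensor_integral (fun i => (poisson_line S (tnth x i) (b0 i)).1).
split => //; rewrite (eq_bigr (fun=> S * oneDsqrV_mass)) => [|i _]; last exact: (poisson_line _ _ (b0 i)).2.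
by rewrite prodr_const card_ord.
Qed.

Lemma ge0_poisson_prod_integral S b x : 0 <= S -> (forall i, 0 < b i) ->
  (\int[lam]_y (poisson_prod S b y x)%:E = ((S * oneDsqrV_mass) ^+ n)%:E)%E.
Proof.
move=> S0 b0; have [iP PE] := poisson_prod_integral S x b0.
rewrite -PE /Rintegral fineK; last exact: (integrable_fin_num measurableT iP).
by apply: eq_integral => y _; rewrite poisson_prodC.
Qed.

Lemma measurable_poisson_pair S b :
  measurable_fun [set: tup * tup] (fun w => poisson_prod S b w.1 w.2).
Proof.
apply: measurable_prod_fun => i; apply: measurable_funM => //.
have m1 : measurable_fun [set: measurableTypeR R] (fun z : measurableTypeR R => (1 + z ^+ 2)^-1 : R).
  by apply/measurable_EFinP; exact: measurable_int (integrable_oneDsqrV R).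
apply: (measurableT_comp (f := fun z : measurableTypeR R => (1 + z ^+ 2)^-1 : R)) => //.
apply: measurable_funM => //; apply: measurable_funB.
  exact: (measurableT_comp (measurable_tnth i) measurable_fst).
exact: (measurableT_comp (measurable_tnth i) measurable_snd).
Qed.

Lemma tcbox_indic_sub a x y : \1_(tcbox (tnth x) a) y =
  \prod_(i < n) \1_(`[0, a i]%classic) (tnth y i - tnth x i) :> R.
Proof.
rewrite tcbox_indic; apply: eq_bigr => i _; rewrite !indicE; congr (nat_of_bool _)%:R.
apply/idP/idP; rewrite !inE/= !in_itv/= => /andP[h1 h2]; apply/andP; split; move: h1 h2;
by rewrite ?subr_ge0 ?lerBlDl.
Qed.

Lemma measurable_tcbox_pair a : measurable_fun [set: tup * tup]
  (fun w => \1_(tcbox (tnth w.1) a) w.2 : R).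
Proof.
rewrite (_ : (fun w => _) = fun w : tup * tup =>
    \prod_(i < n) \1_(`[0, a i]%classic) (tnth w.2 i - tnth w.1 i)); last first.
  by apply/funext => w; exact: tcbox_indic_sub.
apply: measurable_prod_fun => i.
apply: (measurableT_comp (f := \1_(`[0, a i]%classic) : measurableTypeR R -> R)).
  exact: measurable_indic.
apply: measurable_funB.
  exact: (measurableT_comp (measurable_tnth i) measurable_snd).
exact: (measurableT_comp (measurable_tnth i) measurable_fst).
Qed.

(** The corners [x] of the boxes that contain [y] fill a box with the same sides; after Tonelli this
    evaluates the inner integral. *)
Lemma tcbox_indicC a x y :
  \1_(tcbox (tnth x) a) y = \1_(tcbox (fun i => tnth y i - a i) a) x :> R.
Proof.
rewrite !indicE; congr (nat_of_bool _)%:R; apply/idP/idP; rewrite !inE => H i;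
by have := H i; rewrite subrK lerBlDr andbC.
Qed.

Lemma lerD1_powR (t p : R) : 0 <= t -> 1 <= p -> t <= 1 + t `^ p.
Proof.
move=> t0 p1; have [t1|t1] := leP t 1; first by rewrite (le_trans t1)// lerDl powR_ge0.
by rewrite (le_trans (le1r_powR (ltW t1) p1))// lerDr.
Qed.

(* [t <= 1 + t ^ p] with [t = G y / G x] reduces the first moment to the
   [p]-th one, uniformly in [p]. *)
Lemma good_point_poisson S W b (G : tup -> R) x p : 0 <= S -> S * oneDsqrV_mass <= W ->
  (forall i, 0 < b i) -> 1 <= p -> measurable_fun setT G -> (forall y, 0 <= G y) -> 0 < G x ->
  (\int[lam]_y (G y `^ p * poisson_prod S b x y)%:E <= (2 * W ^+ n * G x `^ p)%:E)%E ->
  lam.-integrable setT (EFin \o (fun y => G y * poisson_prod S b x y)) /\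
  \int[lam]_y (G y * poisson_prod S b x y) <= 3 * W ^+ n * G x.
Proof.
move=> S0 SW b0 p1 mG G0 Gx hx.
have P0 y : 0 <= poisson_prod S b x y by exact: poisson_prod_ge0.
have gx : 0 < G x `^ p by exact: powR_gt0.
have mP : measurable_fun setT (poisson_prod S b x).
  exact: (measurableT_comp (measurable_poisson_pair S b) (measurable_pair1 x)).
have mg : measurable_fun setT (fun y => G y `^ p * poisson_prod S b x y).
  by apply: measurable_funM => //; exact: (measurableT_comp (measurable_powR p)).
have [iP PE] := poisson_prod_integral S x b0.
have ig : lam.-integrable setT (EFin \o (fun y => G y `^ p * poisson_prod S b x y)).
  apply/integrableP; split; first exact/measurable_EFinP.
  under eq_integral do rewrite /= ger0_norm ?mulr_ge0 ?powR_ge0//.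
  exact: le_lt_trans hx (ltry _).
have pw y : G y * poisson_prod S b x y <=
    G x * poisson_prod S b x y + G x / G x `^ p * (G y `^ p * poisson_prod S b x y).
  rewrite mulrA -mulrDl; apply: ler_wpM2r => //.
  have t0 : 0 <= G y / G x by exact: divr_ge0 (G0 y) (ltW Gx).
  have -> : G y `^ p = G x `^ p * (G y / G x) `^ p.
    by rewrite -powRM ?(ltW Gx)// mulrC divfK ?gt_eqF.
  rewrite mulrA divfK ?gt_eqF// -[X in _ <= X + _]mulr1 -mulrDr.
  by rewrite -ler_pdivrMl// mulrC lerD1_powR.
have i1 := integrableZr_EFin (G x) iP.
have i2 := integrableZr_EFin (G x / G x `^ p) ig.
have i12 := integrableD_EFin i1 i2.
have iG : lam.-integrable setT (EFin \o (fun y => G y * poisson_prod S b x y)).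
  apply: (integrable_le_norm _ _ i12); first exact: measurable_funM.
  by move=> y; rewrite ger0_norm ?mulr_ge0.
split => //.
apply: (le_trans (le_Rintegral measurableT iG i12 (fun y _ => pw y))).
rewrite (RintegralD measurableT i1 i2).
rewrite (@RintegralZl _ _ R lam setT _ (G x) measurableT iP).
rewrite (@RintegralZl _ _ R lam setT _ (G x / G x `^ p) measurableT ig) PE.
have fin := integrable_fin_num measurableT ig.
have hx' : \int[lam]_y (G y `^ p * poisson_prod S b x y) <= 2 * W ^+ n * G x `^ p.
  by rewrite -lee_fin /Rintegral fineK.
have -> : 3 * W ^+ n * G x = G x * W ^+ n + G x / G x `^ p * (2 * W ^+ n * G x `^ p).
  by field; rewrite gt_eqF.
apply: lerD.
  apply: ler_wpM2l; first exact: ltW.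
  have SI0 : 0 <= S * oneDsqrV_mass by exact: mulr_ge0 S0 oneDsqrV_mass_ge0.
  by rewrite lerXn2r// nnegrE// (le_trans SI0).
by apply: ler_wpM2l => //; exact: divr_ge0 (ltW Gx) (ltW gx).
Qed.

End PoissonKernel.

Lemma ge0_integralZl_real d (T : measurableType d) (R : realType) (m : {measure set T -> \bar R})
    (D : set T) (k : R) (f : T -> R) : measurable D -> measurable_fun D f ->
  (forall x, 0 <= f x) -> 0 <= k ->
  (\int[m]_(x in D) (k * f x)%:E = k%:E * \int[m]_(x in D) (f x)%:E)%E.
Proof.
move=> mD mf f0 k0; under eq_integral do rewrite EFinM.
by apply: ge0_integralZl => //; [exact/measurable_EFinP|move=> x _; rewrite lee_fin].
Qed.

(** * Concentration of the modulus on the dense set *)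

Section Concentration.
Variables (R : realType) (n : nat).
Local Notation tup := (n.-tuple (measurableTypeR R)).
Local Notation lam := (@tuple_lebesgue R n).
Variables (S W q : R) (b a : 'I_n -> R) (gam : R) (N : nat) (E : set tup) (u v G : tup -> R).
Hypotheses (S0 : 0 <= S)
  (HS : forall z, expmaj S 4 (fun s => (1 + z ^+ 2) * cosker (z + s)))
  (SW : S * oneDsqrV_mass R <= W) (W0 : 0 < W) (q1 : 1 <= q) (Wq : W <= q * cosker_mass R)
  (b0 : forall i, 0 < b i) (a0 : forall i, 0 < a i) (n0 : (0 < n)%N)
  (g0 : 0 < gam) (g1 : gam <= 1)
  (HN : 96 * expR 5 * q * (n%:R + \sum_(i < n) a i * b i) <= N.+1%:R)
  (mu_ : measurable_fun setT u) (mv : measurable_fun setT v) (mG : measurable_fun setT G)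
  (uG : forall y, `|u y| <= G y) (vG : forall y, `|v y| <= G y)
  (Guv : forall y, G y <= `|u y| + `|v y|)
  (iu : lam.-integrable setT (EFin \o (fun y => `|u y| * tweight y)))
  (iv : lam.-integrable setT (EFin \o (fun y => `|v y| * tweight y)))
  (aeu : {ae lam, forall z, reproduced b u z}) (aev : {ae lam, forall z, reproduced b v z})
  (mE : measurable E)
  (HE : forall x, (gam%:E * (\prod_(i < n) a i)%:E <= lam (E `&` tcbox (tnth x) a))%E).

Let G0 y : 0 <= G y. Proof. exact: le_trans (uG y). Qed.
Let V := \prod_(i < n) a i.
Let V0 : 0 < V. Proof. exact: prodr_gt0. Qed.
(* [1 / (8 L)], where [L] is the bound of [sum_lagrange0_grid] for
   [g = gam / 2]. *)
Definition conc_level : R := (gam ^+ 2 / (48 * expR 1 * n%:R)) ^+ N.+1 / 8.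
Local Notation del := conc_level.

Lemma conc_level_gt0 : 0 < del.
Proof. by rewrite divr_gt0// exprn_gt0// divr_gt0 ?exprn_gt0// !mulr_gt0 ?expR_gt0 ?ltr0n. Qed.

Let dense x : reproduced b u x -> reproduced b v x -> 0 < G x ->
  lam.-integrable setT (EFin \o (fun y => G y * poisson_prod S b x y)) ->
  \int[lam]_y (G y * poisson_prod S b x y) <= 3 * W ^+ n * G x ->
  ((gam / 2)%:E * V%:E <= lam (E `&` tcbox (tnth x) a `&` [set y | (del * G x <= G y)%R]))%E.
Proof.
move=> ru rv Gx iG GA.
exact: (dense_near_good_point S0 HS (ltW W0) q1 Wq b0 a0 n0 g0 g1 HN mu_ mv mG uG vG Guv iu iv
  iG GA aeu aev ru rv Gx mE (HE x)).
Qed.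

(** [G] exceeds [m / 2] on a set that is not null, so some [x] in it satisfies both reproducing
    formulas. There the Poisson average of [G] is at most [m * W ^+ n <= 2 * W ^+ n * G x], and the
    box at [x] supplies the large values. *)
Lemma ess_sup_concentration (m : R) : 0 < m -> {ae lam, forall y, G y <= m} ->
  ~ {ae lam, forall y, G y <= m / 2} ->
  (0 < lam (E `&` [set y | (del * (m / 2) <= G y)%R]))%E.
Proof.
move=> m0 Gm nGm.
have [x [[ru rv] Gx]] : exists x, (reproduced b u x /\ reproduced b v x) /\ m / 2 < G x.
  apply: contrapT => /forallNP H; apply: nGm.
  apply: filterS2 aeu aev => x rux rvx.
  by rewrite leNgt; apply/negP => lt; apply: (H x).
have mP : measurable_fun setT (poisson_prod S b x).
  exact: (measurableT_comp (measurable_poisson_pair S b) (measurable_pair1 x)).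
have Gx0 : 0 < G x by apply: lt_trans Gx; exact: divr_gt0.
have P0 y : 0 <= poisson_prod S b x y by exact: poisson_prod_ge0.
have [iP PE] := poisson_prod_integral S x b0.
have imP := integrableZr_EFin m iP.
have mGP : measurable_fun setT (fun y => G y * poisson_prod S b x y) by exact: measurable_funM.
have aeP : {ae lam, forall y, setT y -> ((G y * poisson_prod S b x y)%:E <= (m * poisson_prod S b x y)%:E)%E}.
  by apply: filterS Gm => y Gy _; rewrite lee_fin ler_wpM2r.
have le1 : (\int[lam]_y (G y * poisson_prod S b x y)%:E <= \int[lam]_y (m * poisson_prod S b x y)%:E)%E.
  apply: ae_ge0_le_integral => //.
  - by move=> y _; rewrite lee_fin mulr_ge0.
  - exact/measurable_EFinP.
  - by move=> y _; rewrite lee_fin mulr_ge0// ltW.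
  - by apply/measurable_EFinP; exact: measurable_funM.
have lt1 : (\int[lam]_y (m * poisson_prod S b x y)%:E < +oo)%E.
  have := integrable_fin_num measurableT imP; rewrite fin_numE => /andP[_].
  by rewrite lt_neqAle leey andbT.
have iG : lam.-integrable setT (EFin \o (fun y => G y * poisson_prod S b x y)).
  apply/integrableP; split; first exact/measurable_EFinP.
  under eq_integral do rewrite /= ger0_norm ?mulr_ge0//.
  exact: le_lt_trans le1 lt1.
have SI0 : 0 <= S * oneDsqrV_mass R by exact: mulr_ge0 S0 (oneDsqrV_mass_ge0 R).
have Wn0 : 0 <= W ^+ n by exact: exprn_ge0 (ltW W0).
have GA : \int[lam]_y (G y * poisson_prod S b x y) <= 3 * W ^+ n * G x.
  apply: (@le_trans _ _ (\int[lam]_y (m * poisson_prod S b x y))).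
    by apply: fine_le le1; exact: integrable_fin_num.
  rewrite (@RintegralZl _ _ R lam setT _ m measurableT iP) PE.
  apply: (@le_trans _ _ (m * W ^+ n)).
    apply: ler_wpM2l; first exact: ltW.
    by rewrite lerXn2r// nnegrE// (le_trans SI0).
  rewrite mulrC mulrAC -[leRHS]mulrC; apply: ler_wpM2l => //; lra.
have mB : measurable (tcbox (tnth x) a) by exact: measurable_tcbox.
have mH (r : R) : measurable [set y | r <= G y].
  by rewrite -[X in measurable X]setTI; apply: measurable_fun_le.
apply: (@lt_le_trans _ _ ((gam / 2)%:E * V%:E)%E).
  by rewrite -EFinM lte_fin mulr_gt0// divr_gt0.
apply: (le_trans (dense ru rv Gx0 iG GA)).
have m1 := measurableI _ _ (measurableI _ _ mE mB) (mH (del * G x)).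
have m2 := measurableI _ _ mE (mH (del * (m / 2))).
apply: le_measure; rewrite ?inE//.
move=> y [[Ey _] Hy]; split => //; apply: le_trans Hy.
by apply: ler_wpM2l; [exact: ltW conc_level_gt0|exact: ltW Gx].
Qed.

(* By Tonelli the points where the Poisson average of [G ^ p] exceeds
   [2 W^n G^p] carry at most half of the integral; at the others
   [dense_near_good_point] applies, and a second use of Tonelli sums over them. *)
Lemma integral_concentration (p : R) : 1 <= p -> (\int[lam]_y (G y `^ p)%:E < +oo)%E ->
  ((gam / 4 * del `^ p)%:E * \int[lam]_y (G y `^ p)%:E <= \int[lam]_(y in E) (G y `^ p)%:E)%E.
Proof.
move=> p1; set I := (\int[lam]_y _)%E => Ifin.
have p0 : 0 <= p by exact: le_trans p1.
pose g y := G y `^ p.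
have gge0 y : 0 <= g y by exact: powR_ge0.
have mg : measurable_fun setT g by exact: (measurableT_comp (measurable_powR p)).
have mg2 : measurable_fun [set: tup * tup] (fun w => g w.2).
  exact: (measurableT_comp mg measurable_snd).
have I0 : (0 <= I)%E by apply: integral_ge0 => y _; rewrite lee_fin powR_ge0.
have Wn0 : 0 < W ^+ n by exact: exprn_gt0.
have SI0 : 0 <= S * oneDsqrV_mass R by exact: mulr_ge0 S0 (oneDsqrV_mass_ge0 R).
have P0 x y : 0 <= poisson_prod S b x y by exact: poisson_prod_ge0.
pose h x := (\int[lam]_y (g y * poisson_prod S b x y)%:E)%E.
pose hf (w : tup * tup) := (g w.2 * poisson_prod S b w.1 w.2)%:E.
have mhf : measurable_fun setT hf.
  by apply/measurable_EFinP; apply: measurable_funM => //; exact: measurable_poisson_pair.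
have hf0 w : (0 <= hf w)%E by rewrite lee_fin mulr_ge0.
have mh : measurable_fun setT h by exact: (measurable_fun_fubini_tonelli_F hf mhf hf0).
have h0 x : (0 <= h x)%E by apply: integral_ge0 => y _; rewrite lee_fin mulr_ge0.
have hI : (\int[lam]_x h x <= (W ^+ n)%:E * I)%E.
  rewrite /h (@fubini_tonelli _ _ _ _ R lam lam hf mhf hf0) /hf/=.
  have E1 y : (\int[lam]_x (g y * poisson_prod S b x y)%:E = ((S * oneDsqrV_mass R) ^+ n)%:E * (g y)%:E)%E.
    rewrite ge0_integralZl_real//; first by rewrite ge0_poisson_prod_integral// muleC.
    exact: (measurableT_comp (measurable_poisson_pair S b) (measurable_pair2 y)).
  under eq_integral do rewrite E1 -EFinM.
  rewrite ge0_integralZl_real//; last exact: exprn_ge0.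
  apply: lee_wpmul2r => //; rewrite lee_fin.
  by rewrite lerXn2r// nnegrE// (le_trans SI0).
pose good := [set x | (h x <= (2 * W ^+ n * g x)%:E)%E].
have mgood : measurable good.
  rewrite /good -[X in measurable X]setTI; apply: measurable_lee => //.
  by apply/measurable_EFinP; exact: measurable_funM.
have mgE : measurable_fun setT (EFin \o g) by exact/measurable_EFinP.
have half : ((2^-1)%:E * I <= \int[lam]_(x in good) (g x)%:E)%E.
  have split : (I = \int[lam]_(x in good) (g x)%:E + \int[lam]_(x in ~` good) (g x)%:E)%E.
    rewrite /I -[in LHS](setUv good) ge0_integral_setU//.
    - exact: measurableC.
    - exact: measurable_funTS.
    - by move=> x _; rewrite lee_fin powR_ge0.
    - by rewrite disj_set2E setICr.
  have bad : (\int[lam]_(x in ~` good) (g x)%:E <= (2^-1)%:E * I)%E.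
    apply: (@le_trans _ _ (\int[lam]_(x in ~` good) (((2 * W ^+ n)^-1)%:E * h x))%E).
      apply: ge0_le_integral => //.
      - exact: measurableC.
      - by move=> x _; rewrite lee_fin.
      - exact: measurable_funTS.
      - by apply: measurable_funTS; apply: measurable_funeM.
      move=> x; rewrite /good/= => /negP; rewrite -ltNge => /ltW lt.
      apply: le_trans (lee_wpmul2l _ lt); last by rewrite lee_fin invr_ge0 mulr_ge0 ?(ltW Wn0).
      by rewrite -EFinM lee_fin mulKf// mulf_neq0// gt_eqF.
    rewrite ge0_integralZl//; last 3 first.
    - exact: measurableC.
    - exact: measurable_funTS.
    - by rewrite lee_fin invr_ge0 mulr_ge0 ?(ltW Wn0).
    apply: (@le_trans _ _ (((2 * W ^+ n)^-1)%:E * ((W ^+ n)%:E * I))%E).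
      apply: lee_wpmul2l; first by rewrite lee_fin invr_ge0 mulr_ge0 ?(ltW Wn0).
      apply: le_trans hI; apply: ge0_subset_integral => //; exact: measurableC.
    rewrite muleA -EFinM invfM -mulrA mulVf ?mulr1// gt_eqF//.
  (* Finiteness of [I] permits cancelling the half that bounds the bad points. *)
  have Ireal : I \is a fin_num by rewrite ge0_fin_numE.
  have Ihalf : (I = (2^-1)%:E * I + (2^-1)%:E * I)%E.
    by rewrite -ge0_muleDl ?lee_fin ?invr_ge0// -EFinD (_ : 2^-1 + 2^-1 = 1) ?mul1e//; lra.
  have fin2 : ((2^-1)%:E * I)%E \is a fin_num by rewrite fin_numM.
  rewrite -(leeD2rE _ _ fin2) -Ihalf {1}split; exact: leeD.
(* The mass of [G ^ p] on [E] within the box at [x]; integrated over [x] it counts each point of [E]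
   with weight [V]. *)
pose k x := (\int[lam]_y (g y * \1_E y * \1_(tcbox (tnth x) a) y)%:E)%E.
pose kf (w : tup * tup) := (g w.2 * \1_E w.2 * \1_(tcbox (tnth w.1) a) w.2)%:E.
have mkf : measurable_fun setT kf.
  apply/measurable_EFinP; apply: measurable_funM; last exact: measurable_tcbox_pair.
  apply: measurable_funM => //.
  by apply: (measurableT_comp (f := \1_E : tup -> R)) => //; exact: measurable_indic.
have kf0 w : (0 <= kf w)%E by rewrite lee_fin !mulr_ge0.
have mk : measurable_fun setT k by exact: (measurable_fun_fubini_tonelli_F kf mkf kf0).
have k0 x : (0 <= k x)%E by apply: integral_ge0 => y _; rewrite lee_fin !mulr_ge0.
have kI : (\int[lam]_x k x = V%:E * \int[lam]_(y in E) (g y)%:E)%E.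
  rewrite /k (@fubini_tonelli _ _ _ _ R lam lam kf mkf kf0) /kf/=.
  have E1 y : (\int[lam]_x (g y * \1_E y * \1_(tcbox (tnth x) a) y)%:E = V%:E * (g y * \1_E y)%:E)%E.
    under eq_integral do rewrite tcbox_indicC.
    have mB : measurable (tcbox (fun i => tnth y i - a i) a) by exact: measurable_tcbox.
    rewrite ge0_integralZl_real//; last exact: mulr_ge0.
    rewrite muleC; congr (_ * _)%E; rewrite integral_indic// setIT; exact: lam_tcbox.
  under eq_integral do rewrite E1 -EFinM.
  rewrite ge0_integralZl_real//; last 3 first.
  - by apply: measurable_funM => //; exact: measurable_indic.
  - by move=> y; exact: mulr_ge0.
  - exact: ltW.
  congr (_ * _)%E; rewrite [RHS]integral_mkcond; apply: eq_integral => y _.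
  by rewrite patchE indicE; case: ifP => _; rewrite ?mulr1 ?mulr0.
(* Density times volume times the level to the power [p]. The other factor 1/2 of [gam / 4] comes
   from [half]. *)
pose c := gam / 2 * V * del `^ p.
have c0 : 0 <= c by rewrite !mulr_ge0 ?powR_ge0 ?(ltW V0) ?(ltW g0).
have pw : {ae lam, forall x, good x -> ((c * g x)%:E <= k x)%E}.
  apply: filterS2 aeu aev => x rux rvx gx.
  have [Gx0|Gx0] := eqVneq (G x) 0.
    rewrite /g Gx0 powR0 ?mulr0//; exact: lt0r_neq0 (lt_le_trans ltr01 p1).
  have Gx : 0 < G x by rewrite lt0r Gx0 G0.
  have [iG GA] := good_point_poisson S0 SW b0 p1 mG G0 Gx gx.
  have D := dense rux rvx Gx iG GA.
  set A := E `&` _ `&` _ in D.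
  have mA : measurable A.
    apply: measurableI; first by apply: measurableI => //; exact: measurable_tcbox.
    by rewrite -[X in measurable X]setTI; apply: measurable_fun_le.
  apply: (@le_trans _ _ ((del `^ p * g x)%:E * lam A)%E).
    apply: le_trans (lee_wpmul2l _ D); last by rewrite lee_fin mulr_ge0// powR_ge0.
    by rewrite -!EFinM lee_fin /c le_eqVlt; apply/orP; left; apply/eqP; ring.
  have -> : ((del `^ p * g x)%:E * lam A = \int[lam]_y ((del `^ p * g x) * \1_A y)%:E)%E.
    rewrite ge0_integralZl_real//; last by rewrite mulr_ge0// powR_ge0.
    by rewrite integral_indic// setIT.
  apply: ge0_le_integral => //.
  - by move=> y _; rewrite lee_fin !mulr_ge0// powR_ge0.
  - by apply/measurable_EFinP; apply: measurable_funM => //; exact: measurable_indic.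
  - exact: (measurableT_comp mkf (measurable_pair1 x)).
  move=> y _; rewrite lee_fin [\1_A y]indicE; case: (boolP (y \in A)) => [|_]; last first.
    by rewrite mulr0 !mulr_ge0.
  rewrite inE => -[[Ey By] Hy]; rewrite !indicE !mem_set//= !mulr1 /g -powRM ?(ltW Gx)//; last first.
    exact: ltW conc_level_gt0.
  apply: ge0_ler_powR => //; rewrite nnegrE//.
  exact: mulr_ge0 (ltW conc_level_gt0) (ltW Gx).
have le1 : (\int[lam]_(x in good) (c * g x)%:E <= \int[lam]_(x in good) k x)%E.
  apply: ae_ge0_le_integral => //.
  - by move=> x _; rewrite lee_fin mulr_ge0.
  - by apply: measurable_funTS; apply/measurable_EFinP; exact: measurable_funM.
  - exact: measurable_funTS.
have le2 : (c%:E * ((2^-1)%:E * I) <= V%:E * \int[lam]_(y in E) (g y)%:E)%E.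
  rewrite -kI; apply: (@le_trans _ _ (\int[lam]_(x in good) k x)%E); last first.
    exact: ge0_subset_integral.
  apply: le_trans le1.
  rewrite ge0_integralZl_real//; first exact: lee_wpmul2l.
  exact: measurable_funTS.
have : (V^-1%:E * (c%:E * ((2^-1)%:E * I)) <= V^-1%:E * (V%:E * \int[lam]_(y in E) (g y)%:E))%E.
  by apply: lee_wpmul2l => //; rewrite lee_fin invr_ge0 ltW.
rewrite !muleA -!EFinM mulVf ?gt_eqF// mul1e.
rewrite (_ : V^-1 * c / 2 = gam / 4 * del `^ p)//.
by rewrite /c; field; rewrite gt_eqF.
Qed.

End Concentration.

(** * Borel models and transport between tuples and rows *)

Section CaratheodoryHull.
Context d (T : measurableType d) (R : realType) (m : {measure set T -> \bar R}).
Local Open Scope ereal_scope.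

(** Measurable covers of excess at most [1 / k.+1] intersect in a set of the same outer measure; for
    infinite outer measure the whole space serves. *)
Lemma outer_measure_hull (X : set T) :
  exists F, [/\ measurable F, X `<=` F & m F = (m^*)%mu X].
Proof.
have [Xoo|] := eqVneq ((m^*)%mu X) +oo.
  exists setT; split => //; apply/eqP; rewrite eq_le Xoo leey/= -Xoo.
  by rewrite -(measurable_mu_extE m)//; exact: le_mu_ext.
rewrite -ltey => Xfin.
have Xf : (m^*)%mu X \is a fin_num by rewrite ge0_fin_numE// mu_ext_ge0.
have inv0 k : (0 < k.+1%:R^-1 :> R)%R by rewrite invr_gt0.
have cov k : exists F, [/\ measurable F, X `<=` F & m F <= (m^*)%mu X + (k.+1%:R^-1)%:E].
  have [_ [A [mA XA] <-] lt] := lb_ereal_inf_adherent (inv0 k) Xf.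
  have mU : measurable (\bigcup_i A i) by exact: bigcupT_measurable.
  exists (\bigcup_i A i); split => //; apply: le_trans (ltW lt).
  exact: measure_sigma_subadditive.
have {cov}/choice[F HF] := cov.
have mF : measurable (\bigcap_k F k) by apply: bigcapT_measurable => k; have [] := HF k.
have XF : X `<=` \bigcap_k F k by move=> x Xx k _; have [_ + _] := HF k; apply.
exists (\bigcap_k F k); split => //; apply/eqP; rewrite eq_le; apply/andP; split.
  apply/lee_addgt0Pr => /= _/posnumP[e]; near \oo => k.
  have [mFk _ le] := HF k.
  apply: (@le_trans _ _ (m (F k))).
    by apply: le_measure; rewrite ?inE//; exact: bigcap_inf.
  apply: (le_trans le); rewrite leeD// lee_fin ltW//.
  by near: k; exact: near_infty_natSinv_lt.
by rewrite -(measurable_mu_extE m mF); exact: le_mu_ext.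
Unshelve. all: by end_near. Qed.

(** On a piece of finite measure take a hull [F] of [A] and a hull [N] of the difference. [N] is
    null because the outer measure is additive on Caratheodory measurable sets and finite on [F].
    Countably many pieces are then united. *)
Lemma caratheodory_hull (A : set T) : sigma_finite setT m -> (m^*)%mu.-cara.-measurable A ->
  exists B N, [/\ measurable B, measurable N, m N = 0 & forall x, ~ N x -> (A x <-> B x)].
Proof.
move=> [S SU mS] mA.
have H i : exists BN : set T * set T, [/\ measurable BN.1, measurable BN.2, m BN.2 = 0 &
    forall x, ~ BN.2 x -> ((A `&` S i) x <-> BN.1 x)].
  have [mSi Si] := mS i.
  pose M : {measure set (caratheodory_type (m^*)%mu) -> \bar R} := @completed_measure_extension _ _ _ m.
  have mASi : (m^*)%mu.-cara.-measurable (A `&` S i).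
    by apply: measurableI => //; exact: caratheodory_measurable_mu_ext.
  have [F [mF AF FA]] := outer_measure_hull (A `&` S i).
  have cF : (m^*)%mu.-cara.-measurable F by exact: caratheodory_measurable_mu_ext.
  have MF : M F = m F by exact: measurable_mu_extE.
  have Ffin : M F < +oo.
    rewrite MF FA (le_lt_trans _ Si)// -(measurable_mu_extE m mSi).
    by apply: le_mu_ext; exact: subIsetr.
  have [N [mN FN N0]] := outer_measure_hull (F `\` (A `&` S i)).
  exists (F, N); split => //=.
    have MD : M (F `\` (A `&` S i)) = M F - M (F `&` (A `&` S i)) by exact: measureD.
    rewrite N0 -[LHS]/(M (F `\` (A `&` S i))) MD.
    rewrite setIidr// MF -[M _]FA subee// ge0_fin_numE//.
    by rewrite -[X in X < _]MF.
  move=> x nNx; split => [/AF//|Fx]; apply: contrapT => nA.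
  by apply: nNx; apply: FN.
have {H}/choice[BN HBN] := H.
exists (\bigcup_i (BN i).1), (\bigcup_i (BN i).2); split.
- by apply: bigcupT_measurable => i; have [] := HBN i.
- by apply: bigcupT_measurable => i; have [] := HBN i.
- apply: measure_negligible; first by apply: bigcupT_measurable => i; have [] := HBN i.
  by apply: negligible_bigcup => i; have [_ mN N0 _] := HBN i; exact/negligibleP.
move=> x nx; have nxi i : ~ (BN i).2 x by move=> h; apply: nx; exists i.
split=> [Ax|[i _ Bx]]; last by have [_ _ _ h] := HBN i; have /h[_ /(_ Bx)[]] := nxi i.
have [i _ Six] : (\bigcup_i S i) x by rewrite -SU.
by exists i => //; have [_ _ _ h] := HBN i; apply/(h _ (nxi i)).
Qed.

(* [N'] rather than [N]: several functions can be made Borel off a common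
   null set. *)
Lemma caratheodory_measurable_fun (f : T -> R) : sigma_finite setT m ->
  measurable_fun [set: caratheodory_type (m^*)%mu] f ->
  exists N, [/\ measurable N, m N = 0 & forall N', measurable N' -> N `<=` N' ->
    measurable_fun setT (f \_ (~` N'))].
Proof.
move=> sf mf.
(* All rationals are enumerated; a number that codes none gives the default 0. *)
pose q k : R := ratr (odflt 0%R (unpickle k : option rat)).
have H k : exists BN : set T * set T, [/\ measurable BN.1, measurable BN.2, m BN.2 = 0 &
    forall x, ~ BN.2 x -> ((q k < f x)%R <-> BN.1 x)].
  have mA : (m^*)%mu.-cara.-measurable [set x | (q k < f x)%R].
    have := mf measurableT `]q k, +oo[%classic (measurable_itv _); rewrite setTI.
    by congr measurable; apply/seteqP; split => x /=; rewrite in_itv/= andbT.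
  by have [B [N HBN]] := caratheodory_hull sf mA; exists (B, N).
have {H}/choice[BN HBN] := H.
exists (\bigcup_k (BN k).2); split.
- by apply: bigcupT_measurable => k; have [] := HBN k.
- apply: measure_negligible; first by apply: bigcupT_measurable => i; have [] := HBN i.
  by apply: negligible_bigcup => i; have [_ mN N0 _] := HBN i; exact/negligibleP.
move=> N' mN' NN'.
apply: (measurability _ (@RGenOInfty.measurableE R)) => _ [_ [r ->] <-]; rewrite setTI.
(* The restricted function is 0 on [N'], which therefore belongs to the superlevel set exactly when
   [r < 0]. *)
rewrite (_ : _ @^-1` _ = (~` N' `&` \bigcup_(k in [set k | (r < q k)%R]) (BN k).1) `|`
    (if (r < 0)%R then N' else set0)); last first.
  apply/seteqP; split => x; rewrite /= in_itv/= andbT patchE.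
    case: (boolP (x \in _)) => [|/negP]; rewrite inE => nx.
      move=> rf; left; split => //.
      have [c /= rcf] := rat_in_itvoo rf.
      have qc : q (pickle c) = ratr c by rewrite /q pickleK.
      exists (pickle c) => /=; first by rewrite qc; move: rcf; rewrite in_itv/= => /andP[].
      have [_ _ _ h] := HBN (pickle c); apply/h.
        by move=> Nx; apply: nx; apply: NN'; exists (pickle c).
      by rewrite qc; move: rcf; rewrite in_itv/= => /andP[].
    by move=> r0; right; rewrite r0; exact: contrapT.
  case=> [[nx [k /= rk Bx]]|].
    rewrite mem_set//; apply: (lt_trans rk); have [_ _ _ h] := HBN k; apply/h => //.
    by move=> Nx; apply: nx; apply: NN'; exists k.
  case: ifP => // r0 Nx; rewrite memNset//=; exact.
apply: measurableU; last by case: ifP.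
apply: measurableI; first exact: measurableC.
by apply: bigcup_measurable => k _; have [] := HBN k.
Qed.

End CaratheodoryHull.

Section RowTransport.
Variables (R : realType) (n : nat).
Local Notation tup := (n.-tuple (measurableTypeR R)).
Local Notation lam := (@tuple_lebesgue R n).
Local Notation leb := (@lebesgue_measure_rV R n).

Lemma tuple_of_rVK : cancel (@tuple_of_rV R n) (@rV_of_tuple R n).
Proof. by move=> x; apply/rowP => k; rewrite mxE tnth_mktuple. Qed.

Lemma measurable_tuple_of_rV_borel : measurable_fun [set: rV_borel R n] (@tuple_of_rV R n).
Proof. by move=> _ A mA; rewrite setTI; exists A => //; rewrite setTI. Qed.

Lemma borel_sub_lebesgue_rV (A : set (rV_borel R n)) :
  measurable A -> measurable (A : set (lebesgue_rV R n)).
Proof. exact: caratheodory_measurable_mu_ext. Qed.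

Lemma measurable_tuple_of_rV : measurable_fun [set: lebesgue_rV R n] (@tuple_of_rV R n).
Proof.
move=> _ A mA; rewrite setTI; apply: borel_sub_lebesgue_rV.
by rewrite -[X in measurable X]setTI; exact: measurable_tuple_of_rV_borel.
Qed.

Lemma lebesgue_measure_rV_borel (A : set (rV_borel R n)) : measurable A ->
  leb A = lam (@rV_of_tuple R n @^-1` A).
Proof. by move=> mA; rewrite -[LHS]/((borel_lebesgue^*)%mu A) measurable_mu_extE. Qed.

Lemma lebesgue_measure_rV_preimage (A : set tup) : measurable A ->
  leb (@tuple_of_rV R n @^-1` A) = lam A.
Proof.
move=> mA; rewrite lebesgue_measure_rV_borel; last first.
  by rewrite -[X in measurable X]setTI; exact: measurable_tuple_of_rV_borel.
by congr (lam _); apply/seteqP; split => t /=; rewrite /preimage/= rV_of_tupleK.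
Qed.

Lemma ge0_integral_rV (g : tup -> \bar R) : measurable_fun setT g -> (forall t, 0 <= g t)%E ->
  (\int[leb]_x g (tuple_of_rV x) = \int[lam]_t g t)%E.
Proof.
move=> mg g0; transitivity (\int[pushforward leb (@tuple_of_rV R n)]_t g t)%E.
  by apply/esym/(ge0_integral_pushforward measurable_tuple_of_rV).
apply: eq_measure_integral => [|? A mA _]; first exact: measurable_tuple_of_rV.
exact: lebesgue_measure_rV_preimage.
Qed.

Lemma Rintegral_rV (g : tup -> R) : lam.-integrable setT (EFin \o g) ->
  \int[leb]_x g (tuple_of_rV x) = \int[lam]_t g t.
Proof.
move=> ig; have mg := measurable_int _ ig.
have Hp : (\int[leb]_x ((EFin \o g)^\+ (tuple_of_rV x)) = \int[lam]_t (EFin \o g)^\+ t)%E.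
  by apply: ge0_integral_rV => [|t]; [exact: measurable_funepos|exact: funepos_ge0].
have Hn : (\int[leb]_x ((EFin \o g)^\- (tuple_of_rV x)) = \int[lam]_t (EFin \o g)^\- t)%E.
  by apply: ge0_integral_rV => [|t]; [exact: measurable_funeneg|exact: funeneg_ge0].
rewrite /Rintegral [in LHS]integralE [in RHS]integralE; congr (fine (_ - _)%E).
  rewrite -[RHS]Hp; apply: eq_integral => x _; by rewrite !funeposE.
rewrite -[RHS]Hn; apply: eq_integral => x _; by rewrite !funenegE.
Qed.

Lemma borel_lebesgue_sigma_finite : sigma_finite setT (@borel_lebesgue R n).
Proof.
have [S SU mS] := sigma_finiteT lam.
exists (fun k => @tuple_of_rV R n @^-1` S k).
  by rewrite -preimage_bigcup -SU preimage_setT.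
move=> k; have [mSk Sk] := mS k; split.
  by rewrite -[X in measurable X]setTI; exact: measurable_tuple_of_rV_borel.
rewrite /borel_lebesgue/= /pushforward.
rewrite (_ : _ @^-1` _ = S k)//; apply/seteqP; split => t /=; by rewrite /preimage/= rV_of_tupleK.
Qed.

End RowTransport.

(** * Tensor test functions and the spectral hypothesis *)

Section ComplexIntegral.
Context d (T : measurableType d) (R : realType) (m : {measure set T -> \bar R}).
Local Open Scope complex_scope.
Implicit Types (f g : T -> R[i]) (z : R[i]).

Definition cint f : R[i] :=
  (\int[m]_x complex.Re (f x)) +i* (\int[m]_x complex.Im (f x)).

Definition cintegrable f :=
  m.-integrable setT (EFin \o (fun x => complex.Re (f x))) /\
  m.-integrable setT (EFin \o (fun x => complex.Im (f x))).

Lemma ReM z1 z2 : complex.Re (z1 * z2 : R[i]) =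
  complex.Re z1 * complex.Re z2 - complex.Im z1 * complex.Im z2.
Proof. by case: z1 => ? ?; case: z2. Qed.

Lemma ImM z1 z2 : complex.Im (z1 * z2 : R[i]) =
  complex.Re z1 * complex.Im z2 + complex.Im z1 * complex.Re z2.
Proof. by case: z1 => ? ?; case: z2. Qed.

Lemma ReD z1 z2 : complex.Re (z1 + z2 : R[i]) = complex.Re z1 + complex.Re z2.
Proof. by case: z1 => ? ?; case: z2. Qed.

Lemma ImD z1 z2 : complex.Im (z1 + z2 : R[i]) = complex.Im z1 + complex.Im z2.
Proof. by case: z1 => ? ?; case: z2. Qed.

Lemma complexRI z1 z2 : complex.Re z1 = complex.Re z2 -> complex.Im z1 = complex.Im z2 ->
  z1 = z2 :> R[i].
Proof. by case: z1 => ? ?; case: z2 => ? ? /= -> ->. Qed.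

Lemma cintegrableD f g : cintegrable f -> cintegrable g -> cintegrable (fun x => f x + g x).
Proof.
move=> [f1 f2] [g1 g2]; split.
  by under eq_fun do rewrite ReD; exact: integrableD_EFin.
by under eq_fun do rewrite ImD; exact: integrableD_EFin.
Qed.

Lemma cintD f g : cintegrable f -> cintegrable g ->
  cint (fun x => f x + g x) = cint f + cint g.
Proof.
move=> [f1 f2] [g1 g2]; apply: complexRI; rewrite ?ReD ?ImD /=.
  by under eq_Rintegral do rewrite ReD; rewrite (RintegralD measurableT f1 g1).
by under eq_Rintegral do rewrite ImD; rewrite (RintegralD measurableT f2 g2).
Qed.

Lemma cintegrableZ z f : cintegrable f -> cintegrable (fun x => z * f x).
Proof.
move=> [f1 f2]; split.
  under eq_fun do rewrite ReM; apply: integrableB_EFin; exact: integrableZr_EFin.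
under eq_fun do rewrite ImM; apply: integrableD_EFin; exact: integrableZr_EFin.
Qed.

Lemma cintZ z f : cintegrable f -> cint (fun x => z * f x) = z * cint f.
Proof.
move=> [f1 f2]; have i11 := integrableZr_EFin (complex.Re z) f1.
have i12 := integrableZr_EFin (complex.Re z) f2.
have i21 := integrableZr_EFin (complex.Im z) f1.
have i22 := integrableZr_EFin (complex.Im z) f2.
apply: complexRI; rewrite ?ReM ?ImM /=.
  under eq_Rintegral do rewrite ReM; rewrite (RintegralB measurableT i11 i22).
  by congr (_ - _); [exact: (@RintegralZl _ _ R m setT _ (complex.Re z) measurableT f1)|exact: (@RintegralZl _ _ R m setT _ (complex.Im z) measurableT f2)].
under eq_Rintegral do rewrite ImM; rewrite (RintegralD measurableT i12 i21).
by congr (_ + _); [exact: (@RintegralZl _ _ R m setT _ (complex.Re z) measurableT f2)|exact: (@RintegralZl _ _ R m setT _ (complex.Im z) measurableT f1)].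
Qed.

Lemma cintegrable_sum (I : Type) (s : seq I) (F : I -> T -> R[i]) :
  (forall i, cintegrable (F i)) -> cintegrable (fun x => \sum_(i <- s) F i x).
Proof.
move=> iF; elim: s => [|i s IH].
  by under eq_fun do rewrite big_nil; split; exact: integrable0.
by under eq_fun do rewrite big_cons; exact: cintegrableD.
Qed.

Lemma cint_sum (I : Type) (s : seq I) (F : I -> T -> R[i]) :
  (forall i, cintegrable (F i)) -> cint (fun x => \sum_(i <- s) F i x) = \sum_(i <- s) cint (F i).
Proof.
move=> iF; elim: s => [|i s IH].
  under eq_fun do rewrite big_nil; rewrite big_nil; apply: complexRI => /=;
  by rewrite /Rintegral integral0.
under eq_fun do rewrite big_cons.
by rewrite (cintD (iF i) (cintegrable_sum s iF)) IH big_cons.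
Qed.

Lemma normc_Re_le z : `|complex.Re z| <= Normc.normc z.
Proof.
case: z => x y /=; rewrite -sqrtr_sqr; apply: ler_wsqrtr.
by rewrite lerDl sqr_ge0.
Qed.

Lemma normc_Im_le z : `|complex.Im z| <= Normc.normc z.
Proof.
case: z => x y /=; rewrite -sqrtr_sqr; apply: ler_wsqrtr.
by rewrite lerDr sqr_ge0.
Qed.

Lemma normc_le z : Normc.normc z <= `|complex.Re z| + `|complex.Im z|.
Proof.
case: z => x y /=; have h0 : 0 <= `|x| + `|y| by rewrite addr_ge0.
rewrite -(ger0_norm h0) -sqrtr_sqr; apply: ler_wsqrtr.
rewrite sqrrD !real_normK ?num_real// -addrA lerD2l lerDr mulrn_wge0// mulr_ge0//.
Qed.

Lemma normc_ge0R z : 0 <= Normc.normc z.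
Proof. by case: z => x y; exact: sqrtr_ge0. Qed.

Lemma normc_prod (I : Type) (s : seq I) (F : I -> R[i]) :
  Normc.normc (\prod_(i <- s) F i) = \prod_(i <- s) Normc.normc (F i).
Proof.
elim: s => [|i s IH]; first by rewrite !big_nil Normc.normc1.
by rewrite !big_cons Normc.normcM IH.
Qed.

Lemma cintegrable_le f (g : T -> R) :
  measurable_fun setT (fun x => complex.Re (f x)) ->
  measurable_fun setT (fun x => complex.Im (f x)) ->
  (forall x, Normc.normc (f x) <= g x) -> m.-integrable setT (EFin \o g) -> cintegrable f.
Proof.
move=> m1 m2 fg ig; split; apply: (integrable_le_norm _ _ ig) => // x; apply: le_trans (fg x).
  exact: normc_Re_le.
exact: normc_Im_le.
Qed.

End ComplexIntegral.

Section ComplexTensor.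
Variable R : realType.
Local Open Scope complex_scope.
Local Notation mu := (@lebesgue_measure R).
Local Notation tup n := (n.-tuple (measurableTypeR R)).
Local Notation lam n := (@tuple_lebesgue R n).

Lemma ctuple_tensor_integral n (u : R -> R[i]) (v : tup n -> R[i]) :
  cintegrable mu u -> cintegrable (lam n) v ->
  cintegrable (lam n.+1) (fun x => u (thead x) * v (tpred x)) /\
  cint (lam n.+1) (fun x => u (thead x) * v (tpred x)) = cint mu u * cint (lam n) v.
Proof.
move=> [u1 u2] [v1 v2].
have [a1 a2] := tuple_tensor_integral u1 v1.
have [b1 b2] := tuple_tensor_integral u1 v2.
have [c1 c2] := tuple_tensor_integral u2 v1.
have [d1 d2] := tuple_tensor_integral u2 v2.
split; first split.
- by under eq_fun do rewrite ReM; exact: integrableB_EFin.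
- by under eq_fun do rewrite ImM; exact: integrableD_EFin.
apply: complexRI; rewrite ?ReM ?ImM /=.
  under eq_Rintegral do rewrite ReM; rewrite (RintegralB measurableT a1 d1).
  by congr (_ - _).
under eq_Rintegral do rewrite ImM; rewrite (RintegralD measurableT b1 c1).
by congr (_ + _).
Qed.

Lemma ctensor_integral n (F : 'I_n -> R -> R[i]) : (forall i, cintegrable mu (F i)) ->
  cintegrable (lam n) (fun x => \prod_(i < n) F i (tnth x i)) /\
  cint (lam n) (fun x => \prod_(i < n) F i (tnth x i)) = \prod_(i < n) cint mu (F i).
Proof.
elim: n F => [|n IH] F iF.
  under eq_fun do rewrite big_ord0; rewrite big_ord0.
  have [i1 I1] := tensor_integral (fun i : 'I_0 => (iF i).1).
  move: i1 I1; rewrite big_ord0; under eq_fun do rewrite big_ord0.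
  move=> i1 I1; split; first split => //.
    exact: integrable0.
  by apply: complexRI => //=; rewrite /Rintegral integral0.
have [i1 i2] := IH (fun i => F (lift ord0 i)) (fun i => iF _).
have [i3 i4] := ctuple_tensor_integral (iF ord0) i1.
have E : (fun x : tup n.+1 => \prod_(i < n.+1) F i (tnth x i)) =
    (fun x => F ord0 (thead x) * \prod_(i < n) F (lift ord0 i) (tnth (tpred x) i)).
  apply/funext => x; rewrite big_ord_recl; congr (_ * _).
  by apply: eq_bigr => i _; rewrite -{1}(tuple_consE x) tnth_tuple_consS.
by rewrite E; split => //; rewrite i4 i2 big_ord_recl.
Qed.

Lemma expiD (s t : R) : expi (s + t) = expi s * expi t.
Proof. by apply: complexRI; rewrite ?ReM ?ImM /= ?cosD ?sinD// addrC. Qed.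

Lemma expi0 : expi (0 : R) = 1.
Proof. by apply: complexRI; rewrite /= ?cos0 ?sin0. Qed.

Lemma expi_sum n (t : 'I_n -> R) : expi (\sum_(i < n) t i) = \prod_(i < n) expi (t i).
Proof. exact: (big_morph _ expiD expi0). Qed.

Lemma normc_expi (t : R) : Normc.normc (expi t) = 1.
Proof. by rewrite /expi/= cos2Dsin2 sqrtr1. Qed.

Definition ctest A (h : R -> R[i]) :=
  [/\ smooth (fun t => complex.Re (h t)), smooth (fun t => complex.Im (h t)) &
      forall t, A <= `|t| -> h t = 0].

Definition ft (h : R -> R[i]) (y : R) : R[i] := cint mu (fun t => h t * expi (- (t * y))).

Lemma ctestM A h k : ctest A h -> smooth (fun t => complex.Re (k t)) ->
  smooth (fun t => complex.Im (k t)) -> ctest A (fun t => h t * k t).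
Proof.
move=> [s1 s2 hA] k1 k2; split.
- under eq_fun do rewrite ReM; apply: smoothB; exact: smoothM.
- under eq_fun do rewrite ImM; apply: smoothD; exact: smoothM.
- by move=> t /hA ->; rewrite mul0r.
Qed.

Lemma smooth_expi (y : R) : smooth (fun t => complex.Re (expi (- (t * y)))) /\
  smooth (fun t => complex.Im (expi (- (t * y)))).
Proof.
have [sc ss] := smooth_cos_sin R; rewrite /expi/=.
have E (f : R -> R) : (fun t => f (- (t * y))) = (fun t => f (- y * t + 0)).
  by apply/funext => t; rewrite addr0 mulNr mulrC.
by split; [rewrite (E cos)|rewrite (E sin)]; exact: smooth_comp_affine.
Qed.

Lemma ctest_integrable A h : ctest A h -> cintegrable mu h.
Proof.
move=> [s1 s2 hA]; split; apply: (csupp_integrable (A := A)).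
- exact: smooth_continuous.
- by move=> t /hA ->.
- exact: smooth_continuous.
- by move=> t /hA ->.
Qed.

Lemma ft_integrable A h y : ctest A h -> cintegrable mu (fun t => h t * expi (- (t * y))).
Proof. by move=> hA; have [e1 e2] := smooth_expi y; exact: ctest_integrable (ctestM hA e1 e2). Qed.

(** Measurability in [y] comes from Fubini, which requires integrability in [y] too: [F] carries the
    weight [1 / (1 + y ^+ 2)], removed at the end. The phase [b] covers sine transforms. *)
Lemma cos_transform_decay (u : R -> R) A b : 0 <= A -> smooth u ->
  (forall t, A <= `|t| -> u t = 0) ->
  measurable_fun [set: measurableTypeR R] (fun y => \int[mu]_t (u t * cos (y * t + b))) /\
  exists C, 0 <= C /\ forall y, `|\int[mu]_t (u t * cos (y * t + b))| <= C * (1 + y ^+ 2)^-1.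
Proof.
move=> A0 su uA; have iu := csupp_integrable (smooth_continuous su) uA.
have [B uB] := smooth_C2_bounded su uA.
have B0 : 0 <= B by case: uB => _ _ h _ _; exact: le_trans (h 0).
split; last first.
  exists (4 * (A + 2) * B); split; first by rewrite !mulr_ge0// addr_ge0.
  by move=> y; exact: cos_int_decay.
pose F (w : measurableTypeR R * measurableTypeR R) :=
  (1 + w.1 ^+ 2)^-1 * (u w.2 * cos (w.1 * w.2 + b)).
have mV : measurable_fun [set: measurableTypeR R] (fun z : measurableTypeR R => (1 + z ^+ 2)^-1 : R).
  by apply/measurable_EFinP; exact: measurable_int (integrable_oneDsqrV R).
have mF : measurable_fun setT F.
  apply: measurable_funM; first exact: (measurableT_comp mV measurable_fst).
  apply: measurable_funM.
    apply: (measurableT_comp (f := u : measurableTypeR R -> R)); last exact: measurable_snd.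
    by apply: continuous_measurable; exact: smooth_continuous.
  apply: (measurableT_comp (f := (@cos R) : measurableTypeR R -> R)).
    by apply: continuous_measurable; exact: continuous_cos.
  apply: measurable_funD => //; apply: measurable_funM.
    exact: measurable_fst.
  exact: measurable_snd.
have FF x y : `|F (x, y)| <= (1 + x ^+ 2)^-1 * `|u y|.
  rewrite /F/= normrM ger0_norm ?invr_ge0 ?addr_ge0 ?sqr_ge0// ler_wpM2l ?invr_ge0 ?addr_ge0 ?sqr_ge0//.
  by rewrite normrM ler_piMr// cos_max.
have mG := measurable_fubini_F (integrable_prod_dominated mF FF (integrable_oneDsqrV R) (integrable_norm iu)).
have E : (fun y : measurableTypeR R => \int[mu]_t (u t * cos (y * t + b))) =
    (fun y => (1 + y ^+ 2) * fine (\int[mu]_t (F (y, t))%:E)%E).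
  apply/funext => y; have y0 : 1 + y ^+ 2 != 0 by rewrite gt_eqF// ltr_pwDl// sqr_ge0.
  rewrite -[fine _]/(\int[mu]_t F (y, t)) /F/= RintegralZl ?mulVKf//.
  have [sc _] := smooth_cos_sin R.
  apply: (csupp_integrable (A := A)).
    by apply: smooth_continuous; apply: smoothM => //; exact: smooth_comp_affine.
  by move=> t /uA ->; rewrite mul0r.
rewrite E; apply: measurable_funM.
  by apply: measurable_funD => //; apply: measurable_funM.
apply/measurable_EFinP; apply: eq_measurable_fun mG => z _; rewrite /= fineK//.
exact: (integrable_fin_num measurableT (integrable_section1 mF FF (integrable_norm iu) z)).
Qed.

Lemma ReftE A h y : ctest A h -> complex.Re (ft h y) =
  \int[mu]_t (complex.Re (h t) * cos (y * t + 0)) +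
  \int[mu]_t (complex.Im (h t) * cos (y * t + (- (pi / 2)))).
Proof.
move=> [s1 s2 hA]; have [sc ss] := smooth_cos_sin R.
rewrite /= -RintegralD//; last 2 first.
- apply: (csupp_integrable (A := A)).
    by apply: smooth_continuous; apply: smoothM => //; exact: smooth_comp_affine.
  by move=> t /hA ->; rewrite mul0r.
- apply: (csupp_integrable (A := A)).
    by apply: smooth_continuous; apply: smoothM => //; exact: smooth_comp_affine.
  by move=> t /hA ->; rewrite mul0r.
apply: eq_Rintegral => t _.
by rewrite ReM /= cosN sinN mulrN opprK addr0 (mulrC y) -cos_phase.
Qed.

Lemma ImftE A h y : ctest A h -> complex.Im (ft h y) =
  \int[mu]_t (complex.Im (h t) * cos (y * t + 0)) -
  \int[mu]_t (complex.Re (h t) * cos (y * t + (- (pi / 2)))).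
Proof.
move=> [s1 s2 hA]; have [sc ss] := smooth_cos_sin R.
rewrite /= -RintegralB//; last 2 first.
- apply: (csupp_integrable (A := A)).
    by apply: smooth_continuous; apply: smoothM => //; exact: smooth_comp_affine.
  by move=> t /hA ->; rewrite mul0r.
- apply: (csupp_integrable (A := A)).
    by apply: smooth_continuous; apply: smoothM => //; exact: smooth_comp_affine.
  by move=> t /hA ->; rewrite mul0r.
apply: eq_Rintegral => t _.
by rewrite ImM /= cosN sinN mulrN addr0 (mulrC y) -cos_phase addrC.
Qed.

Lemma ft_decay A h : ctest A h ->
  [/\ measurable_fun [set: measurableTypeR R] (fun y => complex.Re (ft h y)),
      measurable_fun [set: measurableTypeR R] (fun y => complex.Im (ft h y)) &
      exists C, 0 <= C /\ forall y, Normc.normc (ft h y) <= C * (1 + y ^+ 2)^-1].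
Proof.
wlog A0 : A / 0 <= A.
  move=> H hA; apply: (H `|A|) => //; case: hA => s1 s2 hA; split => // t At.
  by apply: hA; rewrite (le_trans _ At)// ler_norm.
move=> hA; have [s1 s2 h0] := hA.
have z1 t : A <= `|t| -> complex.Re (h t) = 0 by move=> /h0 ->.
have z2 t : A <= `|t| -> complex.Im (h t) = 0 by move=> /h0 ->.
have [m1 [C1 [C10 H1]]] := cos_transform_decay 0 A0 s1 z1.
have [m2 [C2 [C20 H2]]] := cos_transform_decay (- (pi / 2)) A0 s2 z2.
have [m3 [C3 [C30 H3]]] := cos_transform_decay 0 A0 s2 z2.
have [m4 [C4 [C40 H4]]] := cos_transform_decay (- (pi / 2)) A0 s1 z1.
split.
- by under eq_fun do rewrite (ReftE _ hA); exact: measurable_funD.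
- by under eq_fun do rewrite (ImftE _ hA); exact: measurable_funB.
exists ((C1 + C2) + (C3 + C4)); split; first by rewrite !addr_ge0.
move=> y; apply: (le_trans (normc_le _)); rewrite (ReftE _ hA) (ImftE _ hA).
rewrite [leRHS](_ : _ = (C1 * (1 + y ^+ 2)^-1 + C2 * (1 + y ^+ 2)^-1) +
  (C3 * (1 + y ^+ 2)^-1 + C4 * (1 + y ^+ 2)^-1)); last by rewrite !mulrDl.
apply: lerD; first by rewrite (le_trans (ler_normD _ _))// lerD.
by rewrite (le_trans (ler_normB _ _))// lerD.
Qed.

Lemma measurable_Re_Im_prod d (T : measurableType d) n (F : 'I_n -> T -> R[i]) :
  (forall i, measurable_fun setT (fun x => complex.Re (F i x)) /\
             measurable_fun setT (fun x => complex.Im (F i x))) ->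
  measurable_fun setT (fun x => complex.Re (\prod_(i < n) F i x)) /\
  measurable_fun setT (fun x => complex.Im (\prod_(i < n) F i x)).
Proof.
move=> mF; elim: (index_enum _) => [|i s [IH1 IH2]].
  by split; under eq_fun do rewrite big_nil; exact: measurable_cst.
have [m1 m2] := mF i; split; under eq_fun do rewrite big_cons ?ReM ?ImM.
  by apply: measurable_funB; exact: measurable_funM.
by apply: measurable_funD; exact: measurable_funM.
Qed.

End ComplexTensor.

(** * Tensor products as Schwartz test functions *)

Section SchwartzTensor.
Variables (R : realType) (n : nat).
Local Open Scope complex_scope.
Local Notation Rn := 'rV[R]_n.
Implicit Types (u v : Rn -> R).

Definition pd (k : 'I_n) u : Rn -> R := 'D_(delta_mx ord0 k) u.

(** Order 0 already includes differentiability, which [real_schwartz] requires of every iterated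
    partial derivative and the sum and product rules for [pd] use. *)
Fixpoint mdiff (m : nat) u : Prop :=
  (forall x, differentiable u x) /\
  (if m is m'.+1 then forall k, mdiff m' (pd k u) else True).

Definition msmooth u := forall m, mdiff m u.

Lemma mdiff_differentiable m u x : mdiff m u -> differentiable u x.
Proof. by case: m => [|m] []. Qed.

Lemma mdiffS m u : mdiff m.+1 u -> mdiff m u.
Proof.
elim: m u => [|m IH] u [du mu]; first by split.
by split=> // k; apply: IH.
Qed.

Lemma pdD k u v : (forall x, differentiable u x) -> (forall x, differentiable v x) ->
  pd k (u \+ v) = pd k u \+ pd k v.
Proof. by move=> du dv; apply/funext => x; rewrite /pd deriveD//; exact: diff_derivable. Qed.

Lemma pdM k u v : (forall x, differentiable u x) -> (forall x, differentiable v x) ->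
  pd k (u \* v) = (u \* pd k v) \+ (v \* pd k u).
Proof. by move=> du dv; apply/funext => x; rewrite /pd deriveM//; exact: diff_derivable. Qed.

Lemma mdiffD m u v : mdiff m u -> mdiff m v -> mdiff m (u \+ v).
Proof.
elim: m u v => [|m IH] u v um vm; (split; first by move=> x; apply: differentiableD;
  [exact: mdiff_differentiable um|exact: mdiff_differentiable vm]) => //.
move=> k; rewrite pdD; [|by move=> x; exact: mdiff_differentiable um|by move=> x; exact: mdiff_differentiable vm].
by apply: IH; [case: um => _; apply|case: vm => _; apply].
Qed.

Lemma mdiffM m u v : mdiff m u -> mdiff m v -> mdiff m (u \* v).
Proof.
elim: m u v => [|m IH] u v um vm; (split; first by move=> x; apply: differentiableM;
  [exact: mdiff_differentiable um|exact: mdiff_differentiable vm]) => //.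
move=> k; rewrite pdM; [|by move=> x; exact: mdiff_differentiable um|by move=> x; exact: mdiff_differentiable vm].
apply: mdiffD; apply: IH; rewrite ?(mdiffS um) ?(mdiffS vm)//.
- exact: mdiffS.
- by case: vm => _; apply.
- exact: mdiffS.
- by case: um => _; apply.
Qed.

Lemma msmoothD u v : msmooth u -> msmooth v -> msmooth (fun x => u x + v x).
Proof. by move=> su sv m; exact: mdiffD. Qed.

Lemma msmoothM u v : msmooth u -> msmooth v -> msmooth (fun x => u x * v x).
Proof. by move=> su sv m; exact: mdiffM. Qed.

Lemma pd_coord (g : R -> R) k j : pd j (fun x => g (x ord0 k)) =
  if j == k then (fun x => derive1 g (x ord0 k)) else (fun=> 0).
Proof.
apply/funext => x; rewrite /pd /derive; case: eqP => [->|jk].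
  rewrite /derive1.
  rewrite [X in lim (X @ _)](_ : _ = (fun h : R => h^-1 *: (g (h + x ord0 k) - g (x ord0 k))))//.
  by apply/funext => h; rewrite /= !mxE !eqxx mulr1.
rewrite (_ : (fun h : R => _) = cst 0) ?lim_cst//.
apply/funext => h; rewrite /= !mxE eqxx/= (_ : (k == j) = false) ?mulr0 ?add0r ?subrr ?scaler0//.
by apply/eqP => kj; apply: jk.
Qed.

Lemma msmooth_cst (c : R) : msmooth (fun=> c).
Proof.
move=> m; elim: m c => [|m IH] c; (split; first by move=> x; exact: differentiable_cst) => //.
move=> k; rewrite (_ : pd k _ = fun=> 0)//; apply/funext => x; exact: derive_cst.
Qed.

Lemma msmooth_coord (g : R -> R) k : smooth g -> msmooth (fun x => g (x ord0 k)).
Proof.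
move=> sg m; elim: m g sg => [|m IH] g sg; (split; first by move=> x;
  apply: (@differentiable_comp _ _ _ _ (fun x : Rn => x ord0 k : R) g);
  [exact: differentiable_coord|exact/derivable1_diffP/smooth_derivable]) => //.
move=> j; rewrite pd_coord; case: ifP => _; first by apply: IH; exact: smooth_derive1.
exact: (IH (cst 0) (smooth_cst 0)).
Qed.

Lemma mdiff_partials s m u : mdiff (m + size s) u -> mdiff m (partials s u).
Proof.
elim: s m u => [|k s IH] m u; first by rewrite addn0.
rewrite /= addnS -addSn => /IH [_]; apply.
Qed.

Lemma pd_csupp k u A : (forall x, A < `|x| -> u x = 0) -> forall x, A < `|x| -> pd k u x = 0.
Proof.
move=> uA x Ax; rewrite /pd (@near_eq_derive _ _ _ u (cst 0)) ?derive_cst//.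
have : \forall y \near x, A < `|y|.
  by have /cvgr_gt/(_ _ Ax) := @norm_continuous R Rn x.
by apply: filterS => y /uA ->.
Qed.

Lemma partials_csupp s u A : (forall x, A < `|x| -> u x = 0) ->
  forall x, A < `|x| -> partials s u x = 0.
Proof. by move=> uA; elim: s => [//|k s IH]; exact: pd_csupp. Qed.

Lemma compact_mxball (A : R) : compact [set x : Rn | `|x| <= A].
Proof.
apply: bounded_closed_compact; first by exists A; split; [exact: num_real|move=> M AM x /= /le_trans; apply; exact: ltW].
rewrite (_ : [set x | _] = (fun x : Rn => `|x|) @^-1` [set r | r <= A])//.
by apply: preimage_closed; [move=> ? _; exact: norm_continuous|exact: closed_le].
Qed.

(** Each iterated partial derivative is continuous and vanishes off a compact ball, so it is
    bounded, and the polynomial weight is bounded on that ball. *)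
Lemma msmooth_schwartz u A : msmooth u -> (forall x, A < `|x| -> u x = 0) -> real_schwartz u.
Proof.
move=> su uA; have dp s x : differentiable (partials s u) x.
  exact: mdiff_differentiable (mdiff_partials (m := 0) (su _)).
split=> // k s; have cA := @compact_mxball A.
have cs : continuous (fun x => partials s u x).
  by move=> x; exact: differentiable_continuous.
have : compact (partials s u @` [set x : Rn | `|x| <= A]).
  by apply: continuous_compact => //; exact: continuous_subspaceT.
move=> /(@compact_bounded R R^o) [M0 [_ HM]].
pose M := Num.max 1 (M0 + 1).
have M1 : 0 <= M by rewrite le_max ler01.
have bd x : `|x| <= A -> `|partials s u x| <= M.
  move=> xA; have M0M : M0 < M by rewrite lt_max ltrDl ltr01 orbT.
  by apply: (HM _ M0M); exists x.
exists ((1 + `|A|) ^+ k * M) => x.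
have [xA|xA] := leP `|x| A; last first.
  by rewrite (partials_csupp _ uA)// normr0 mulr0 mulr_ge0// exprn_ge0// addr_ge0.
apply: ler_pM => //; last exact: bd.
by rewrite lerXn2r ?nnegrE ?addr_ge0// lerD2l (le_trans xA)// ler_norm.
Qed.

Definition tensor (h : 'I_n -> R -> R[i]) (x : Rn) : R[i] := \prod_(k < n) h k (x ord0 k).

Lemma norm_le_coord (x : Rn) (A : R) : 0 <= A -> (forall k, `|x ord0 k| <= A) -> `|x| <= A.
Proof.
move=> A0 xA; rewrite [leLHS]/Num.Def.normr /= mx_normrE; apply/bigmax_leP; split => // -[i k] _ /=.
by rewrite (ord1 i).
Qed.

Lemma tensor_eq0 (h : 'I_n -> R -> R[i]) (x : Rn) k : h k (x ord0 k) = 0 -> tensor h x = 0.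
Proof. by move=> h0; rewrite /tensor (bigD1 k)//= h0 mul0r. Qed.

Lemma tensor_msmooth A h : (forall k, ctest A (h k)) ->
  msmooth (fun x => complex.Re (tensor h x)) /\ msmooth (fun x => complex.Im (tensor h x)).
Proof.
move=> hA; rewrite /tensor; elim: (index_enum _) => [|k s [IH1 IH2]].
  by split; under eq_fun do rewrite big_nil; exact: msmooth_cst.
have [s1 s2 _] := hA k; have m1 := msmooth_coord k s1; have m2 := msmooth_coord k s2.
split.
  under eq_fun do rewrite big_cons ReM.
  under eq_fun do rewrite -mulNr.
  apply: msmoothD; first exact: msmoothM.
  by apply: msmoothM => //; under eq_fun do rewrite -mulN1r; apply: msmoothM => //; exact: msmooth_cst.
under eq_fun do rewrite big_cons ImM.
by apply: msmoothD; exact: msmoothM.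
Qed.

Lemma tensor_schwartz A h : 0 <= A -> (forall k, ctest A (h k)) -> schwartz (tensor h).
Proof.
move=> A0 hA; have [s1 s2] := tensor_msmooth hA.
have z x : A < `|x| -> tensor h x = 0.
  move=> Ax; have [k Ak] : exists k, A <= `|x ord0 k|.
    apply: contrapT => /forallNP H; move: Ax; rewrite ltNge => /negP; apply.
    by apply: norm_le_coord => // k; apply/ltW; rewrite ltNge; exact/negP/H.
  by apply: (tensor_eq0 (k := k)); case: (hA k) => _ _; apply.
by split; apply: msmooth_schwartz; [exact: s1|move=> x /z ->|exact: s2|move=> x /z ->].
Qed.

Lemma tensor_fsupp (h : 'I_n -> R -> R[i]) (lo hi : 'I_n -> R) :
  (forall k t, ~ (lo k <= t <= hi k) -> h k t = 0) ->
  compact (fsupp (tensor h)) /\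
  fsupp (tensor h) `<=` [set x | forall k, lo k <= x ord0 k <= hi k].
Proof.
move=> h0; pose B := [set x : Rn | forall k, (`[lo k, hi k]%classic : set R) (x ord0 k)].
have cB : compact B.
  exact: (@rV_compact _ n (fun k => `[lo k, hi k]%classic) (fun k => @segment_compact R (lo k) (hi k))).
have fB : fsupp (tensor h) `<=` B.
  have clB : closed B by apply: compact_closed => //; exact: norm_hausdorff.
  rewrite ((closure_id B).1 clB); apply: closureS => x /= /eqP nz k.
  by rewrite /= in_itv/=; apply: contrapT => nk; apply: nz; apply: (tensor_eq0 (k := k)); exact: h0.
split; first exact: (subclosed_compact (@closed_closure _ _) cB fB).
by move=> x /fB Bx k; have := Bx k; rewrite /= in_itv.
Qed.

End SchwartzTensor.

Section TensorPairing.
Variables (R : realType) (n : nat).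
Local Open Scope complex_scope.
Local Notation mu := (@lebesgue_measure R).
Local Notation tup := (n.-tuple (measurableTypeR R)).
Local Notation lam := (@tuple_lebesgue R n).
Local Notation Rn := 'rV[R]_n.
Implicit Types (F : tup -> R[i]) (h : 'I_n -> R -> R[i]).

(** The one integrability condition behind the pairings and the reproducing formula; it treats
    finite exponents and the bounded case alike. *)
Definition tame F := [/\ measurable_fun setT (fun y => complex.Re (F y)),
  measurable_fun setT (fun y => complex.Im (F y)) &
  lam.-integrable setT (EFin \o (fun y => Normc.normc (F y) * tweight y))].

Definition ftensor h (y : tup) : R[i] := \prod_(k < n) ft (h k) (tnth y k).

Definition tpair F h : R[i] := cint lam (fun y => F y * ftensor h y).

Lemma measurable_ftensor A h : (forall k, ctest A (h k)) ->
  measurable_fun setT (fun y => complex.Re (ftensor h y)) /\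
  measurable_fun setT (fun y => complex.Im (ftensor h y)).
Proof.
move=> hA; apply: (measurable_Re_Im_prod (F := fun k (y : tup) => ft (h k) (tnth y k))) => k.
have [m1 m2 _] := ft_decay (hA k).
by split; [exact: (measurableT_comp m1 (measurable_tnth k))|exact: (measurableT_comp m2 (measurable_tnth k))].
Qed.

Lemma ftensor_bound A h : (forall k, ctest A (h k)) -> exists C, 0 <= C /\
  forall y, Normc.normc (ftensor h y) <= C * tweight y.
Proof.
move=> hA; have /choice[C HC] : forall k, exists C, 0 <= C /\
    forall y, Normc.normc (ft (h k) y) <= C * (1 + y ^+ 2)^-1.
  by move=> k; have [_ _] := ft_decay (hA k).
exists (\prod_(k < n) C k); split; first by apply: prodr_ge0 => k _; case: (HC k).
move=> y; rewrite /ftensor normc_prod /tweight -big_split; apply: ler_prod => k _.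
by apply/andP; split; [exact: normc_ge0R|have [_] := HC k; apply].
Qed.

Lemma tpair_integrable A F h : tame F -> (forall k, ctest A (h k)) ->
  cintegrable lam (fun y => F y * ftensor h y).
Proof.
move=> [m1 m2 iF] hA; have [p1 p2] := measurable_ftensor hA.
have [C [C0 HC]] := ftensor_bound hA.
apply: (cintegrable_le (g := fun y => C * (Normc.normc (F y) * tweight y))).
- by under eq_fun do rewrite ReM; apply: measurable_funB; exact: measurable_funM.
- by under eq_fun do rewrite ImM; apply: measurable_funD; exact: measurable_funM.
- by move=> y; rewrite Normc.normcM mulrCA ler_wpM2l// normc_ge0R.
- exact: (integrableZr_EFin C iF).
Qed.

Definition upd h (k : 'I_n) (g : R -> R[i]) : 'I_n -> R -> R[i] :=
  fun i => if i == k then g else h i.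

Lemma upd_eq h k g : upd h k g k = g. Proof. by rewrite /upd eqxx. Qed.

Lemma upd_neq h k g i : i != k -> upd h k g i = h i.
Proof. by rewrite /upd => /negbTE ->. Qed.

Lemma ftensor_upd h k g y :
  ftensor (upd h k g) y = ft g (tnth y k) * \prod_(i < n | i != k) ft (h i) (tnth y i).
Proof.
rewrite /ftensor (bigD1 k)//= upd_eq; congr (_ * _).
by apply: eq_bigr => i ik; rewrite upd_neq.
Qed.

Lemma ctest_upd A h k g : (forall k, ctest A (h k)) -> ctest A g -> forall i, ctest A (upd h k g i).
Proof. by move=> hA gA i; rewrite /upd; case: eqP. Qed.

Lemma upd_id h k : upd h k (h k) = h.
Proof. by apply/funext => i; rewrite /upd; case: eqP => [->|]. Qed.

(** Linearity in a single slot: both the partition of unity and the comparison of two cutoffs split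
    a tensor one slot at a time. *)
Lemma tpair_sum A F h k (I : Type) (s : seq I) (g : I -> R -> R[i]) : tame F ->
  (forall k, ctest A (h k)) -> (forall j, ctest A (g j)) ->
  (forall t, h k t = \sum_(j <- s) g j t) ->
  tpair F h = \sum_(j <- s) tpair F (upd h k (g j)).
Proof.
move=> tF hA gA hg; rewrite -cint_sum; last first.
  by move=> j; apply: (tpair_integrable tF (ctest_upd k hA (gA j))).
congr (cint _ _); apply/funext => y; rewrite -mulr_sumr -{1}(upd_id h k); congr (_ * _).
under eq_bigr do rewrite ftensor_upd.
rewrite ftensor_upd -mulr_suml; congr (_ * _).
rewrite /ft -cint_sum; last by move=> j; exact: ft_integrable (gA j).
by congr (cint _ _); apply/funext => t; rewrite hg mulr_suml.
Qed.

Lemma ft0 y : ft (fun=> 0 : R[i]) y = 0.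
Proof.
rewrite /ft /cint; under eq_Rintegral do rewrite mul0r.
under [X in _ +i* X]eq_Rintegral do rewrite mul0r.
by rewrite /Rintegral integral0.
Qed.

Lemma tpair_eq0 F h k : (forall t, h k t = 0) -> tpair F h = 0.
Proof.
move=> hk; rewrite /tpair (_ : (fun y => _) = fun=> 0).
  by rewrite /cint /Rintegral integral0.
apply/funext => y; rewrite -(upd_id h k) ftensor_upd (_ : h k = fun=> 0); last exact/funext.
by rewrite ft0 mul0r mulr0.
Qed.

Lemma fourier_tensor A h (xi : Rn) : (forall k, ctest A (h k)) ->
  fourier (tensor h) xi = ftensor h (tuple_of_rV xi).
Proof.
move=> hA; pose H k t := h k t * expi (- (t * xi ord0 k)).
have iH k : cintegrable mu (H k) by exact: ft_integrable (hA k).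
have [[i1 i2] E] := ctensor_integral iH.
have HE x : tensor h x * expi (- dotrV x xi) = \prod_(k < n) H k (tnth (tuple_of_rV x) k).
  rewrite /dotrV -sumrN expi_sum /tensor -big_split/=; apply: eq_bigr => k _.
  by rewrite /H tnth_mktuple.
rewrite /fourier /ftensor; transitivity (\prod_(k < n) cint mu (H k)).
  rewrite -E /cintegral /cint; congr (_ +i* _).
    by under eq_Rintegral do rewrite HE; exact: (Rintegral_rV i1).
  by under eq_Rintegral do rewrite HE; exact: (Rintegral_rV i2).
by apply: eq_bigr => k _; rewrite tnth_mktuple.
Qed.

Lemma Rintegral_rV_ae (g : Rn -> R) (G : tup -> R) :
  measurable_fun [set: lebesgue_rV R n] g -> lam.-integrable setT (EFin \o G) ->
  {ae @lebesgue_measure_rV R n, forall x, g x = G (tuple_of_rV x)} ->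
  \int[@lebesgue_measure_rV R n]_x g x = \int[lam]_y G y.
Proof.
move=> mg iG gG; rewrite -(Rintegral_rV iG) /Rintegral; congr fine; apply: ae_eq_integral.
- exact: measurableT.
- exact/measurable_EFinP.
- exact: (measurableT_comp (measurable_int _ iG) (@measurable_tuple_of_rV R n)).
- by move: gG; apply: negligibleS => x /= nx gx; apply: nx => _; rewrite gx.
Qed.

Lemma fourier_distribution_tensor A F h (f : Rn -> R[i]) : tame F -> cmeasurable f ->
  {ae @lebesgue_measure_rV R n, forall x, f x = F (tuple_of_rV x)} ->
  (forall k, ctest A (h k)) -> fourier_distribution f (tensor h) = tpair F h.
Proof.
move=> tF [mf1 mf2] fF hA; have [i1 i2] := tpair_integrable tF hA.
have [p1 p2] := measurable_ftensor hA; have [m1 m2 _] := tF.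
have mt := @measurable_tuple_of_rV R n.
have q1 := measurableT_comp p1 mt; have q2 := measurableT_comp p2 mt.
have E x : f x * fourier (tensor h) x = f x * ftensor h (tuple_of_rV x).
  by rewrite (fourier_tensor _ hA).
rewrite /fourier_distribution /cintegral /tpair /cint; congr (_ +i* _).
  rewrite -(Rintegral_rV_ae _ i1 (g := fun x => complex.Re (f x * ftensor h (tuple_of_rV x)))).
  - by apply: eq_Rintegral => x _; rewrite E.
  - by under eq_fun do rewrite ReM; apply: measurable_funB; exact: measurable_funM.
  - by move: fF; apply: negligibleS => x /= nx fx; apply: nx; rewrite fx.
rewrite -(Rintegral_rV_ae _ i2 (g := fun x => complex.Im (f x * ftensor h (tuple_of_rV x)))).
- by apply: eq_Rintegral => x _; rewrite E.
- by under eq_fun do rewrite ImM; apply: measurable_funD; exact: measurable_funM.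
- by move: fF; apply: negligibleS => x /= nx fx; apply: nx; rewrite fx.
Qed.

(** Around each point half the radius of a ball inside a member of [V] serves all nearby points;
    compactness makes one radius valid on [K]. *)
Lemma lebesgue_number (K : set Rn) (V : set (set Rn)) : compact K ->
  (forall x, K x -> exists U, [/\ V U, open U & U x]) ->
  exists r : R, 0 < r /\ forall x, K x -> exists U, [/\ V U, open U & ball x r `<=` U].
Proof.
move=> /compact_near_coveringP cK HV.
pose P (r : R) (x : Rn) := exists U, [/\ V U, open U & ball x r `<=` U].
have : \forall r \near (0 : R)^'+, K `<=` P r.
  apply: cK => x Kx; have [U [VU oU Ux]] := HV x Kx.
  have /nbhs_ballP[e /= e0 eU] : nbhs x U by exact: open_nbhs_nbhs.
  exists (ball x (e / 2), [set r | r < e / 2]) => /=.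
    by split; [exact: nbhsx_ballx (divr_gt0 e0 _)|exact: nbhs_right_lt (divr_gt0 e0 _)].
  move=> [x' r] [/= xx' re]; exists U; split => // y yr; apply: eU.
  by rewrite (splitr e); apply: ball_triangle xx' (le_ball (ltW re) yr).
move=> HK; have [r [r0 Kr]] : exists r : R, 0 < r /\ K `<=` P r.
  have H0 : \forall r \near (0 : R)^'+, 0 < r by exact: nbhs_right_gt.
  by have [r [h1 h2]] := filter_ex (filterI H0 HK); exists r.
by exists r; split.
Qed.

(** The difference of two consecutive translates of [smoothstep] at scale [dl]: such bumps telescope
    to 1, and each lives on an interval of length [2 * dl]. *)
Definition bump (dl : R) (m : R) (t : R) : R :=
  smoothstep (t / dl - m + 1) - smoothstep (t / dl - m).

Lemma smooth_bump dl m : smooth (bump dl m).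
Proof.
have H (c : R) : smooth (fun t => smoothstep (t / dl - m + c)).
  rewrite (_ : (fun t => _) = fun t => smoothstep (dl^-1 * t + (c - m))).
    exact/smooth_comp_affine/smooth_smoothstep.
  by apply/funext => t; congr smoothstep; ring.
apply: smoothB; first exact: H.
have := H 0; congr smooth; apply/funext => t; by rewrite addr0.
Qed.

Lemma bump_eq0 dl m t : 0 < dl -> ~ (dl * (m - 1) <= t <= dl * (m - 1) + 2 * dl) -> bump dl m t = 0.
Proof.
move=> d0 nt; rewrite /bump; have tE : t = dl * (t / dl) by rewrite mulrCA mulfV ?mulr1// gt_eqF.
have [h1|h1] := leP (t / dl - m) (-1); first by rewrite !smoothstep_le0 ?subrr//; lra.
have [h2|h2] := leP 1 (t / dl - m); first by rewrite !smoothstep_ge1 ?subrr//; lra.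
exfalso; apply: nt; apply/andP; split; first by rewrite [leRHS]tE ler_pM2l//; lra.
rewrite [leLHS]tE (_ : dl * (m - 1) + 2 * dl = dl * (m + 1)); last by ring.
by rewrite ler_pM2l//; lra.
Qed.

Lemma bump_sum dl (M : nat) t : 0 < dl -> `|t| <= dl * M%:R ->
  \sum_(j <- iota 0 (M + M).+1) bump dl (j%:R - M%:R) t = 1.
Proof.
move=> d0 tM; have : `|t / dl| <= M%:R by rewrite normrM normfV (gtr0_norm d0) ler_pdivrMr// mulrC.
set z := t / dl => /ler_normlP[z1 z2].
have E k : \sum_(j <- iota 0 k) bump dl (j%:R - M%:R) t =
    smoothstep (z + M%:R + 1) - smoothstep (z + M%:R + 1 - k%:R).
  elim: k => [|k IH]; first by rewrite big_nil subr0 subrr.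
  rewrite -addn1 iotaD big_cat/= big_seq1 IH add0n /bump -/z natrD.
  rewrite (_ : z - (k%:R - M%:R) + 1 = z + M%:R + 1 - k%:R); last by ring.
  rewrite (_ : z - (k%:R - M%:R) = z + M%:R + 1 - (k%:R + 1)); last by ring.
  by rewrite addrA subrK.
rewrite E smoothstep_ge1; last by lra.
by rewrite smoothstep_le0 ?subr0// -natr1 natrD; lra.
Qed.

Lemma ctest_real A (h : R -> R[i]) (g : R -> R) : ctest A h -> smooth g -> ctest A (fun t => h t * (g t)%:C).
Proof.
move=> hA sg; apply: (ctestM hA) => /=; first exact: sg.
exact: smooth_cst.
Qed.

Lemma sum_realc (I : Type) (s : seq I) (g : I -> R) :
  \sum_(j <- s) (g j)%:C = (\sum_(j <- s) g j)%:C :> R[i].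
Proof. by rewrite rmorph_sum. Qed.

Definition vanishing (f : Rn -> R[i]) : set (set Rn) :=
  [set U | open U /\ vanishes_on (fourier_distribution f) U].

(* A Lebesgue number of the cover and a partition of unity in each variable
   split the tensor into tensors supported in vanishing sets. *)
Lemma tensor_missing_support A F (f : Rn -> R[i]) h (lo hi : 'I_n -> R) : 0 <= A ->
  tame F -> cmeasurable f -> {ae @lebesgue_measure_rV R n, forall x, f x = F (tuple_of_rV x)} ->
  (forall k, ctest A (h k)) -> (forall k t, ~ (lo k <= t <= hi k) -> h k t = 0) ->
  (forall x : Rn, (forall k, lo k <= x ord0 k <= hi k) ->
     exists U, [/\ vanishing f U & U x]) ->
  tpair F h = 0.
Proof.
move=> A0 tF cf fF hA hK HU.
have cK : compact [set x : Rn | forall k, (`[lo k, hi k]%classic : set R) (x ord0 k)].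
  exact: (@rV_compact _ n (fun k => `[lo k, hi k]%classic) (fun k => @segment_compact R (lo k) (hi k))).
have [|r [r0 Hr]] := lebesgue_number cK (V := vanishing f).
  move=> x xK; have [|U [VU Ux]] := HU x; last by exists U; split => //; case: VU.
  by move=> k; have := xK k; rewrite /= in_itv.
(* Slots supported in intervals of length [2 * dl = r / 2] confine the tensor to a ball of radius
   [r] in the sup norm. *)
pose dl := r / 4; have d0 : 0 < dl by rewrite divr_gt0.
(* Induction on the list [s] of slots whose support is not yet short. *)
have gen (s : seq 'I_n) : forall h, (forall k, ctest A (h k)) ->
    (forall k t, ~ (lo k <= t <= hi k) -> h k t = 0) ->
    (forall k, k \notin s -> exists c, forall t, ~ (c <= t <= c + 2 * dl) -> h k t = 0) ->
    tpair F h = 0.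
  elim: s => [|k s IH] g gA gK gs.
    (* All supports are short here. Either some slot vanishes identically, or a point where no slot
       vanishes lies in [K] and is the centre of the ball. *)
    have [nz|] := pselect (forall k, exists t, g k t <> 0); last first.
      by move=> /existsNP[k /forallNP gk]; apply: (@tpair_eq0 F g k) => t; apply: contrapT; exact: gk.
    have /choice[x Hx] := nz; have /choice[c Hc] := fun k => gs k isT.
    have xK k : lo k <= x k <= hi k by apply: contrapT => /gK; exact: Hx.
    have xc k : c k <= x k <= c k + 2 * dl by apply: contrapT => /Hc; exact: Hx.
    pose x0 : Rn := \row_k x k.
    have [|U [[oU vU] _ ballU]] := Hr x0; first by move=> k; rewrite /= in_itv/= mxE.
    have [cs fs] := tensor_fsupp Hc.
    rewrite -(fourier_distribution_tensor tF cf fF gA); apply: vU => //.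
      exact: tensor_schwartz A0 gA.
    move=> y /fs yc; apply: ballU; rewrite -ball_normE /=.
    apply: (@le_lt_trans _ _ (2 * dl)); last by rewrite /dl; lra.
    apply: norm_le_coord => [|k]; first by rewrite mulr_ge0// ltW.
    rewrite !mxE; have := xc k; have := yc k; rewrite ler_norml; lra.
  pose M := (Num.truncn (A / dl)).+1.
  have AM : A <= dl * M%:R by rewrite mulrC -ler_pdivrMr// ltW// truncnS_gt.
  rewrite (@tpair_sum A F g k _ (iota 0 (M + M).+1)
    (fun j t => g k t * (bump dl (j%:R - M%:R) t)%:C))//.
  - rewrite big1// => j _; apply: IH.
    + by apply: ctest_upd => //; apply: ctest_real => //; exact: smooth_bump.
    + move=> i t nt; rewrite /upd; case: eqP => [ik|_]; last exact: gK.
      by rewrite gK ?mul0r// -ik.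
    + move=> i ns; rewrite /upd; case: eqP => [_|/eqP ik].
        exists (dl * (j%:R - M%:R - 1)) => t nt.
        by rewrite bump_eq0// mulr0.
      by apply: gs; rewrite inE negb_or ik.
  - by move=> j; apply: ctest_real => //; exact: smooth_bump.
  - move=> t; rewrite -mulr_sumr sum_realc.
    have [At|tA] := leP A `|t|; first by case: (gA k) => _ _ ->; rewrite // mul0r.
    by rewrite bump_sum ?mulr1// (le_trans (ltW tA)).
apply: (gen (enum 'I_n)) => // k; by rewrite mem_enum.
Qed.

End TensorPairing.

(** * Modulated cutoffs and the spectral support *)

Section SlabWaves.
Variables (R : realType).
Local Open Scope complex_scope.
Local Notation mu := (@lebesgue_measure R).

Definition wave (g : R -> R) (x t : R) : R[i] := (g t)%:C * expi (x * t).

Lemma ctest_wave A g x : smooth g -> (forall t, A <= `|t| -> g t = 0) -> ctest A (wave g x).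
Proof.
move=> sg gA; have [sc ss] := smooth_cos_sin R.
have E (f : R -> R) : (fun t => f (x * t)) = (fun t => f (x * t + 0)).
  by apply/funext => t; rewrite addr0.
split.
- under eq_fun do rewrite ReM /= mul0r subr0.
  by apply: smoothM => //; rewrite (E cos); exact: smooth_comp_affine.
- under eq_fun do rewrite ImM /= mul0r addr0.
  by apply: smoothM => //; rewrite (E sin); exact: smooth_comp_affine.
- by move=> t /gA gt; rewrite /wave gt mul0r.
Qed.

Lemma ft_waveE A g x y : smooth g -> (forall t, A <= `|t| -> g t = 0) ->
  ft (wave g x) y = (\int[mu]_t (g t * cos ((x - y) * t))) +i* (\int[mu]_t (g t * sin ((x - y) * t))).
Proof.
move=> sg gA; rewrite /ft /cint; congr (_ +i* _); apply: eq_Rintegral => t _;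
rewrite /wave -mulrA -expiD (_ : x * t - t * y = (x - y) * t) ?ReM ?ImM /= ?mul0r ?subr0 ?addr0//; ring.
Qed.

Definition slab_cutoff (c B t : R) := cutoff ((t - c) / B).

Lemma smooth_slab_cutoff c B : smooth (slab_cutoff c B).
Proof.
rewrite (_ : slab_cutoff c B = fun t => cutoff (B^-1 * t + (- c / B))).
  exact/smooth_comp_affine/smooth_cutoff.
by apply/funext => t; rewrite /slab_cutoff; congr cutoff; ring.
Qed.

Lemma slab_cutoff_eq0 c B t : 0 < B -> 2 * B <= `|t - c| -> slab_cutoff c B t = 0.
Proof. by move=> B0 h; rewrite /slab_cutoff cutoff_eq0// normrM normfV (gtr0_norm B0) ler_pdivlMr. Qed.

Lemma slab_cutoff_eq1 c B t : 0 < B -> `|t - c| <= B -> slab_cutoff c B t = 1.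
Proof. by move=> B0 h; rewrite /slab_cutoff cutoff_eq1// normrM normfV (gtr0_norm B0) ler_pdivrMr// mul1r. Qed.

Lemma slab_cutoff_csupp c B A t : 0 < B -> `|c| + 2 * B <= A -> A <= `|t| -> slab_cutoff c B t = 0.
Proof.
move=> B0 cA At; apply: slab_cutoff_eq0 => //.
have := ler_normD (t - c) c; rewrite subrK; lra.
Qed.

Lemma cutoff_sin_int (w : R) : \int[mu]_z (cutoff z * sin (w * z)) = 0.
Proof.
have [sc ss] := smooth_cos_sin R.
have iS : mu.-integrable setT (EFin \o (fun z => cutoff z * sin (w * z))).
  apply: cutoff_integrable; rewrite (_ : (fun z => _) = fun z => sin (w * z + 0)).
    by apply: smooth_continuous; exact: smooth_comp_affine.
  by apply/funext => z; rewrite addr0.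
have n1 : (-1 : R) != 0 by rewrite oppr_eq0 oner_eq0.
have := Rintegral_affine 0 n1 iS; rewrite normrN1 invr1 mul1r.
under eq_Rintegral do rewrite addr0 mulN1r cutoffN mulrN sinN mulrN -mulN1r.
rewrite (@RintegralZl _ _ R mu setT _ (-1) measurableT iS) => H; lra.
Qed.

Lemma affine_phase (B w c t : R) : B != 0 -> w * t = c * w + B * w * (B^-1 * t + - (c / B)).
Proof. by move=> B0; field. Qed.

Lemma complex_cancel (z z' : R[i]) (a b a' b' : R) : z' * z = 1 ->
  z * (a +i* b) = z * (a' +i* b') -> a = a' /\ b = b'.
Proof. by move=> z1 /(congr1 (fun w => z' * w)); rewrite !mulrA z1 !mul1r => -[-> ->]. Qed.

Lemma sum_012 (g : nat -> R[i]) : \sum_(j <- [:: 0; 1; 2]%N) g j = g 0%N + (g 1%N + g 2%N).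
Proof. by rewrite !big_cons big_nil addr0. Qed.

(** The substitution [z = (t - c) / B] leaves the phase of the centre and the transform of [cutoff],
    whose sine part vanishes by evenness. Pairing with this wave is thus, up to phases, convolution
    with the kernel, evaluated at [x]. *)
Lemma ft_slab_wave c B x y : 0 < B ->
  ft (wave (slab_cutoff c B) x) y = expi (c * (x - y)) * (dcosker B (x - y))%:C.
Proof.
move=> B0; set w := x - y.
have [sc ss] := smooth_cos_sin R.
rewrite (@ft_waveE (`|c| + 2 * B)) ?smooth_slab_cutoff//; last first.
- by move=> t; exact: slab_cutoff_csupp.
- exact: smooth_slab_cutoff.
rewrite -/w; have Bn : B^-1 != 0 by rewrite invr_eq0 gt_eqF.
have ic : mu.-integrable setT (EFin \o (fun z => cutoff z * cos (B * w * z))).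
  apply: cutoff_integrable; rewrite (_ : (fun z => _) = fun z => cos (B * w * z + 0)).
    by apply: smooth_continuous; exact: smooth_comp_affine.
  by apply/funext => z; rewrite addr0.
have iS : mu.-integrable setT (EFin \o (fun z => cutoff z * sin (B * w * z))).
  apply: cutoff_integrable; rewrite (_ : (fun z => _) = fun z => sin (B * w * z + 0)).
    by apply: smooth_continuous; exact: smooth_comp_affine.
  by apply/funext => z; rewrite addr0.
have argE t : w * t = c * w + B * w * (B^-1 * t + - (c / B)).
  by apply: affine_phase; rewrite gt_eqF.
have cutE t : slab_cutoff c B t = cutoff (B^-1 * t + - (c / B)).
  by rewrite /slab_cutoff; congr cutoff; ring.
have subst (f : R -> R) : mu.-integrable setT (EFin \o f) ->
    \int[mu]_t f (B^-1 * t + - (c / B)) = B * \int[mu]_z f z.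
  by move=> jf; rewrite (Rintegral_affine (- (c / B)) Bn jf) normfV (gtr0_norm B0) invrK.
have K : \int[mu]_z (cutoff z * cos (B * w * z)) = cosker (B * w) by [].
apply: complexRI; rewrite ?ReM ?ImM /= ?mulr0 ?subr0 ?addr0 ?add0r /dcosker.
  under eq_Rintegral do rewrite argE cutE cosD mulrBr 2![cutoff _ * (_ * _)]mulrCA.
  have j1 := integrableZr_EFin (cos (c * w)) ic; have j2 := integrableZr_EFin (sin (c * w)) iS.
  rewrite (subst (fun z => cos (c * w) * (cutoff z * cos (B * w * z)) -
    sin (c * w) * (cutoff z * sin (B * w * z))) (integrableB_EFin j1 j2)).
  rewrite (RintegralB measurableT j1 j2) (@RintegralZl _ _ R mu setT _ (cos (c * w)) measurableT ic).
  rewrite (@RintegralZl _ _ R mu setT _ (sin (c * w)) measurableT iS) cutoff_sin_int K mulr0 subr0.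
  by rewrite mulrCA.
under eq_Rintegral do rewrite argE cutE sinD mulrDr 2![cutoff _ * (_ * _)]mulrCA.
have j1 := integrableZr_EFin (sin (c * w)) ic; have j2 := integrableZr_EFin (cos (c * w)) iS.
rewrite (subst (fun z => sin (c * w) * (cutoff z * cos (B * w * z)) +
  cos (c * w) * (cutoff z * sin (B * w * z))) (integrableD_EFin j1 j2)).
rewrite (RintegralD measurableT j1 j2) (@RintegralZl _ _ R mu setT _ (sin (c * w)) measurableT ic).
rewrite (@RintegralZl _ _ R mu setT _ (cos (c * w)) measurableT iS) cutoff_sin_int K mulr0 addr0.
by rewrite mulrCA.
Qed.

End SlabWaves.

Section SpectralReproducing.
Variables (R : realType) (n : nat).
Local Open Scope complex_scope.
Local Notation tup := (n.-tuple (measurableTypeR R)).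
Local Notation lam := (@tuple_lebesgue R n).
Local Notation Rn := 'rV[R]_n.
Variables (F : tup -> R[i]) (f : Rn -> R[i]) (v b : 'I_n -> R).
Hypotheses (tF : tame F) (cf : cmeasurable f)
  (fF : {ae @lebesgue_measure_rV R n, forall x, f x = F (tuple_of_rV x)})
  (b0 : forall k, 0 < b k)
  (spec : forall x : Rn, ~ (forall k, v k <= x ord0 k <= v k + b k) ->
     exists U, [/\ vanishing f U & U x]).

Let c k := v k + b k / 2.

(* The slots are replaced one at a time: the difference of the two cutoffs in
   slot [k] lives where [|xi_k - c k| >= b k], away from the spectrum. *)
Lemma tpair_dilate (r : R) (x : 'I_n -> R) : 2 <= r ->
  tpair F (fun k => wave (slab_cutoff (c k) (r * b k)) (x k)) =
  tpair F (fun k => wave (slab_cutoff (c k) (b k)) (x k)).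
Proof.
move=> r2; have r0 : 0 < r by lra.
have rb0 k : 0 < r * b k by rewrite mulr_gt0.
have brb k : b k <= r * b k by rewrite ler_peMl ?(ltW (b0 k))//; lra.
pose A := \sum_(k < n) (`|c k| + 2 * (r * b k)).
have A1 k : `|c k| + 2 * (r * b k) <= A.
  rewrite /A (bigD1 k)//= lerDl sumr_ge0// => i _.
  by rewrite addr_ge0// mulr_ge0// ltW.
have A0 : 0 <= A by apply: sumr_ge0 => i _; rewrite addr_ge0// mulr_ge0// ltW.
have A2 k : `|c k| + 2 * b k <= A by have := A1 k; have := brb k; lra.
pose G (s : seq 'I_n) k := wave (slab_cutoff (c k) (if k \in s then b k else r * b k)) (x k).
have Gb (s : seq 'I_n) k : 0 < (if k \in s then b k else r * b k) <= r * b k.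
  by case: ifP => _; rewrite ?b0 ?rb0 ?brb ?lexx.
have GA s k : ctest A (G s k).
  apply: ctest_wave; first exact: smooth_slab_cutoff.
  move=> t; apply: slab_cutoff_csupp; first by have /andP[] := Gb s k.
  have /andP[_ h] := Gb s k; apply: le_trans (A1 k); by rewrite lerD2l ler_pM2l.
have Gs s k t : ~ (c k - 2 * (r * b k) <= t <= c k + 2 * (r * b k)) -> G s k t = 0.
  move=> nt; rewrite /G /wave slab_cutoff_eq0 ?mul0r//; first by have /andP[] := Gb s k.
  have /andP[_ h] := Gb s k; apply: (@le_trans _ _ (2 * (r * b k))); first by rewrite ler_pM2l.
  rewrite leNgt; apply/negP => lt; apply: nt; move: lt; rewrite ltr_norml; lra.
suff H s : tpair F (G s) = tpair F (G [::]).
  have E1 : (fun k => wave (slab_cutoff (c k) (r * b k)) (x k)) = G [::].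
    by apply/funext => k; rewrite /G in_nil.
  have E2 : (fun k => wave (slab_cutoff (c k) (b k)) (x k)) = G (enum 'I_n).
    by apply/funext => k; rewrite /G mem_enum.
  by rewrite E1 E2 H.
elim: s => [//|k s <-].
have [ks|ks] := boolP (k \in s).
  congr (tpair F _); apply/funext => i; rewrite /G inE.
  by case: eqP => [->|]//; rewrite ks.
pose d t := slab_cutoff (c k) (r * b k) t - slab_cutoff (c k) (b k) t.
(* Separates the two sides of the support of [d], since [tensor_missing_support] takes one interval
   per slot. *)
pose sg t := smoothstep ((t - c k) / b k).
pose p (j : nat) := match j with
  | 0 => wave (slab_cutoff (c k) (b k)) (x k)
  | 1 => wave (fun t => d t * sg t) (x k)
  | _ => wave (fun t => d t * (1 - sg t)) (x k) end.
have sd : smooth d by apply: smoothB; exact: smooth_slab_cutoff.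
have ssg : smooth sg.
  rewrite (_ : sg = fun t => smoothstep ((b k)^-1 * t + (- c k / b k))).
    exact/smooth_comp_affine/smooth_smoothstep.
  by apply/funext => t; rewrite /sg; congr smoothstep; ring.
have dA t : 2 * (r * b k) <= `|t - c k| -> d t = 0.
  move=> h; rewrite /d !slab_cutoff_eq0 ?subrr//; apply: le_trans h.
  by rewrite ler_pM2l.
have dA' t : A <= `|t| -> d t = 0.
  by move=> h; rewrite /d !(@slab_cutoff_csupp _ _ _ A) ?subrr.
have d1 t : `|t - c k| <= b k -> d t = 0.
  by move=> h; rewrite /d !slab_cutoff_eq1 ?subrr// (le_trans h).
have pA j : ctest A (p j).
  case: j => [|[|j]]; apply: ctest_wave.
  - exact: smooth_slab_cutoff.
  - by move=> t; exact: slab_cutoff_csupp.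
  - exact: smoothM.
  - by move=> t /dA' ->; rewrite mul0r.
  - by apply: smoothM => //; apply: smoothB => //; exact: smooth_cst.
  - by move=> t /dA' ->; rewrite mul0r.
have GkE t : G s k t = \sum_(j <- [:: 0; 1; 2]%N) p j t.
  rewrite sum_012 /p /wave -!mulrDl /G (negbTE ks); congr (_ * _).
  rewrite -!rmorphD; congr (_%:C); rewrite /d; ring.
have SUM : tpair F (G s) = \sum_(j <- [:: 0; 1; 2]%N) tpair F (upd (G s) k (p j)).
  exact: (@tpair_sum R n A F (G s) k nat [:: 0; 1; 2]%N p tF (GA s) pA GkE).
rewrite SUM sum_012; clear SUM.
have -> : upd (G s) k (p 0%N) = G (k :: s).
  apply/funext => i; rewrite /upd /G inE; case: eqP => [->//|_].
  by case: (i \in s).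
have bb : 0 < b k := b0 k.
have -> : tpair F (upd (G s) k (p 1%N)) = 0.
  apply: (@tensor_missing_support _ _ A F f _
    (fun i => if i == k then c i + b i else c i - 2 * (r * b i)) (fun i => c i + 2 * (r * b i))) => //.
  - by apply: ctest_upd.
  - move=> i t; rewrite /upd; case: eqP => [->|_]; last exact: Gs.
    move=> nt; rewrite /p /wave.
    have [h|h] := leP (2 * (r * b k)) `|t - c k|; first by rewrite dA// mul0r mul0r.
    have [h2|h2] := leP `|t - c k| (b k); first by rewrite d1// mul0r mul0r.
    have [h3|h3] := leP (t - c k) 0.
      by rewrite /sg smoothstep_le0 ?mulr0 ?mul0r// pmulr_lle0// invr_gt0.
    exfalso; apply: nt; move: h h2; rewrite gtr0_norm// => h h2; lra.
  (* Slot [k] forces [y k >= c k + b k], beyond the end [c k + b k / 2] of the spectral box. *)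
  - move=> y yK; apply: spec => yJ; have := yJ k; have := yK k; rewrite eqxx /c; lra.
have -> : tpair F (upd (G s) k (p 2%N)) = 0.
  apply: (@tensor_missing_support _ _ A F f _
    (fun i => c i - 2 * (r * b i)) (fun i => if i == k then c i - b i else c i + 2 * (r * b i))) => //.
  - by apply: ctest_upd.
  - move=> i t; rewrite /upd; case: eqP => [->|_]; last exact: Gs.
    move=> nt; rewrite /p /wave.
    have [h|h] := leP (2 * (r * b k)) `|t - c k|; first by rewrite dA// mul0r mul0r.
    have [h2|h2] := leP `|t - c k| (b k); first by rewrite d1// mul0r mul0r.
    have [h3|h3] := leP 0 (t - c k).
      rewrite /sg smoothstep_ge1 ?subrr ?mulr0 ?mul0r// ler_pdivlMr// mul1r ltW//.
      by move: h2; rewrite ger0_norm.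
    exfalso; apply: nt; move: h h2; rewrite ltr0_norm// => h h2; lra.
  - move=> y yK; apply: spec => yJ; have := yJ k; have := yK k; rewrite eqxx /c; lra.
by rewrite !addr0.
Qed.

(* Centres the spectrum, so that the kernels become real. *)
Definition modulated (y : tup) : R[i] := F y * expi (- \sum_(k < n) c k * tnth y k).

(** The phase in [c k * (x k - y k)] splits: the part in [x] leaves the integral, the part in [y]
    turns [F] into [modulated], and a real kernel remains. *)
Lemma tpair_slab_wave (B : 'I_n -> R) (x : tup) : (forall k, 0 < B k) ->
  tpair F (fun k => wave (slab_cutoff (c k) (B k)) (tnth x k)) =
  expi (\sum_(k < n) c k * tnth x k) *
  ((\int[lam]_y (complex.Re (modulated y) * tker B x y)) +i*
   (\int[lam]_y (complex.Im (modulated y) * tker B x y))).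
Proof.
move=> B0; set z := expi _.
pose A := \sum_(k < n) (`|c k| + 2 * B k).
have A1 k : `|c k| + 2 * B k <= A.
  rewrite /A (bigD1 k)//= lerDl sumr_ge0// => i _.
  by rewrite addr_ge0// mulr_ge0// ltW.
have hA k : ctest A (wave (slab_cutoff (c k) (B k)) (tnth x k)).
  apply: ctest_wave; first exact: smooth_slab_cutoff.
  by move=> t; exact: slab_cutoff_csupp.
have iT := tpair_integrable tF hA.
have E y : F y * ftensor (fun k => wave (slab_cutoff (c k) (B k)) (tnth x k)) y =
    z * (modulated y * (tker B x y)%:C).
  rewrite /ftensor (eq_bigr (fun k => expi (c k * tnth x k) * expi (- (c k * tnth y k)) *
    (dcosker (B k) (tnth x k - tnth y k))%:C)) => [|k _]; last first.
    by rewrite ft_slab_wave// mulrBr expiD.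
  rewrite !big_split/= -!expi_sum sumrN -rmorph_prod -/z /modulated -/(tker B x y).
  rewrite [RHS]mulrCA !mulrA; congr (_ * _); by rewrite -!mulrA [z * _]mulrC.
have z0 : z * expi (- \sum_(k < n) c k * tnth x k) = 1.
  by rewrite /z -expiD subrr expi0.
have iM : cintegrable lam (fun y => modulated y * (tker B x y)%:C).
  have := cintegrableZ (expi (- \sum_(k < n) c k * tnth x k)) iT.
  by under eq_fun do rewrite E mulrA [_ * z]mulrC z0 mul1r.
rewrite /tpair; under [X in cint _ X]eq_fun do rewrite E.
rewrite (cintZ z iM); congr (_ * _); rewrite /cint; congr (_ +i* _).
  by apply: eq_Rintegral => y _; rewrite ReM /= mulr0 subr0.
by apply: eq_Rintegral => y _; rewrite ImM /= mulr0 add0r.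
Qed.

(** The common phase in [x] is invertible and cancels; the kernels being real, real and imaginary
    parts can then be compared. *)
Lemma modulated_dilate (r : R) (x : tup) : 2 <= r ->
  \int[lam]_y (complex.Re (modulated y) * tker (fun k => r * b k) x y) =
  \int[lam]_y (complex.Re (modulated y) * tker b x y) /\
  \int[lam]_y (complex.Im (modulated y) * tker (fun k => r * b k) x y) =
  \int[lam]_y (complex.Im (modulated y) * tker b x y).
Proof.
move=> r2; have rb0 k : 0 < r * b k by rewrite mulr_gt0//; lra.
have H1 := tpair_slab_wave x rb0; have H2 := tpair_slab_wave x b0.
have H := etrans (esym H1) (etrans (tpair_dilate (tnth x) r2) H2); clear H1 H2.
set z := expi _ in H.
have z0 : expi (- \sum_(k < n) c k * tnth x k) * z = 1 by rewrite /z -expiD addNr expi0.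
exact: complex_cancel z0 H.
Qed.

End SpectralReproducing.

(** * Assembly of the inequality *)

Section TupleConcentration.
Variable R : realType.
Local Open Scope complex_scope.
Local Notation tup n := (n.-tuple (measurableTypeR R)).
Local Notation lam n := (@tuple_lebesgue R n).

Lemma measurable_normc d (T : measurableType d) (F : T -> R[i]) :
  measurable_fun setT (fun y => complex.Re (F y)) ->
  measurable_fun setT (fun y => complex.Im (F y)) ->
  measurable_fun setT (fun y => Normc.normc (F y)).
Proof.
move=> m1 m2.
rewrite (_ : (fun y => _) = fun y => Num.sqrt (complex.Re (F y) ^+ 2 + complex.Im (F y) ^+ 2)); last first.
  by apply/funext => y; case: (F y).
apply: (measurableT_comp (f := @Num.sqrt R)).
  by apply: continuous_measurable; exact: sqrt_continuous.
by apply: measurable_funD; apply: measurable_funX.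
Qed.

(** [kap] is made of one-dimensional constants: [W] bounds the mass of the Poisson majorant in one
    variable and [q] its ratio to [cosker_mass]. It is therefore fixed before the dimension. The
    concentration lemmas apply to the real and imaginary parts of [modulated], with the modulus of
    [F], which modulation preserves, in the role of [G]. *)
Lemma concentration : exists kap : R, 1 <= kap /\
  forall n (F : tup n -> R[i]) (f : 'rV[R]_n -> R[i]) (v b a : 'I_n -> R) (gam : R) N (E : set (tup n)),
  (0 < n)%N -> tame F -> cmeasurable f ->
  {ae @lebesgue_measure_rV R n, forall x, f x = F (tuple_of_rV x)} ->
  (forall k, 0 < b k) -> (forall k, 0 < a k) ->
  (forall x : 'rV[R]_n, ~ (forall k, v k <= x ord0 k <= v k + b k) ->
     exists U, [/\ vanishing f U & U x]) ->
  0 < gam -> gam <= 1 -> kap * (n%:R + \sum_(k < n) a k * b k) <= N.+1%:R ->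
  measurable E ->
  (forall x, (gam%:E * (\prod_(i < n) a i)%:E <= lam n (E `&` tcbox (tnth x) a))%E) ->
  (forall p : R, 1 <= p -> (\int[lam n]_y (Normc.normc (F y) `^ p)%:E < +oo)%E ->
    ((gam / 4 * conc_level n gam N `^ p)%:E * \int[lam n]_y (Normc.normc (F y) `^ p)%:E <=
      \int[lam n]_(y in E) (Normc.normc (F y) `^ p)%:E)%E) /\
  (forall m : R, 0 < m -> {ae lam n, forall y, Normc.normc (F y) <= m} ->
    ~ {ae lam n, forall y, Normc.normc (F y) <= m / 2} ->
    (0 < lam n (E `&` [set y | (conc_level n gam N * (m / 2) <= Normc.normc (F y))%R]))%E).
Proof.
have [S [S0 HS]] := @cosker_expmaj R.
pose W := Num.max 1 (S * oneDsqrV_mass R).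
have W0 : 0 < W by rewrite lt_max ltr01.
have SW : S * oneDsqrV_mass R <= W by rewrite le_max lexx orbT.
have c0 := cosker_mass_gt0 R.
pose q := Num.max 1 (W / cosker_mass R).
have q1 : 1 <= q by rewrite le_max lexx.
have Wq : W <= q * cosker_mass R by rewrite -ler_pdivrMr// le_max lexx orbT.
have e1 : 1 <= expR (5 : R) by rewrite -[X in X <= _]expR0 ler_expR.
exists (96 * expR 5 * q); split.
  rewrite -[X in X <= _]mulr1; apply: ler_pM => //; lra.
move=> n F f v b a gam N E n0 tF cf fF b0 a0 spec g0 g1 HN mE HE.
pose M := modulated F v b.
have [m1 m2 iF] := tF.
have GM y : Normc.normc (M y) = Normc.normc (F y).
  by rewrite /M /modulated Normc.normcM normc_expi mulr1.
have [sc ss] := smooth_cos_sin R.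
have mph : measurable_fun [set: tup n] (fun y : tup n => - \sum_(k < n) (v k + b k / 2) * tnth y k : R).
  apply: (measurableT_comp (f := -%R : R -> R)) => //.
  by apply: measurable_sum => k; apply: measurable_funM => //; exact: measurable_tnth.
have mcos : measurable_fun [set: tup n] (fun y : tup n => cos (- \sum_(k < n) (v k + b k / 2) * tnth y k)).
  apply: (measurableT_comp (f := @cos R)) => //.
  by apply: continuous_measurable; exact: continuous_cos.
have msin : measurable_fun [set: tup n] (fun y : tup n => sin (- \sum_(k < n) (v k + b k / 2) * tnth y k)).
  apply: (measurableT_comp (f := @sin R)) => //.
  by apply: continuous_measurable; exact: continuous_sin.
have mu_ : measurable_fun setT (fun y => complex.Re (M y)).
  by under eq_fun do rewrite ReM; apply: measurable_funB; exact: measurable_funM.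
have mv : measurable_fun setT (fun y => complex.Im (M y)).
  by under eq_fun do rewrite ImM; apply: measurable_funD; exact: measurable_funM.
have uG y : `|complex.Re (M y)| <= Normc.normc (F y) by rewrite -GM; exact: normc_Re_le.
have vG y : `|complex.Im (M y)| <= Normc.normc (F y) by rewrite -GM; exact: normc_Im_le.
have Guv y : Normc.normc (F y) <= `|complex.Re (M y)| + `|complex.Im (M y)|.
  by rewrite -GM; exact: normc_le.
have mG := measurable_normc m1 m2.
have mw : measurable_fun setT (@tweight R n).
  by apply/measurable_EFinP; exact: measurable_int (integrable_tweight R n).
have dom (w : tup n -> R) : measurable_fun setT w -> (forall y, `|w y| <= Normc.normc (F y)) ->
    (lam n).-integrable setT (EFin \o (fun y => `|w y| * tweight y)).
  move=> mw' wG; apply: (integrable_le_norm _ _ iF).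
    by apply: measurable_funM => //; exact: measurableT_comp.
  move=> y; rewrite ger0_norm ?mulr_ge0 ?tweight_ge0//.
  by apply: ler_wpM2r; [exact: tweight_ge0|exact: wG].
have iu := dom _ mu_ uG; have iv := dom _ mv vG.
have r2 (m : nat) : (2 : R) <= m.+2%:R by rewrite ler_nat.
have aeu : {ae lam n, forall z, reproduced b (fun y => complex.Re (M y)) z}.
  apply: (reproducing_ae b0 mu_ iu) => m x.
  exact: (modulated_dilate tF cf fF b0 spec x (r2 m)).1.
have aev : {ae lam n, forall z, reproduced b (fun y => complex.Im (M y)) z}.
  apply: (reproducing_ae b0 mv iv) => m x.
  exact: (modulated_dilate tF cf fF b0 spec x (r2 m)).2.
split=> [p p1 pfin|m m0 Gm nGm].
  exact: (integral_concentration S0 HS SW W0 q1 Wq b0 a0 n0 g0 g1 HN mu_ mv mG uG vG Guv iu iv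
    aeu aev mE HE p1 pfin).
exact: (ess_sup_concentration S0 HS SW W0 q1 Wq b0 a0 n0 g0 g1 HN mu_ mv mG uG vG Guv iu iv
  aeu aev mE HE m0 Gm nGm).
Qed.

(* [D = 96 e] absorbs [48 e n] into [D ^+ n] since [n <= 2 ^+ n], and then
   [gam / 4 * conc_level >= (gam / D ^+ n) ^+ (2 N + 3)]. *)
Lemma power_le_conc_level (kap gam sg : R) n : 1 <= kap -> (0 < n)%N -> 0 < gam -> gam <= 1 ->
  0 <= sg -> exists N, kap * (n%:R + sg) <= N.+1%:R /\
  (gam / (96 * expR 1 + 6 * kap) ^+ n) `^ ((96 * expR 1 + 6 * kap) * (n%:R + sg)) <=
    gam / 4 * conc_level n gam N.
Proof.
move=> k1 n0 g0 g1 sg0; set C := 96 * expR 1 + 6 * kap.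
have n1 : (1 : R) <= n%:R by rewrite ler1n.
have L1 : 1 <= kap * (n%:R + sg) by rewrite -[X in X <= _]mulr1; apply: ler_pM => //; lra.
exists (Num.truncn (kap * (n%:R + sg))); set N := Num.truncn _.
split; first by rewrite ltW// truncnS_gt.
have NL : N%:R <= kap * (n%:R + sg) by rewrite truncn_le//; lra.
have e1 : 1 < expR (1 : R) by rewrite -[X in X < _]expR0 ltr_expR.
pose D := 96 * expR (1 : R); have D96 : 96 < D by rewrite /D; lra.
have Dn : 1 <= D ^+ n by apply: exprn_ege1; lra.
have Dn0 : 0 < D ^+ n by rewrite exprn_gt0//; lra.
have nD : 48 * expR 1 * n%:R <= D ^+ n.
  have n2 : n%:R <= 2 ^+ n :> R by rewrite -natrX ler_nat ltnW// ltn_expl.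
  have -> : D = 48 * expR 1 * 2 by rewrite /D; ring.
  have h48 : 0 <= 48 * expR (1 : R) by lra.
  rewrite exprMn; apply: (ler_pM h48 _ _ n2) => //.
  by rewrite -[X in X <= _]expr1; apply: ler_weXn2l => //; lra.
have D1n : D <= D ^+ n by rewrite -[X in X <= _]expr1; apply: ler_weXn2l => //; lra.
pose x := gam / D ^+ n.
have x0 : 0 < x by rewrite divr_gt0.
have x1 : x <= 1 by rewrite ler_pdivrMr// mul1r (le_trans g1).
have CD : D <= C by rewrite /C -/D; lra.
have y0 : 0 < gam / C ^+ n by rewrite divr_gt0// exprn_gt0//; lra.
have yx : gam / C ^+ n <= x.
  rewrite /x ler_pM2l// lef_pV2 ?posrE ?exprn_gt0//; [|lra|lra].
  by rewrite lerXn2r ?nnegrE//; lra.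
apply: (@le_trans _ _ (x `^ (2 * N.+1%:R + 1))).
  apply: (@le_trans _ _ (x `^ (C * (n%:R + sg)))).
    by apply: ge0_ler_powR; rewrite ?nnegrE ?(ltW x0) ?(ltW y0)// mulr_ge0//; lra.
  apply: ger_powR; first by rewrite x0.
  (* With [L = kap * (n + sg)], the exponent [2 * N.+1 + 1] is at most [2 * L + 3], hence at most
     [6 * L] since [L >= 1]. *)
  have : 6 * (kap * (n%:R + sg)) <= C * (n%:R + sg).
    rewrite mulrA; apply: ler_wpM2r; first by lra.
    rewrite /C; lra.
  rewrite -natr1; lra.
rewrite (_ : 2 * N.+1%:R + 1 = (1 + 2 * N.+1)%N%:R :> R); last by rewrite natrD natrM addrC.
rewrite powR_mulrn ?(ltW x0)// exprD expr1 exprM /conc_level mulrA.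
rewrite [leRHS](_ : _ = gam / 32 * (gam ^+ 2 / (48 * expR 1 * n%:R)) ^+ N.+1); last by field.
apply: ler_pM.
- exact: ltW.
- by rewrite exprn_ge0// exprn_ge0// ltW.
(* The 32 is absorbed by [D ^+ n >= D > 96]. *)
- by rewrite /x ler_pM2l// lef_pV2 ?posrE//; lra.
have den0 : 0 < 48 * expR 1 * n%:R :> R by rewrite !mulr_gt0//; lra.
apply: lerXn2r; rewrite ?nnegrE ?exprn_ge0 ?(ltW x0)//.
  by rewrite divr_ge0 ?exprn_ge0 ?(ltW g0) ?(ltW den0).
rewrite /x expr_div_n ler_pM2l ?exprn_gt0// lef_pV2 ?posrE ?exprn_gt0//.
by rewrite (le_trans nD)// expr2 ler_peMr// ltW.
lra.
Qed.

End TupleConcentration.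

(** * Borel models of Lebesgue measurable data and transport of norms *)

Section BorelModel.
Variables (R : realType) (n : nat).
Local Open Scope complex_scope.
Local Notation tup := (n.-tuple (measurableTypeR R)).
Local Notation lam := (@tuple_lebesgue R n).
Local Notation leb := (@lebesgue_measure_rV R n).
Local Notation Rn := 'rV[R]_n.

(** A single null set [N] serves the real part, the imaginary part and [E]; on it the model of [f]
    is set to 0, which keeps it Borel. *)
Lemma borel_model (f : Rn -> R[i]) (E : set Rn) : cmeasurable f ->
  measurable (E : set (lebesgue_rV R n)) ->
  exists (N : set (rV_borel R n)) (F : tup -> R[i]) (E' : set tup),
  [/\ measurable N, leb N = 0%E,
      measurable_fun setT (fun y => complex.Re (F y)),
      measurable_fun setT (fun y => complex.Im (F y)) &
      measurable E' /\
      forall x, ~ N x -> f x = F (tuple_of_rV x) /\ (E x <-> E' (tuple_of_rV x))].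
Proof.
move=> [m1 m2] mE; have sf := borel_lebesgue_sigma_finite R n.
have [N1 [mN1 N10 H1]] := caratheodory_measurable_fun sf m1.
have [N2 [mN2 N20 H2]] := caratheodory_measurable_fun sf m2.
have [B [N3 [mB mN3 N30 H3]]] := caratheodory_hull sf mE.
pose N := N1 `|` N2 `|` N3.
have mN : measurable N by do 2 apply: measurableU => //.
have mr := @measurable_rV_of_tuple R n.
pose g1 := (fun x => complex.Re (f x)) \_ (~` N).
pose g2 := (fun x => complex.Im (f x)) \_ (~` N).
have mg1 : measurable_fun [set: rV_borel R n] g1 by apply: H1 => // x Nx; left; left.
have mg2 : measurable_fun [set: rV_borel R n] g2 by apply: H2 => // x Nx; left; right.
exists N, (fun t => g1 (rV_of_tuple t) +i* g2 (rV_of_tuple t)), (@rV_of_tuple R n @^-1` B).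
split => //.
- have N12 : (@borel_lebesgue R n (N1 `|` N2) <= 0)%E.
    by rewrite -[X in (_ <= X)%E](adde0 0%E) -{1}N10 -N20; apply: measureU2.
  rewrite lebesgue_measure_rV_borel// -[LHS]/(@borel_lebesgue R n N).
  apply/eqP; rewrite eq_le measure_ge0 andbT.
  rewrite -[X in (_ <= X)%E](adde0 0%E) -{2}N30.
  apply: (le_trans (measureU2 _ _ _)) => //; first exact: measurableU.
  exact: leeD.
- exact: (measurableT_comp mg1 mr).
- exact: (measurableT_comp mg2 mr).
split; first by rewrite -[X in measurable X]setTI; exact: mr.
move=> x nNx; split; last by rewrite /preimage/= tuple_of_rVK; apply: H3 => N3x; apply: nNx; right.
rewrite tuple_of_rVK; apply: complexRI; rewrite /= /g1 /g2 patchE mem_set//.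
Qed.

End BorelModel.

Section NormTransport.
Variables (R : realType) (n : nat).
Local Open Scope complex_scope.
Local Notation tup := (n.-tuple (measurableTypeR R)).
Local Notation lam := (@tuple_lebesgue R n).
Local Notation leb := (@lebesgue_measure_rV R n).
Local Notation Rn := 'rV[R]_n.

Lemma Lpnorm_tuple (f : Rn -> R[i]) (F : tup -> R[i]) (S N : set Rn) (S' : set tup) (p : R) :
  1 <= p -> cmeasurable f -> measurable (S : set (lebesgue_rV R n)) -> measurable S' ->
  measurable_fun setT (fun y => complex.Re (F y)) ->
  measurable_fun setT (fun y => complex.Im (F y)) ->
  leb.-negligible N ->
  (forall x, ~ N x -> f x = F (tuple_of_rV x) /\ (S x <-> S' (tuple_of_rV x))) ->
  Lpnorm p%:E S f = ((\int[lam]_(y in S') (Normc.normc (F y) `^ p)%:E) `^ p^-1)%E.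
Proof.
move=> p1 [mf1 mf2] mS mS' m1 m2 N0 H; have p0 : p != 0 by rewrite gt_eqF//; lra.
pose r (x : Rn) : R := `|((fun x => Normc.normc (f x)) \_ S) x| `^ p.
have mr : measurable_fun [set: lebesgue_rV R n] r.
  apply: (measurableT_comp (measurable_powR p)); apply: (measurableT_comp (@normr_measurable R setT)).
  by apply/(measurable_restrictT _ mS); apply: measurable_funTS; exact: measurable_normc.
have -> : Lpnorm p%:E S f = ((\int[leb]_x (r x)%:E) `^ p^-1)%E by rewrite /Lpnorm unlock.
congr (poweR _ _).
pose g (y : tup) : \bar R := ((Normc.normc (F y) `^ p) * \1_S' y)%:E.
have mg : measurable_fun setT g.
  apply/measurable_EFinP; apply: measurable_funM; last exact: measurable_indic.
  by apply: (measurableT_comp (measurable_powR p)); exact: measurable_normc.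
transitivity (\int[leb]_x g (tuple_of_rV x))%E.
  apply: ae_eq_integral.
  - exact: measurableT.
  - exact/measurable_EFinP.
  - exact: (measurableT_comp mg (@measurable_tuple_of_rV R n)).
  - apply: negligibleS N0 => x /= nx; apply: contrapT => nN; apply: nx => _.
    have [fx Sx] := H x nN; rewrite /g /r patchE indicE.
    case: (boolP (x \in S)) => xS.
      rewrite mem_set ?mulr1; last by apply/Sx; move: xS; rewrite inE.
      by rewrite /= ger0_norm ?normc_ge0R// fx.
    rewrite memNset ?mulr0/=; last by move=> /Sx; move/negP: xS; rewrite inE.
    by rewrite normr0 powR0.
rewrite ge0_integral_rV//; last by move=> y; rewrite lee_fin mulr_ge0// powR_ge0.
rewrite [RHS]integral_mkcond; apply: eq_integral => y _.
by rewrite /g patchE indicE; case: ifP => _; rewrite ?mulr1 ?mulr0.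
Qed.

(** By [t <= 1 + t ^ p] and [tweight <= 1], the weighted modulus is at most the weight plus the
    [p]-th power of the modulus. *)
Lemma tame_Lp (F : tup -> R[i]) (p : R) : 1 <= p ->
  measurable_fun setT (fun y => complex.Re (F y)) ->
  measurable_fun setT (fun y => complex.Im (F y)) ->
  (\int[lam]_y (Normc.normc (F y) `^ p)%:E < +oo)%E -> tame F.
Proof.
move=> p1 m1 m2 fin; split => //; have mG := measurable_normc m1 m2.
have mw : measurable_fun setT (@tweight R n).
  by apply/measurable_EFinP; exact: measurable_int (integrable_tweight R n).
have ig : lam.-integrable setT (EFin \o (fun y => Normc.normc (F y) `^ p)).
  apply/integrableP; split.
    by apply/measurable_EFinP; exact: (measurableT_comp (measurable_powR p)).
  by under eq_integral do rewrite /= ger0_norm ?powR_ge0//.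
apply: (integrable_le_norm _ _ (integrableD_EFin (integrable_tweight R n) ig)).
  exact: measurable_funM.
move=> y; have w0 := tweight_ge0 y; have G0 := normc_ge0R (F y).
have w1 : tweight y <= 1.
  apply: (@le_trans _ _ (\prod_(i < n) 1)); last by rewrite big1.
  apply: ler_prod => i _; have h : 1 <= 1 + tnth y i ^+ 2 by rewrite lerDl sqr_ge0.
  rewrite invr_ge0 (le_trans ler01 h)/= invf_le1// (lt_le_trans ltr01 h)//.
rewrite ger0_norm ?mulr_ge0//.
apply: (le_trans (ler_wpM2r w0 (lerD1_powR G0 p1))).
by rewrite mulrDl mul1r lerD2l ler_piMr// powR_ge0.
Qed.

Lemma tame_Loo (F : tup -> R[i]) (m : R) :
  measurable_fun setT (fun y => complex.Re (F y)) ->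
  measurable_fun setT (fun y => complex.Im (F y)) ->
  {ae lam, forall y, Normc.normc (F y) <= m} -> tame F.
Proof.
move=> m1 m2 Fm; split => //; have mG := measurable_normc m1 m2.
have mw : measurable_fun setT (@tweight R n).
  by apply/measurable_EFinP; exact: measurable_int (integrable_tweight R n).
have im := integrableZr_EFin `|m| (integrable_tweight R n).
apply/integrableP; split; first by apply/measurable_EFinP; exact: measurable_funM.
apply: (@le_lt_trans _ _ (\int[lam]_y (`|m| * tweight y)%:E)%E).
  apply: ae_ge0_le_integral => //.
  - by apply: measurableT_comp => //; apply/measurable_EFinP; exact: measurable_funM.
  - by move=> y _; rewrite lee_fin mulr_ge0// tweight_ge0.
  - by apply/measurable_EFinP; exact: measurable_funM.
  apply: filterS Fm => y Fy _; rewrite /= lee_fin ger0_norm ?mulr_ge0 ?tweight_ge0 ?normc_ge0R//.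
  by apply: ler_wpM2r; [exact: tweight_ge0|rewrite (le_trans Fy)// ler_norm].
have := integrable_fin_num measurableT im; rewrite fin_numE => /andP[_].
by rewrite lt_neqAle leey andbT.
Qed.

(** The norm of exponent [+oo] is defined by cases on the measure of the whole space, hence the
    hypothesis. *)
Lemma Lpnorm_ooE (f : Rn -> R[i]) (S : set Rn) : (0 < leb setT)%E ->
  Lpnorm +oo%E S f = ess_sup leb (fun x => `|((fun x => Normc.normc (f x)) \_ S) x|%:E).
Proof. by move=> l0; rewrite /Lpnorm unlock l0. Qed.

Lemma negligible_preimage (A : set tup) : measurable A ->
  leb.-negligible (@tuple_of_rV R n @^-1` A) -> lam A = 0%E.
Proof.
move=> mA; rewrite -lebesgue_measure_rV_preimage// => H.
apply: (measure_negligible _ H).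
by rewrite -[X in measurable X]setTI; exact: measurable_tuple_of_rV.
Qed.

Lemma box_preimage (c : Rn) (a : 'I_n -> R) :
  box c a = @tuple_of_rV R n @^-1` tcbox (c ord0) a.
Proof.
by apply/seteqP; split => x H k; have := H k; rewrite /= tnth_mktuple.
Qed.

Lemma translate_box_preimage (c x : Rn) (a : 'I_n -> R) :
  translate (box c a) x = @tuple_of_rV R n @^-1` tcbox ((c + x) ord0) a.
Proof.
apply/seteqP; split => [_ [y yB <-] k|y yB].
  have := yB k; rewrite tnth_mktuple !mxE => /andP[h1 h2].
  by rewrite lerD2r h1/= addrAC lerD2r.
exists (y - x); last by rewrite subrK.
move=> k; have := yB k; rewrite tnth_mktuple !mxE => /andP[h1 h2].
by rewrite lerBrDr h1/= lerBlDr addrAC.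
Qed.

End NormTransport.

Theorem theorem3 (R : realType) :
  exists C : R, 0 < C /\
  forall (d : nat) (a b : 'I_d -> R) (gamma : R) (p : \bar R)
    (u v : 'rV[R]_d) (E : set 'rV[R]_d) (f : 'rV[R]_d -> R[i]),
  (1 <= d)%N ->
  (forall k, 0 < a k) ->
  (forall k, 0 < b k) ->
  0 < gamma ->
  (1 <= p)%E ->
  let Pi := box u a in
  let J := box v b in
  measurable (E : set (lebesgue_rV R d)) ->
  (forall x : 'rV[R]_d,
    (gamma%:E * lebesgue_measure_rV Pi
      <= lebesgue_measure_rV (E `&` translate Pi x))%E) ->
  in_Lp p f ->
  distribution_supp (fourier_distribution f) `<=` J ->
  (Lpnorm p E f >=
    ((gamma / C ^+ d) `^ (C * (d%:R + \sum_(k < d) a k * b k)))%:E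
      * Lpnorm p [set: 'rV[R]_d] f)%E.
Proof.
have [kap [k1 conc]] := @concentration R.
pose C := 96 * expR 1 + 6 * kap.
have e1 := expR_gt0 (1 : R).
have C0 : 0 < C by rewrite /C; lra.
exists C; split => // d a b gamma p u v E f d1 a0 b0 g0 p1 Pi J mE HE [cf fin] spec.
have [N [F [E' [mN N0 m1 m2 [mE' H]]]]] := borel_model cf mE.
have Nneg : (@lebesgue_measure_rV R d).-negligible N by exists N; split => //; exact: borel_sub_lebesgue_rV.
have fF : {ae @lebesgue_measure_rV R d, forall x, f x = F (tuple_of_rV x)}.
  by apply: negligibleS Nneg => x /= nx; apply: contrapT => /H[].
pose V := \prod_(i < d) a i.
have V0 : 0 < V by exact: prodr_gt0.
have lPi : lebesgue_measure_rV Pi = V%:E.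
  by rewrite /Pi box_preimage lebesgue_measure_rV_preimage ?lam_tcbox//; exact: measurable_tcbox.
have HE' x : (gamma%:E * V%:E <= tuple_lebesgue d (E' `&` tcbox (tnth x) a))%E.
  have mB : measurable (tcbox (tnth x) a) by exact: measurable_tcbox.
  have mEB := measurableI _ _ mE' mB.
  (* This translation moves the lowest corner [u] of [Pi] to [x]. *)
  have := HE (rV_of_tuple x - u); rewrite lPi => /le_trans; apply.
  rewrite /Pi translate_box_preimage addrC subrK.
  rewrite (_ : tcbox (rV_of_tuple x ord0) a = tcbox (tnth x) a); last first.
    by congr tcbox; apply/funext => k; rewrite mxE.
  rewrite -lebesgue_measure_rV_preimage// -[leRHS]adde0 -N0.
  have mP : measurable (@tuple_of_rV R d @^-1` (E' `&` tcbox (tnth x) a) : set (lebesgue_rV R d)).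
    by rewrite -[X in measurable X]setTI; exact: measurable_tuple_of_rV.
  have mN' := borel_sub_lebesgue_rV mN.
  apply: (le_trans _ (measureU2 _ _ _)) => //.
  apply: le_measure; rewrite ?inE//.
  - apply: measurableI => //; rewrite -[X in measurable X]setTI; exact: measurable_tuple_of_rV.
  - exact: measurableU.
  move=> y [Ey By]; have [Ny|nNy] := pselect (N y); [by right|left].
  by split => //; apply/(H y nNy).2.
(* [E'] cannot occupy more than the whole of a box. *)
have g1 : gamma <= 1.
  pose x := @tuple_of_rV R d 0; have mB : measurable (tcbox (tnth x) a) by exact: measurable_tcbox.
  have LE : (tuple_lebesgue d (E' `&` tcbox (tnth x) a) <= V%:E)%E.
    apply: (@le_trans _ _ (tuple_lebesgue d (tcbox (tnth x) a))).
      by apply: le_measure; rewrite ?inE//; exact: measurableI.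
    by have /eqP := lam_tcbox (tnth x) a0; rewrite eq_le => /andP[].
  by have := le_trans (HE' x) LE; rewrite -EFinM lee_fin ger_pMl.
have sg0 : 0 <= \sum_(k < d) a k * b k by apply: sumr_ge0 => k _; rewrite mulr_ge0 ?ltW.
have [M [HM Hpow]] := power_le_conc_level k1 d1 g0 g1 sg0.
(* The contrapositive of the support hypothesis: a point off [J] lies in an open set where the
   distribution vanishes. *)
have spec' (x : 'rV[R]_d) : ~ (forall k, v ord0 k <= x ord0 k <= v ord0 k + b k) ->
    exists U, [/\ vanishing f U & U x].
  move=> nJ; apply: contrapT => nU; apply: nJ; apply: spec => -[U /= VU Ux].
  by apply: nU; exists U.
have conc' tF := conc d F f _ b a gamma M E' d1 tF cf fF b0 a0 spec' g0 g1 HM mE' HE'.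
set c := _ `^ _; have cle : c <= gamma / 4 * conc_level d gamma M by exact: Hpow.
have cl0 : 0 < conc_level d gamma M by exact: conc_level_gt0.
have c0 : 0 <= c by exact: powR_ge0.
have mT : measurable ([set: 'rV[R]_d] : set (lebesgue_rV R d)) by exact: measurableT.
have HT x : ~ N x -> f x = F (tuple_of_rV x) /\ ([set: 'rV[R]_d] x <-> [set: d.-tuple R] (tuple_of_rV x)).
  by move=> /H[].
case: p p1 fin => [p||//]; last first.
  move=> _; have lT : (0 < @lebesgue_measure_rV R d setT)%E.
    apply: (@lt_le_trans _ _ V%:E); first by rewrite lte_fin.
    rewrite -lPi; apply: le_measure => //; rewrite inE//.
    by rewrite /Pi box_preimage; apply: borel_sub_lebesgue_rV; exists (tcbox (u ord0) a);
       [exact: measurable_tcbox|rewrite setTI].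
  have LT := Lpnorm_ooE f setT lT; have LE := Lpnorm_ooE f E lT.
  set mT' := Lpnorm +oo%E _ f in LT * => fin.
  have aT x : ~ N x -> (`|((fun x => Normc.normc (f x)) \_ setT) x|%:E = (Normc.normc (F (tuple_of_rV x)))%:E)%E.
    by move=> /H[fx _]; rewrite patchT ?in_setT// ger0_norm ?normc_ge0R// fx.
  have mT0 : (0 <= mT')%E by exact: Lnorm_ge0.
  have mTE : mT' = (fine mT')%:E by rewrite fineK// ge0_fin_numE.
  have [m0|m0] := leP (fine mT') 0.
    have -> : mT' = 0%E by rewrite mTE; congr EFin; apply/le_anti; rewrite m0/= fine_ge0.
    by rewrite mule0; exact: Lnorm_ge0.
  set m := fine mT' in mTE m0.
  have mG := measurable_normc m1 m2.
  have mlt r : measurable [set y | r < Normc.normc (F y)].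
    rewrite (_ : [set y | _] = ~` [set y | Normc.normc (F y) <= r]).
      apply: measurableC; rewrite -[X in measurable X]setTI; exact: measurable_fun_le.
    by apply/seteqP; split => y /=; rewrite ltNge => /negP.
  have Gm : {ae tuple_lebesgue d, forall y, Normc.normc (F y) <= m}.
    exists [set y | m < Normc.normc (F y)]; split => //; last first.
      by move=> y /= /negP; rewrite -ltNge.
    apply: negligible_preimage => //.
    have := negligibleU Nneg (ess_sup_ge (@lebesgue_measure_rV R d)
      (fun x => `|((fun x => Normc.normc (f x)) \_ setT) x|%:E)).
    apply: negligibleS => x /= mx; have [Nx|nNx] := pselect (N x); [by left|right].
    rewrite /= aT// -LT mTE lee_fin => h; by rewrite ltNge h in mx.
  have tF := tame_Loo m1 m2 Gm.
  have [_ /(_ m m0 Gm) K] := conc' tF.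
  have nG : ~ {ae tuple_lebesgue d, forall y, Normc.normc (F y) <= m / 2}.
    move=> [B [mB B0 GB]].
    have : (mT' <= (m / 2)%:E)%E.
      rewrite LT; apply/ess_supP; have : (@lebesgue_measure_rV R d).-negligible (@tuple_of_rV R d @^-1` B).
        exists (@tuple_of_rV R d @^-1` B); split => //.
          by rewrite -[X in measurable X]setTI; exact: measurable_tuple_of_rV.
        by rewrite lebesgue_measure_rV_preimage.
      move=> /(negligibleU Nneg); apply: negligibleS => x /= nx.
      have [Nx|nNx] := pselect (N x); [by left|right].
      by apply: GB => /= h; apply: nx; rewrite aT.
    by rewrite mTE lee_fin; lra.
  have {}K := K nG.
  (* If the inequality failed, the modulus would be below [c * m] almost everywhere on [E']. It is
     at least [conc_level d gamma M * (m / 2)] on a part of positive measure, and [c * m] is no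
     larger than that. *)
  rewrite leNgt LE; apply/negP => lt.
  have mA : measurable (E' `&` [set y | conc_level d gamma M * (m / 2) <= Normc.normc (F y)]).
    apply: measurableI => //; rewrite -[X in measurable X]setTI; exact: measurable_fun_le.
  move: K; rewrite (negligible_preimage mA) ?ltxx//.
  have := negligibleU Nneg (ess_sup_ge (@lebesgue_measure_rV R d)
      (fun x => `|((fun x => Normc.normc (f x)) \_ E) x|%:E)).
  apply: negligibleS => x /= [E'x Gx]; have [Nx|nNx] := pselect (N x); [by left|right].
  rewrite /= patchE mem_set; last by apply/(H x nNx).2.
  rewrite ger0_norm ?normc_ge0R// (H x nNx).1 => h.
  have := le_lt_trans h lt; rewrite mTE -EFinM lte_fin ltNge => /negP; apply.
  apply: le_trans Gx; rewrite -/m.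
  apply: (@le_trans _ _ (gamma / 4 * conc_level d gamma M * m)); first by rewrite ler_pM2r.
  have : gamma * conc_level d gamma M * m <= conc_level d gamma M * m.
    by rewrite -mulrA ler_piMl// mulr_ge0 ?ltW.
  have : 0 <= conc_level d gamma M * m by exact: mulr_ge0 (ltW cl0) (ltW m0).
  lra.
rewrite lee_fin => p1.
have NT := Lpnorm_tuple p1 cf mT measurableT m1 m2 Nneg HT.
have NE := Lpnorm_tuple p1 cf mE mE' m1 m2 Nneg H.
have p0 : p != 0 by rewrite gt_eqF//; lra.
have pV0 : 0 <= p^-1 by rewrite invr_ge0; lra.
rewrite NT NE => /(lty_poweRy (invr_neq0 p0)) fin.
have tF := tame_Lp p1 m1 m2 fin.
have [/(_ p p1 fin) K _] := conc' tF.
set I := (\int[_]_y _)%E in K fin *; set I' := (\int[_]_(y in E') _)%E in K *.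
have I0 : (0 <= I)%E by apply: integral_ge0 => y _; rewrite lee_fin powR_ge0.
(* As [gamma / 4 <= 1] and [p >= 1], the power [(gamma / 4) ^ p] is at most [gamma / 4]; so a
   constant [c] free of [p] survives the [p]-th root. *)
have cp : c `^ p <= gamma / 4 * conc_level d gamma M `^ p.
  apply: (@le_trans _ _ ((gamma / 4 * conc_level d gamma M) `^ p)).
    by apply: ge0_ler_powR; rewrite ?nnegrE//; lra.
  rewrite powRM ?(ltW cl0)//; last by lra.
  by apply: ler_wpM2r; [exact: powR_ge0|apply: ge1r_powR => //; lra].
have -> : c%:E = ((c `^ p)%:E `^ p^-1)%E by rewrite poweR_EFin -powRrM mulfV// powRr1.
rewrite -poweRM ?lee_fin ?powR_ge0//.
apply: gt0_ler_poweR => //.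
- by rewrite in_itv/= mule_ge0 ?lee_fin ?powR_ge0//= leey.
- by rewrite in_itv/= leey andbT; apply: integral_ge0 => y _; rewrite lee_fin powR_ge0.
- by apply: le_trans K; apply: lee_wpmul2r => //; rewrite lee_fin.
Qed.
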